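(* There are universal constants $C,c>0$ such that the following holds. Let $G\in L^1(\mathbb R)$ be even with integrable weak derivative $K:=G'\in L^1(\mathbb R)$. If $u_0\in L^2\cap L^\infty(\mathbb R)$ satisfies $$[u_0]_s^{3+2s}>c\,|K|_{TV^s}^{2+s}\,\|u_0\|_{L^2(\mathbb R)}^{1+s}$$ for some $s\in[0,1]$ such that $|K|_{TV^s}<\infty$, then the lifespan $T$ of a classical solution $u\in L^\infty\cap C^1((0,T)\times\mathbb R)$ of $$u_t+\tfrac12(u^2)_x=(G\ast u)_x$$ admitting $u_0$ as initial data must satisfy $$T<C\Bigg[\frac{\|u_0\|_{L^2(\mathbb R)}^{1-s}}{[u_0]_s^{3}}\Bigg]^{\frac1{2+s}}.$$
   Context: All functions are real valued. ''Universal'' means that $C$ and $c$ do not depend on $G$, $s$, $u_0$ or $u$. For $s\in[0,1]$, $$|K|_{TV^s}=\sup_{h>0}\frac{\|K(\cdot+h)-K\|_{L^1(\mathbb R)}}{h^s},\qquad [u_0]_s:=\operatorname*{ess\,sup}_{x\in\mathbb R,\ h>0}\frac{u_0(x-h)-u_0(x)}{h^{\frac{1+s}{2}}}.$$ Convolution acts in $x$: $(G\ast u)(t,x)=\int_{\mathbb R}G(x-y)u(t,y)\,dy$, and $(G\ast u)_x=K\ast u$. A classical solution satisfies the equation pointwise on $(0,T)\times\mathbb R$. It admits $u_0$ as initial data in the $L^1_{\mathrm{loc}}$ sense: $\lim_{t\searrow0}\int_{-r}^r|u(t,x)-u_0(x)|\,dx=0$ for all $r>0$. *)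

(* Defs.v *)
From HB Require Import structures.
From mathcomp Require Import all_boot all_order all_algebra.
From mathcomp Require Import all_classical all_reals all_analysis.
From mathcomp Require Import ess_sup_inf.

Set Implicit Arguments.
Unset Strict Implicit.
Unset Printing Implicit Defensive.

Import Order.TTheory GRing.Theory Num.Theory.
Import numFieldNormedType.Exports.

Local Open Scope classical_set_scope.
Local Open Scope ring_scope.

(* Elements of L^p are represented by Borel functions R -> R. All notions below
   that involve G, K or u0 are unchanged by modifications on null sets. *)

Section Defs.
Context {R : realType}.

Definition leb : {measure set (measurableTypeR R) -> \bar R} :=
  @lebesgue_measure R.

Definition leb2 :
    {measure set (measurableTypeR R * measurableTypeR R) -> \bar R} :=
  (leb \x leb)%E.

Definition TV_seminorm (s : R) (K : R -> R) : \bar R :=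
  ereal_sup [set ('N[leb]_1[EFin \o (fun x => (K (x + h) - K x)%R)]
                  / (h `^ s)%:E)%E | h in [set h : R | 0 < h]].

(* p.1 is x and p.2 is h; the value -oo discards h <= 0 from the supremum. *)
Definition one_sided_seminorm (s : R) (u0 : R -> R) : \bar R :=
  ess_sup leb2 (fun p : R * R =>
    if 0 < p.2
    then ((u0 (p.1 - p.2) - u0 p.1) / p.2 `^ ((1 + s) / 2))%:E
    else -oo%E).

Definition test_function (phi : R -> R) : Prop :=
  (forall (n : nat) (x : R), derivable (derive1n n phi) x 1) /\
  compact (closure [set x | phi x != 0]).

Definition weak_derivative (G K : R -> R) : Prop :=
  forall phi : R -> R, test_function phi ->
    Rintegral leb setT (fun x => G x * derive1 phi x)
    = - Rintegral leb setT (fun x => K x * phi x).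

Definition convol (G v : R -> R) (x : R) : R :=
  Rintegral leb setT (fun y => G (x - y) * v y).

(* The lifespan T may be infinite. *)
Definition slab (T : \bar R) : set (R * R) :=
  [set p | 0 < p.1 /\ (p.1%:E < T)%E].

(* Points of the slab are pairs (t, x), so the time derivative is 'D_(1, 0)
   and the space derivative is 'D_(0, 1). *)
Definition C1_on (D : set (R * R)) (u : R * R -> R) : Prop :=
  forall p, D p ->
    [/\ differentiable u p,
        {for p, continuous ('D_((1, 0) : R * R) u)}
      & {for p, continuous ('D_((0, 1) : R * R) u)}].

Definition Linfty_on (D : set (R * R)) (u : R * R -> R) : Prop :=
  ('N[leb2]_+oo[EFin \o (u \_ D)] < +oo)%E.

(* u_t + (u^2 / 2)_x = (G * u)_x at every point of the slab; that the right-hand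
   side exists is part of the equation, as derive1 is total. *)
Definition solves_eq (G : R -> R) (T : \bar R) (u : R * R -> R) : Prop :=
  forall t x, slab T (t, x) ->
    let Gu := convol G (fun y => u (t, y)) in
    derivable Gu x 1 /\
    'D_((1, 0) : R * R) u (t, x)
      + 2^-1 * 'D_((0, 1) : R * R) (fun p => u p ^+ 2) (t, x)
    = derive1 Gu x.

Definition initial_data (u : R * R -> R) (u0 : R -> R) : Prop :=
  forall r : R, 0 < r ->
    (\int[leb]_(x in `[(- r)%R, r]) (`|u (t, x) - u0 x|)%:E)%E @[t --> 0^'+]
      --> 0%E.

Definition classical_solution (G u0 : R -> R) (T : \bar R) (u : R * R -> R)
    : Prop :=
  [/\ Linfty_on (slab T) u, C1_on (slab T) u, solves_eq G T u
    & initial_data u u0].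

End Defs.

(* Main.v *)
From HB Require Import structures.
Require Import Defs.
From mathcomp Require Import all_boot all_order all_algebra.
From mathcomp Require Import all_classical all_reals all_analysis measurable_realfun ess_sup_inf.
From mathcomp Require Import ring lra.

(** Put [alpha = (1 + s) / 2] and call ratio of a pair of points [x < y] at time [t] the quotient
    [(u (t, x) - u (t, y)) / (y - x) `^ alpha].  The proof shows that a large ratio grows until it
    is infinite, within a time controlled by the [L^2] norm.

    The source term.  A weak derivative of an integrable function is a derivative in the usual
    integrated sense ([du_bois_reymond]), so [(G * u)_x = K * u] pointwise ([derive1_convol]), and
    [force u = u_t + u u_x] equals [K * u] ([forceE]).  If [`|u (t, _)| <= m] and [k] is the
    seminorm of [K], then [force u t] is [s]-Hoelder with constant [k m] ([force_holder]).

    Growth of the ratios.  Follow two points along their characteristics.  Their distance [h]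
    shrinks at the rate [u (t, x) - u (t, y)], hence the ratio [q] satisfies
    [q' >= alpha q ^ 2 h ^ (alpha - 1) - k m h ^ (s - alpha)].  As [s - alpha = alpha - 1], this is
    a Riccati inequality as soon as [k m <= q ^ 2 / 8] ([steepening]).  No flow is constructed:
    [pair_propagation] picks, in a compact set of triples [(t, x, y)] with a ratio above the
    solution of the Riccati equation, a triple with maximal [t], and moves it a little further
    along straight lines.

    The amplitude.  If all ratios at time [t] are at most [a] and [u (t, _)] has [L^2] norm of
    order [N], then [`|u (t, _)| `^ (2 + s)] is at most a constant times [N `^ (1 + s) * a]
    ([sup_bound]).  So as long as the ratios stay below [2 r], the amplitude is at most
    [amplitude r], and a pair of ratio [r] reaches ratio [2 r] within the time [delay r]
    ([ratio_doubling]).  The delays of [r], [2 r], [4 r], ... decrease geometrically, so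
    arbitrarily large ratios occur before [t0 + 2 * delay r]; then the crude bound on [u] is enough
    to reach a ratio incompatible with the Lipschitz continuity of [u] on compact sets
    ([collision], [blow_up]).

    The [L^2] bound.  As [G] is even, [K] is odd ([weak_derivative_odd]) and formally
    [u * (K * u)] integrates to [0], so the [L^2] norm is conserved.  Since [u] is only known to be
    bounded, the energy is localised by a weight [phi] with [`|phi'| <= phi / L].  The commutator
    of [phi] with convolution by [K] is small for the part of [K] near the origin, because [phi]
    varies slowly; for the remaining, small part of [K] it is absorbed because [phi] is built such
    that convolution by that part maps it below [eps * phi], up to an error of small integral
    ([exists_weight], [commutator_bound]).  Gronwall's inequality then bounds the integral of
    [u ^ 2] over every segment by [16 * N ^ 2] ([L2_bound]).

    The initial data.  If [r] is below the one-sided seminorm of [u0], some pair has ratio at least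
    [r] at arbitrarily small times: otherwise passing to the limit [t -> 0] for each fixed
    distance [h], and then integrating over [h], would bound the seminorm by [r]
    ([initial_difference], [one_sided_le]).  Taking [r] equal to half the seminorm, or arbitrarily
    large if the seminorm is infinite, gives the theorem ([lifespan_le]). *)

Set Implicit Arguments.
Unset Strict Implicit.
Unset Printing Implicit Defensive.

Import Order.TTheory GRing.Theory Num.Theory.
Import numFieldNormedType.Exports.

Local Open Scope classical_set_scope.
Local Open Scope ring_scope.

(** * Integration over the line and convolution *)

Section Translation.
Context {R : realType}.
Notation MR := (measurableTypeR R).
Implicit Types (f : R -> \bar R) (a : R).

Lemma measurable_addr a : measurable_fun [set: MR] (fun x : MR => (x + a : MR)).
Proof. exact: measurable_funD. Qed.

Lemma measurable_subl a : measurable_fun [set: MR] (fun x : MR => (a - x : MR)).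
Proof. exact: measurable_funB. Qed.

Lemma leb_shift a (A : set MR) : measurable A ->
  pushforward leb (fun x : MR => (x + a : MR)) A = leb A.
Proof.
move=> mA; apply/esym/lebesgue_measure_unique => //= [|_ _ [[b c]] _ <-].
  exact: measurable_addr.
rewrite /pushforward [X in _ = lebesgue_measure X](_ : _ = `](b - a), (c - a)]%classic).
  rewrite !lebesgue_measure_itv/= !lte_fin ltrD2r.
  by case: ifP => // _; rewrite -!EFinB; congr (_%:E); ring.
by apply/seteqP; split => x /=; rewrite !in_itv/= ltrBlDr lerBrDr.
Qed.

Lemma leb_reflect a (A : set MR) : measurable A ->
  pushforward leb (fun x : MR => (a - x : MR)) A = leb A.
Proof.
move=> mA; apply/esym/lebesgue_measure_unique => //= [|_ _ [[b c]] _ <-].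
  exact: measurable_subl.
rewrite /pushforward [X in _ = lebesgue_measure X](_ : _ = `[(a - c), (a - b)[%classic).
  rewrite !lebesgue_measure_itv/= !lte_fin ltrD2l ltrN2.
  by case: ifP => // _; rewrite -!EFinB; congr (_%:E); ring.
by apply/seteqP; split => x /=; rewrite !in_itv/= => /andP[? ?]; apply/andP; lra.
Qed.

Lemma ge0_integral_shift a f : measurable_fun [set: R] f ->
  (forall x, (0 <= f x)%E) ->
  (\int[leb]_x f (x + a)%R)%E = (\int[leb]_x f x)%E.
Proof.
move=> mf f0.
rewrite -(ge0_integral_pushforward (measurable_addr a) leb measurableT)//.
by apply: eq_measure_integral => [|? A mA _]; [exact: measurable_addr|exact: (leb_shift a mA)].
Qed.

Lemma ge0_integral_reflect a f : measurable_fun [set: R] f ->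
  (forall x, (0 <= f x)%E) ->
  (\int[leb]_x f (a - x)%R)%E = (\int[leb]_x f x)%E.
Proof.
move=> mf f0.
rewrite -(ge0_integral_pushforward (measurable_subl a) leb measurableT)//.
by apply: eq_measure_integral => [|? A mA _]; [exact: measurable_subl|exact: (leb_reflect a mA)].
Qed.

Lemma integrable_shift a f : leb.-integrable setT f ->
  leb.-integrable setT (fun x => f (x + a)).
Proof.
move=> /integrableP[mf iF]; apply/integrableP; split.
  exact: (measurableT_comp mf (measurable_addr a)).
rewrite (ge0_integral_shift a (f := fun x => `|f x|%E))//.
exact: measurableT_comp.
Qed.

Lemma integrable_reflect a f : leb.-integrable setT f ->
  leb.-integrable setT (fun x => f (a - x)).
Proof.
move=> /integrableP[mf iF]; apply/integrableP; split.
  exact: (measurableT_comp mf (measurable_subl a)).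
rewrite (ge0_integral_reflect a (f := fun x => `|f x|%E))//.
exact: measurableT_comp.
Qed.

Lemma integral_shift a f : leb.-integrable setT f ->
  (\int[leb]_x f (x + a)%R)%E = (\int[leb]_x f x)%E.
Proof.
move=> iF; have mf := measurable_int _ iF.
rewrite -(@integral_pushforward _ _ _ _ _ _ (measurable_addr a) leb setT f)//.
  by apply: eq_measure_integral => [|? A mA _]; [exact: measurable_addr|exact: (leb_shift a mA)].
exact: (integrable_shift a iF).
Qed.

Lemma integral_reflect a f : leb.-integrable setT f ->
  (\int[leb]_x f (a - x)%R)%E = (\int[leb]_x f x)%E.
Proof.
move=> iF; have mf := measurable_int _ iF.
rewrite -(@integral_pushforward _ _ _ _ _ _ (measurable_subl a) leb setT f)//.
  by apply: eq_measure_integral => [|? A mA _]; [exact: measurable_subl|exact: (leb_reflect a mA)].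
exact: (integrable_reflect a iF).
Qed.

Lemma Rintegral_shift a (g : R -> R) : leb.-integrable setT (EFin \o g) ->
  Rintegral leb setT (fun x => g (x + a)) = Rintegral leb setT g.
Proof. by move=> /(integral_shift a)/= ig; rewrite /Rintegral ig. Qed.

Lemma Rintegral_reflect a (g : R -> R) : leb.-integrable setT (EFin \o g) ->
  Rintegral leb setT (fun x => g (a - x)) = Rintegral leb setT g.
Proof. by move=> /(integral_reflect a)/= ig; rewrite /Rintegral ig. Qed.

Lemma ae_shift a (P : R -> Prop) :
  {ae leb, forall x, P x} -> {ae leb, forall x, P (x + a)}.
Proof.
move=> [N [mN N0 PN]]; exists ((fun x : MR => (x + a : MR)) @^-1` N); split.
- by rewrite -[X in measurable X]setTI; exact: (measurable_addr a measurableT mN).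
- by rewrite -N0; exact: (leb_shift a mN).
- by move=> x /= nP; exact: PN.
Qed.

Lemma ae_reflect a (P : R -> Prop) :
  {ae leb, forall x, P x} -> {ae leb, forall x, P (a - x)}.
Proof.
move=> [N [mN N0 PN]]; exists ((fun x : MR => (a - x : MR)) @^-1` N); split.
- by rewrite -[X in measurable X]setTI; exact: (measurable_subl a measurableT mN).
- by rewrite -N0; exact: (leb_reflect a mN).
- by move=> x /= nP; exact: PN.
Qed.

End Translation.

Section RealIntegrals.
Context {R : realType}.
Notation MR := (measurableTypeR R).
Implicit Types (D : set MR) (f g w : R -> R).

(** Integrability of a real-valued function on [D] for the Lebesgue measure. *)
Notation integ D f := (leb.-integrable D (EFin \o f)).

Lemma integ_measurable D f : measurable D -> integ D f -> measurable_fun D f.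
Proof. by move=> mD /(measurable_int _)/measurable_EFinP. Qed.

Lemma le_integ D f g : measurable D -> measurable_fun D f ->
  (forall x, D x -> `|f x| <= g x) -> integ D g -> integ D f.
Proof.
move=> mD mf fg; apply: le_integrable => //; first exact/measurable_EFinP.
by move=> x Dx /=; rewrite lee_fin (le_trans (fg x Dx))// ler_norm.
Qed.

Lemma integ_extend D f : measurable D -> (forall x, ~ D x -> f x = 0) ->
  integ D f -> integ setT f.
Proof.
move=> mD f0 /(integrable_mkcond _ mD); rewrite restrict_EFin.
rewrite (_ : f \_ D = f)//; apply/funext => x; rewrite patchE; case: ifPn => //.
by rewrite notin_setE => /f0.
Qed.

Lemma Rintegral_extend D f : (forall x, ~ D x -> f x = 0) ->
  Rintegral leb D f = Rintegral leb setT f.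
Proof.
move=> f0; rewrite Rintegral_mkcond; congr (Rintegral leb setT _).
by apply/funext => x; rewrite patchE; case: ifPn => //; rewrite notin_setE => /f0.
Qed.

Lemma integ_segment (a b : R) f : {within `[a, b], continuous f} -> integ `[a, b] f.
Proof. by move=> cf; apply: continuous_compact_integrable => //; exact: segment_compact. Qed.

Lemma leb_bnd_lty b1 b2 (a b : R) :
  (leb ([set` Interval (BSide b1 a) (BSide b2 b)] : set MR) < +oo)%E.
Proof.
have H := @lebesgue_measure_itv R (Interval (BSide b1 a) (BSide b2 b)).
rewrite [X in (X < _)%E](H : leb ([set` Interval (BSide b1 a) (BSide b2 b)] : set MR) = _).
by case: ifP => _ /=; rewrite ltry.
Qed.

Lemma integ_bounded D f M : measurable D -> (leb D < +oo)%E -> measurable_fun D f ->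
  (forall x, D x -> `|f x| <= M) -> integ D f.
Proof.
move=> mD Doo mf fM; apply: (@measurable_bounded_integrable _ MR R leb f) => //.
exists M; split; first exact: num_real.
by move=> N MN x Dx; apply: le_trans (fM x Dx) (ltW MN).
Qed.

Lemma integ_indic b1 b2 (a b : R) :
  integ setT (\1_([set` Interval (BSide b1 a) (BSide b2 b)] : set MR) : R -> R).
Proof.
refine (@integ_extend [set` Interval (BSide b1 a) (BSide b2 b)] _ _ _ _) => //.
  by move=> x nx; rewrite indicE memNset.
apply: (@integ_bounded _ _ 1) => //; first exact: leb_bnd_lty.
by move=> x _; rewrite indicE; case: (_ \in _); rewrite ?normr1 ?normr0.
Qed.

Lemma Rintegral_cst_bnd b1 b2 (a b r : R) : a < b ->
  Rintegral leb ([set` Interval (BSide b1 a) (BSide b2 b)] : set MR) (fun=> r) = r * (b - a).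
Proof.
move=> ab; rewrite Rintegral_cst//; congr (_ * _).
have H := @lebesgue_measure_itv R (Interval (BSide b1 a) (BSide b2 b)).
rewrite [X in fine X](H : leb ([set` Interval (BSide b1 a) (BSide b2 b)] : set MR) = _).
by rewrite /= lte_fin ab.
Qed.

Lemma integZl D f (r : R) : measurable D -> integ D f -> integ D (fun x => r * f x).
Proof.
move=> mD If; rewrite (_ : EFin \o _ = fun x => (r%:E * (f x)%:E)%E)//.
by apply: integrableZl.
Qed.

Lemma integZr D f (r : R) : measurable D -> integ D f -> integ D (fun x => f x * r).
Proof.
move=> mD If; rewrite (_ : EFin \o _ = fun x => ((f x)%:E * r%:E)%E)//.
by apply: integrableZr.
Qed.

Lemma integB D f g : measurable D -> integ D f -> integ D g -> integ D (fun x => f x - g x).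
Proof.
move=> mD If Ig; rewrite (_ : EFin \o _ = fun x => ((f x)%:E - (g x)%:E)%E)//.
by apply: integrableB.
Qed.

Lemma integD D f g : measurable D -> integ D f -> integ D g -> integ D (fun x => f x + g x).
Proof.
move=> mD If Ig; rewrite (_ : EFin \o _ = fun x => ((f x)%:E + (g x)%:E)%E)//.
by apply: integrableD.
Qed.

Lemma integ_norm D f : measurable D -> integ D f -> integ D (fun x => `|f x|).
Proof. by move=> mD /integrable_norm; exact. Qed.

Lemma integ_mul_bounded D f w M : measurable D -> measurable_fun D w ->
  (forall x, D x -> `|w x| <= M) -> integ D f -> integ D (fun x => f x * w x).
Proof.
move=> mD mw wM iF; apply: (@le_integ _ _ (fun x => `|f x| * M)) => //.
- by apply: measurable_funM => //; exact: integ_measurable.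
- by move=> x Dx; rewrite normrM ler_wpM2l// wM.
- rewrite (_ : EFin \o _ = fun x => (`|f x|%:E * M%:E)%E)//.
  by apply: integrableZr => //; exact: integ_norm.
Qed.

Lemma Rintegral_dct D (f_ : (R -> R)^nat) f g : measurable D ->
  (forall n, measurable_fun D (f_ n)) ->
  (forall x, D x -> f_ n x @[n --> \oo] --> f x) ->
  integ D g -> (forall n x, D x -> `|f_ n x| <= g x) ->
  Rintegral leb D (f_ n) @[n --> \oo] --> Rintegral leb D f.
Proof.
move=> mD mf_ f_f ig fg.
have mf : measurable_fun D f by exact: measurable_fun_cvg f_f.
have [||||H1 _ H2] := @dominated_convergence _ MR R leb D mD
  (fun n => EFin \o f_ n) (EFin \o f) (EFin \o g) _ _ _ ig.
- by move=> n; apply/measurable_EFinP; exact: mf_.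
- by apply/measurable_EFinP; exact: mf.
- by apply: aeW => x Dx; apply: cvg_EFin; [exact: nearW|exact: f_f].
- by apply: aeW => x n Dx; rewrite /= lee_fin fg.
apply: fine_cvg; rewrite fineK//.
exact: integrable_fin_num.
Qed.

Lemma integ_convol (K w : R -> R) M x : integ setT K -> measurable_fun [set: MR] w ->
  (forall y, `|w y| <= M) -> integ setT (fun y => K (x - y) * w y).
Proof.
move=> iK mw wM; apply: (@integ_mul_bounded _ _ _ M) => //.
exact: (integrable_reflect x iK).
Qed.

(** The convolution as an integral in the other variable. *)
Lemma convolC (K w : R -> R) M x : integ setT K -> measurable_fun [set: MR] w ->
  (forall y, `|w y| <= M) ->
  convol K w x = Rintegral leb setT (fun z => K z * w (x - z)).
Proof.
move=> iK mw wM; rewrite -(@Rintegral_reflect _ x (fun z => K z * w (x - z))).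
  by apply: eq_Rintegral => y _; rewrite subKr.
apply: (@integ_mul_bounded _ _ _ M) => //.
exact: (measurableT_comp mw (measurable_subl x)).
Qed.

Lemma Rintegral_norm_le D f g : measurable D -> integ D f -> integ D g ->
  (forall x, D x -> `|f x| <= g x) ->
  `|Rintegral leb D f| <= Rintegral leb D g.
Proof.
move=> mD iF iG fg; apply: (le_trans (le_normr_Rintegral mD iF)).
by apply: le_Rintegral => //; exact: integ_norm.
Qed.

Lemma convol_bounded (K w : R -> R) M x : integ setT K -> measurable_fun [set: MR] w ->
  (forall y, `|w y| <= M) ->
  `|convol K w x| <= M * Rintegral leb setT (fun z => `|K z|).
Proof.
move=> iK mw wM; rewrite (convolC _ iK mw wM) -RintegralZl//; last exact: integ_norm.
apply: Rintegral_norm_le => //.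
- apply: (@integ_mul_bounded _ _ _ M) => //.
  exact: (measurableT_comp mw (measurable_subl x)).
- rewrite (_ : EFin \o _ = fun x => (M%:E * `|K x|%:E)%E)//.
  by apply: integrableZl => //; exact: integ_norm.
- by move=> z _; rewrite normrM mulrC ler_wpM2r.
Qed.

Lemma continuous_convol (K w : R -> R) M : integ setT K -> continuous w ->
  (forall y, `|w y| <= M) -> continuous (convol K w).
Proof.
move=> iK cw wM x.
have mw : measurable_fun [set: MR] w by exact: continuous_measurable_fun.
rewrite (_ : convol K w = fun x => Rintegral leb setT (fun z => K z * w (x - z))); last first.
  by apply/funext => y; rewrite (convolC _ iK mw wM).
have I : integ setT (fun z => `|K z| * M).
  rewrite (_ : EFin \o _ = fun x => (`|K x|%:E * M%:E)%E)//.
  by apply: integrableZr => //; exact: integ_norm.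
apply: (@continuity_under_integral _ _ MR leb (fun x z => K z * w (x - z)) setT measurableT
   (x - 1) (x + 1) _ _ (fun z => `|K z| * M)) => //.
- move=> y _; apply: (@integ_mul_bounded _ _ _ M) => //.
  exact: (measurableT_comp mw (measurable_subl y)).
- apply: aeW => z _ y _; apply: cvgM; first exact: cvg_cst.
  apply: (@cvg_comp _ _ _ (fun y => y - z) w _ (nbhs (y - z))); last exact: cw.
  by apply: cvgB; [exact: cvg_id|exact: cvg_cst].
- by move=> y _; apply: aeW => z _; rewrite normrM ler_wpM2l.
- by rewrite inE/= in_itv/=; apply/andP; split; lra.
Qed.

(** Fubini's theorem for a real-valued function whose absolute integrals over one variable have
    an integrable majorant [a]. *)
Lemma Rintegral_fubini (f : R * R -> R) (a : R -> R) :
  measurable_fun [set: MR * MR] f ->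
  (forall x, integ setT (fun y => f (x, y))) ->
  (forall y, integ setT (fun x => f (x, y))) ->
  integ setT a -> (forall x, Rintegral leb setT (fun y => `|f (x, y)|) <= a x) ->
  [/\ integ setT (fun x => Rintegral leb setT (fun y => f (x, y))),
     integ setT (fun y => Rintegral leb setT (fun x => f (x, y))) &
     Rintegral leb setT (fun x => Rintegral leb setT (fun y => f (x, y))) =
     Rintegral leb setT (fun y => Rintegral leb setT (fun x => f (x, y)))].
Proof.
move=> mf ix iy ia fa.
have mf' : measurable_fun [set: MR * MR] (EFin \o f) by exact/measurable_EFinP.
have If : (leb \x leb)%E.-integrable [set: MR * MR] (EFin \o f).
  apply/integrable12ltyP => //; apply: (@le_lt_trans _ _ (\int[leb]_x (a x)%:E)%E); last first.
    by have := integrable_fin_num measurableT ia; rewrite fin_numElt => /andP[].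
  apply: ge0_le_integral => //.
  - by move=> x _; exact: integral_ge0.
  - apply: (@measurable_fun_fubini_tonelli_F _ _ MR MR R leb (fun p => `|(EFin \o f) p|%E)) => //.
    exact: measurableT_comp.
  - exact: measurable_int ia.
  - move=> x _; rewrite -[leLHS]fineK; first by rewrite lee_fin; exact: fa.
    have := integrable_fin_num measurableT (integ_norm measurableT (ix x)).
    by [].
have E1 x : (\int[leb]_y (f (x, y))%:E)%E = (Rintegral leb setT (fun y => f (x, y)))%:E.
  by rewrite fineK//; exact: integrable_fin_num (ix x).
have E2 y : (\int[leb]_x (f (x, y))%:E)%E = (Rintegral leb setT (fun x => f (x, y)))%:E.
  by rewrite fineK//; exact: integrable_fin_num (iy y).
split.
- rewrite (_ : EFin \o _ = fubini_F leb (EFin \o f)); first exact: integrable_fubini_F If.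
  by apply/funext => x; rewrite /fubini_F/= -E1.
- pose g (p : R * R) := f (p.2, p.1).
  have mg : measurable_fun [set: MR * MR] (EFin \o g).
    exact: (measurableT_comp mf' (@measurable_swap _ _ MR MR)).
  have Ig : (leb \x leb)%E.-integrable [set: MR * MR] (EFin \o g).
    apply/integrable12ltyP => //.
    have H := (@integrable21ltyP _ _ MR MR R leb leb _ mf').1 If.
    exact: H.
  rewrite (_ : EFin \o _ = fubini_F leb (EFin \o g)); first exact: integrable_fubini_F Ig.
  by apply/funext => y; rewrite /fubini_F/= -E2.
- congr fine; transitivity (\int[leb]_x \int[leb]_y (EFin \o f) (x, y))%E.
  by apply: eq_integral => x _; exact/esym/E1.
by rewrite (Fubini If); apply: eq_integral => y _; exact: E2.
Qed.

End RealIntegrals.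
Notation integ D f := (leb.-integrable D (EFin \o f)).

(** * Pairs of points moving along characteristics *)

Section Transport.
Context {R : realType}.
Implicit Types (u : R * R -> R) (T : \bar R).

Lemma is_derive_path u (p v : R * R) : differentiable u p ->
  is_derive (0 : R) 1 (fun d : R => u (p + d *: v)) ('D_v u p).
Proof.
move=> du; have cu : derivable u p v by apply: diff_derivable.
have E : (fun h : R => h^-1 *: (((fun d : R => u (p + d *: v)) \o shift 0) (h *: 1)
   - u (p + 0 *: v))) = (fun h : R => h^-1 *: ((u \o shift p) (h *: v) - u p)).
  apply/funext => h /=.
  by rewrite addr0 scale0r addr0 [(h *: v + p)%R]addrC -[h *: 1]/(h * 1) mulr1.
apply: DeriveDef; first by rewrite /derivable E.
by rewrite /derive E.
Qed.

Lemma deriveDE u (p : R * R) (a : R) : differentiable u p ->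
  'D_((1, a) : R * R) u p =
    'D_((1, 0) : R * R) u p + a * 'D_((0, 1) : R * R) u p.
Proof.
move=> du; rewrite !deriveE// -[_ * _]/(a *: _) -linearZ -linearD.
congr ('d u p _); apply/eqP; rewrite xpair_eqE/=.
by rewrite -[_ *: 0]/(a * 0) -[_ *: 1]/(a * 1) mulr0 mulr1 addr0 add0r !eqxx.
Qed.

Lemma is_derive_char u t x a : differentiable u (t, x) ->
  is_derive (0 : R) 1 (fun d : R => u (t + d, x + d * a))
    ('D_((1, 0) : R * R) u (t, x) + a * 'D_((0, 1) : R * R) u (t, x)).
Proof.
move=> du; rewrite -deriveDE//; have := is_derive_path (1, a) du.
congr is_derive; apply/funext => d; congr u.
by apply/eqP; rewrite xpair_eqE/= -[_ *: 1]/(d * 1) mulr1 !eqxx.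
Qed.

Lemma is_derive_space u t x : differentiable u (t, x) ->
  is_derive x 1 (fun y : R => u (t, y)) ('D_((0, 1) : R * R) u (t, x)).
Proof.
move=> du; have cu : derivable u (t, x) (0, 1) by apply: diff_derivable.
have E : (fun h : R => h^-1 *: (((fun y : R => u (t, y)) \o shift x) (h *: 1)
   - u (t, x))) = (fun h : R => h^-1 *: ((u \o shift (t, x)) (h *: (0, 1)) - u (t, x))).
  apply/funext => h /=; congr (_ *: (u _ - _)).
  by apply/eqP; rewrite xpair_eqE/= -[_ *: 0]/(h * 0) mulr0 add0r !eqxx.
apply: DeriveDef; first by rewrite /derivable E.
by rewrite /derive E.
Qed.

Lemma is_derive_time u t x : differentiable u (t, x) ->
  is_derive t 1 (fun s : R => u (s, x)) ('D_((1, 0) : R * R) u (t, x)).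
Proof.
move=> du; have cu : derivable u (t, x) (1, 0) by apply: diff_derivable.
have E : (fun h : R => h^-1 *: (((fun y : R => u (y, x)) \o shift t) (h *: 1)
   - u (t, x))) = (fun h : R => h^-1 *: ((u \o shift (t, x)) (h *: (1, 0)) - u (t, x))).
  apply/funext => h /=; congr (_ *: (u _ - _)).
  by apply/eqP; rewrite xpair_eqE/= -[_ *: 0]/(h * 0) mulr0 add0r !eqxx.
apply: DeriveDef; first by rewrite /derivable E.
by rewrite /derive E.
Qed.

(** The one-sided derivative test behind [pair_propagation]: a constraint [0 <= g] persists for a
    short time when it is slack or when [g] is increasing. *)
Lemma near_right_ge0 (g : R -> R) g' : is_derive (0 : R) 1 g g' ->
  0 <= g 0 -> (g 0 = 0 -> 0 < g') -> \forall d \near 0^'+, 0 <= g d.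
Proof.
move=> dg; rewrite le_eqVlt => /orP[/eqP g0 /(_ (esym g0)) g'0|g0 _]; last first.
  have cg : g d @[d --> 0^'+] --> g 0.
    apply: cvg_at_right_filter.
    by apply/differentiable_continuous/derivable1_diffP; case: dg.
  exact: (cvgr_ge (g 0) cg _ g0).
have [/cvg_ex[/= l lE] g'E] := dg.
have lg' : l = g' by rewrite -g'E; exact/esym/(cvg_lim _ lE).
have lE' := cvg_dnbhs_at_right lE.
have H : \forall d \near 0^'+, 0 < d^-1 *: (g (d *: 1 + 0) - g 0).
  by apply: (cvgr_gt l lE'); rewrite lg'.
near=> d.
have d0 : 0 < d by near: d; exact: nbhs_right_gt.
have : 0 < d^-1 *: (g (d *: 1 + 0) - g 0) by near: d.
rewrite -g0 subr0 addr0 -[d *: 1]/(d * 1) mulr1 -[_ *: _]/(_ * _).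
by rewrite pmulr_rgt0 ?invr_gt0// => /ltW.
Unshelve. all: by end_near. Qed.

Lemma compact_superlevel (X : topologicalType) (A : set X) (F : X -> R) :
  compact A -> {in A, continuous F} -> compact (A `&` [set p | 0 <= F p]).
Proof.
move=> cA cF G PG GA.
have [|p [Ap cp]] := cA G PG; first by apply: filterS GA => ? [].
exists p; split => //; split => //=; rewrite leNgt; apply/negP => Fp.
have /= Fq : \forall q \near p, F q < 0.
  by have := cF p (mem_set Ap); move/cvgr_lt; exact.
by have [q [[_ /=]]] := cp _ _ GA Fq; rewrite leNgt => /negP.
Qed.

Lemma lipschitz_compact u T t0 t1 a b : C1_on (slab T) u ->
  0 < t0 -> (t1%:E < T)%E ->
  exists2 L : R, 0 < L & forall t x y, t0 <= t <= t1 -> a <= x -> x <= y -> y <= b ->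
    `|u (t, y) - u (t, x)| <= L * (y - x).
Proof.
move=> uC t00 t1T.
pose B : set (R * R) := `[t0, t1] `*` `[a, b].
have Bs p : B p -> slab T p.
  move=> [/=]; rewrite !in_itv/= => /andP[t0p pt1] _; split => /=.
    exact: lt_le_trans t0p.
  by apply: le_lt_trans t1T; rewrite lee_fin.
have cB : compact B by apply: compact_setX; exact: segment_compact.
have [t01|t01] := leP t0 t1; last first.
  by exists 1 => // t x y /andP[/le_trans/[apply]]; rewrite leNgt t01.
have [ab|ab] := leP a b; last first.
  by exists 1 => // t x y _ /le_trans/[apply] /le_trans/[apply]; rewrite leNgt ab.
have [||/= [tc xc] /set_mem/= Bc maxc] :=
    @compact_EVT_max _ R (fun p => `|'D_((0, 1) : R * R) u p|) B _ cB.
- by exists (t0, a); split; rewrite /= in_itv/= lexx.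
- apply: continuous_in_subspaceT => p /set_mem/Bs/uC[_ _ cu].
  exact: (cvg_norm cu).
exists (`|'D_((0, 1) : R * R) u (tc, xc)| + 1); first by rewrite ltr_wpDl.
move=> t x y tt ax xy yb.
have Bz z : x <= z <= y -> B (t, z).
  move=> /andP[xz zy]; split; rewrite /= in_itv//=.
  by rewrite (le_trans ax xz) (le_trans zy yb).
have dz z : x <= z <= y -> is_derive z 1 (fun z => u (t, z)) ('D_((0, 1) : R * R) u (t, z)).
  by move=> /Bz/Bs/uC[du _ _]; exact: is_derive_space.
have [|| c] := @MVT_segment R (fun z => u (t, z)) (fun z => 'D_((0, 1) : R * R) u (t, z)) x y xy.
- by move=> z; rewrite in_itv/= => /andP[xz zy]; apply: dz; rewrite !ltW.
- apply: derivable_within_continuous => z; rewrite in_itv/= => xz.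
  by case: (dz z xz).
rewrite in_itv/= => xc' ->; rewrite normrM [`|y - x|]ger0_norm ?subr_ge0//.
rewrite ler_wpM2r ?subr_ge0//.
by rewrite ler_wpDr// maxc// inE; exact: Bz.
Qed.

Lemma cvg_comp_pair (X : Type) (F : set_system X) {FF : Filter F} (f g : X -> R)
    (a b : R) u : {for (a, b), continuous u} ->
  f p @[p --> F] --> a -> g p @[p --> F] --> b ->
  u (f p, g p) @[p --> F] --> u (a, b).
Proof.
move=> cu fa gb.
apply: (@continuous2_cvg X R R R F FF f g (fun x y => u (x, y)) a b _ fa gb).
by rewrite (_ : (fun z : R * R => u (z.1, z.2)) = u)//; apply/funext => -[].
Qed.

Lemma is_derive_affine (x a c : R) : is_derive x 1 (fun d : R => a + d * c) c.
Proof.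
have H := is_deriveD (is_derive_cst a x 1)
  (is_deriveM (is_derive_id x (1 : R)) (is_derive_cst c x 1)).
apply: (is_derive_eq H).
by rewrite /cst add0r -[_ *: 1]/(c * 1) mulr1 scaler0 add0r.
Qed.

End Transport.

Section PairPropagation.
Context {R : realType}.
Variables (u : R * R -> R) (T : \bar R) (M : R).
Hypothesis uC1 : C1_on (slab T) u.
Hypothesis uM : forall p, slab T p -> `|u p| <= M.

(** The derivative of [u] along its characteristics. *)
Definition force (t x : R) : R :=
  'D_((1, 0) : R * R) u (t, x) + u (t, x) * 'D_((0, 1) : R * R) u (t, x).

(** Suppose that, for every pair whose ratio is at least a barrier [b], the quantity
    [u (t, x) - u (t, y) - b t * (y - x) `^ alpha] increases along the characteristics.  Then
    a pair above the barrier at [t0] yields a pair above the barrier at [t1].  The set [Z] below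
    consists of the triples [(t, x, y)] above the barrier that can be reached from [(t0, x0, y0)]
    at speed at most [M] and whose distance has not shrunk faster than [eps] allows; it is compact,
    and a triple of [Z] with maximal time [t < t1] could be moved further. *)
Lemma pair_propagation (b b' : R -> R) (alpha t0 t1 x0 y0 : R) :
  0 < t0 -> t0 <= t1 -> (t1%:E < T)%E -> 0 < alpha -> x0 < y0 ->
  (forall t, t0 <= t <= t1 -> is_derive t 1 b (b' t)) ->
  (forall t x y, t0 <= t <= t1 -> x < y ->
     b t * (y - x) `^ alpha <= u (t, x) - u (t, y) ->
     b' t * (y - x) `^ alpha < force t x - force t y
       + alpha * b t * (y - x) `^ (alpha - 1) * (u (t, x) - u (t, y))) ->
  b t0 * (y0 - x0) `^ alpha <= u (t0, x0) - u (t0, y0) ->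
  exists x y, [/\ x < y, `|x - x0| <= M * (t1 - t0), `|y - y0| <= M * (t1 - t0)
    & b t1 * (y - x) `^ alpha <= u (t1, x) - u (t1, y)].
Proof.
move=> t00 t01 t1T a0 xy0 db hb pair0.
have slabt t x : t0 <= t -> t <= t1 -> slab T (t, x).
  move=> t0t tt1; split; first exact: lt_le_trans t0t.
  by apply: le_lt_trans t1T; rewrite lee_fin.
have M0 : 0 <= M by apply: le_trans (uM (slabt t0 x0 (lexx _) t01)).
pose m := M * (t1 - t0).
have m0 : 0 <= m by rewrite mulr_ge0// subr_ge0.
have [L L0 lip] := lipschitz_compact (x0 - m) (y0 + m) uC1 t00 t1T.
pose h0 := y0 - x0.
have h00 : 0 < h0 by rewrite subr_gt0.
(* A lower barrier for the distance.  As [u] is [L]-Lipschitz in space where the pair can get,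
     [eps] decays strictly faster than the distance of two characteristics can. *)
pose eps (t : R) := h0 * expR (- ((L + 1) * (t - t0))).
have eps0 t : 0 < eps t by rewrite mulr_gt0// expR_gt0.
pose Z1 : set (R * R * R) :=
  (`[t0, t1] `*` `[x0 - m, x0 + m]) `*` `[y0 - m, y0 + m].
have cZ1 : compact Z1 by do 2 ?apply: compact_setX; exact: segment_compact.
pose F1 (p : R * R * R) := M * (p.1.1 - t0) - `|p.1.2 - x0|.
pose F2 (p : R * R * R) := M * (p.1.1 - t0) - `|p.2 - y0|.
pose F3 (p : R * R * R) := p.2 - p.1.2 - eps p.1.1.
pose F4 (p : R * R * R) := u (p.1.1, p.1.2) - u (p.1.1, p.2)
  - b p.1.1 * (p.2 - p.1.2) `^ alpha.
have ct : continuous (fun p : R * R * R => p.1.1).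
  by move=> p; apply: cvg_comp; [exact: cvg_fst|exact: cvg_fst].
have cx : continuous (fun p : R * R * R => p.1.2).
  by move=> p; apply: cvg_comp; [exact: cvg_fst|exact: cvg_snd].
have cy : continuous (fun p : R * R * R => p.2) by move=> p; exact: cvg_snd.
have cF1 : continuous F1.
  move=> p; apply: cvgB; first by apply: cvgM; [exact: cvg_cst|]; apply: cvgB; [exact: ct|exact: cvg_cst].
  by apply: cvg_norm; apply: cvgB; [exact: cx|exact: cvg_cst].
have cF2 : continuous F2.
  move=> p; apply: cvgB; first by apply: cvgM; [exact: cvg_cst|]; apply: cvgB; [exact: ct|exact: cvg_cst].
  by apply: cvg_norm; apply: cvgB; [exact: cy|exact: cvg_cst].
have cF3 : continuous F3.
  move=> p; apply: cvgB; first by apply: cvgB; [exact: cy|exact: cx].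
  apply: cvgM; [exact: cvg_cst|]; apply: continuous_cvg; first exact: continuous_expR.
  by apply: cvgN; apply: cvgM; [exact: cvg_cst|]; apply: cvgB; [exact: ct|exact: cvg_cst].
pose Z2 := Z1 `&` [set p | 0 <= F1 p] `&` [set p | 0 <= F2 p] `&` [set p | 0 <= F3 p].
have cZ2 : compact Z2.
  by do 3 (apply: compact_superlevel; last by move=> ? _; auto).
have cF4 : {in Z2, continuous F4}.
  move=> [[t x] y] /set_mem[[[[[/=]]]]].
  rewrite !in_itv/= => /andP[t0t tt1] _ _ _ _; rewrite /F3/= => F3p.
  have xy : 0 < y - x by rewrite (lt_le_trans (eps0 t))// -subr_ge0.
  have cu z : {for (t, z), continuous u}.
    by apply: differentiable_continuous; case: (uC1 (slabt t z t0t tt1)).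
  have cb : {for t, continuous b}.
    apply: differentiable_continuous; apply/derivable1_diffP.
    by case: (db t); rewrite ?t0t.
  have cpow : {for y - x, continuous (fun h => h `^ alpha)}.
    apply: differentiable_continuous; apply/derivable1_diffP.
    by case: (is_derive1_powR alpha xy).
  apply: cvgB; first apply: cvgB.
  - exact: (cvg_comp_pair (cu x) (ct (t, x, y)) (cx (t, x, y))).
  - exact: (cvg_comp_pair (cu y) (ct (t, x, y)) (cy (t, x, y))).
  - apply: cvgM.
      apply: (@cvg_comp _ _ _ (fun p : R * R * R => p.1.1) b _ (nbhs t)); first exact: (ct (t, x, y)).
      exact: cb.
    apply: (@cvg_comp _ _ _ (fun p : R * R * R => p.2 - p.1.2) (fun h => h `^ alpha) _ (nbhs (y - x))).
      by apply: cvgB; [exact: (cy (t, x, y))|exact: (cx (t, x, y))].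
    exact: cpow.
pose Z := Z2 `&` [set p | 0 <= F4 p].
have cZ : compact Z by exact: compact_superlevel.
have Z0 : Z (t0, x0, y0).
  rewrite /Z /Z2 /Z1 /F1 /F2 /F3 /F4 /eps /=; split; last by rewrite subr_ge0.
  rewrite /= !in_itv/= !subrr !normr0 !mulr0 !oppr0 expR0 mulr1 /h0 subrr !addr0 !lexx t01.
  by rewrite !lerDl !gerBl !m0.
have [||/= [[t x] y] /set_mem/= Zt maxt] :=
  @compact_EVT_max _ R (fun p : R * R * R => p.1.1) Z _ cZ.
- by exists (t0, x0, y0).
- by apply: continuous_in_subspaceT => p _; exact: ct.
have [[[[[[/=]]]]]] := Zt; rewrite !in_itv/= /F1 /F2 /F3 /F4/=.
move=> /andP[t0t tt1] /andP[bx bx'] /andP[yb yb'] F1p F2p F3p F4p.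
have xy : 0 < y - x by rewrite (lt_le_trans (eps0 t))// -subr_ge0.
have [t1t|tlt] := leP t1 t.
  have tE : t = t1 by apply/eqP; rewrite eq_le tt1.
  move: F1p F2p F4p; rewrite tE !subr_ge0 => ? ? ?.
  by exists x, y; split => //; rewrite -subr_gt0.
exfalso.
have st z : slab T (t, z) by exact: slabt.
have du z : differentiable u (t, z) by case: (uC1 (st z)).
pose u1 := u (t, x); pose u2 := u (t, y).
(* The triple after a time [d] along straight lines with the characteristic velocities. *)
pose q (d : R) := (t + d, x + d * u1, y + d * u2).
have N3 : \forall d \near 0^'+, 0 <= F3 (q d).
  apply: (@near_right_ge0 _ (fun d => F3 (q d))
    (u2 - u1 + (L + 1) * eps t)).
  - have d1 := is_deriveB (is_derive_affine 0 y u2) (is_derive_affine 0 x u1).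
    have d2 : is_derive (0 : R) 1 (fun d => eps (t + d)) (- ((L + 1) * eps t)).
      have d3 : is_derive (0 : R) 1 (fun d => expR (- ((L + 1) * (t - t0)) + d * - (L + 1)))
          (expR (- ((L + 1) * (t - t0)) + 0 * - (L + 1)) * - (L + 1)).
        exact: (is_derive1_comp (is_derive_expR _) (is_derive_affine 0 _ _)).
      have := is_deriveZ h0 d3; rewrite [X in is_derive _ _ X _](_ : _ = fun d => eps (t + d)); last first.
        by apply/funext => d; rewrite /eps -[LHS]/(h0 * expR _); congr (_ * expR _); ring.
      move/is_derive_eq; apply; rewrite mul0r addr0 /eps -[LHS]/(h0 * (_ * _)); ring.
    by have := is_deriveB d1 d2; move/is_derive_eq; apply; rewrite opprK.
  - by rewrite /F3 /q/= !mul0r !addr0.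
  - rewrite /F3 /q/= !mul0r !addr0 => /eqP; rewrite subr_eq0 => /eqP <-.
    have := lip t x y; rewrite t0t tt1 bx yb' -subr_ge0 ltW// => /(_ isT isT isT isT).
    rewrite -/u1 -/u2 ler_norml => /andP[+ _]; rewrite mulrDl mul1r addrA => Hl.
    by apply: ltr_wpDl => //; rewrite -lerBlDr sub0r.
have N4 : \forall d \near 0^'+, 0 <= F4 (q d).
  apply: (@near_right_ge0 _ (fun d => F4 (q d))
    (force t x - force t y - (b' t * (y - x) `^ alpha
       + b t * (alpha * (y - x) `^ (alpha - 1) * (u2 - u1))))).
  - have d1 := is_deriveB (is_derive_char u1 (du x)) (is_derive_char u2 (du y)).
    have d2 : is_derive (0 : R) 1 (fun d => b (t + d * 1)) (b' t * 1).
      apply: (@is_derive1_comp _ b (fun d : R => t + d * 1)); last exact: is_derive_affine.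
      by rewrite mul0r addr0; apply: db; rewrite t0t.
    have d3 : is_derive (0 : R) 1 (fun d => (y + d * u2 - (x + d * u1)) `^ alpha)
        (alpha * (y - x) `^ (alpha - 1) * (u2 - u1)).
      apply: (@is_derive1_comp _ (fun h => h `^ alpha) (fun d : R => y + d * u2 - (x + d * u1))).
        by rewrite !mul0r !addr0; exact: is_derive1_powR.
      exact: (is_deriveB (is_derive_affine 0 y u2) (is_derive_affine 0 x u1)).
    have := is_deriveB d1 (is_deriveM d2 d3).
    rewrite [X in is_derive _ _ X _](_ : _ = fun d => F4 (q d)); last first.
      by apply/funext => d; rewrite /F4 /q/= -[LHS]/(_ - _ - _ * _) mulr1.
    move/is_derive_eq; apply; rewrite !mul0r !addr0 !mulr1 -[_ *: _ + _]/(_ * _ + _ * _) /force.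
    by rewrite -/u1 -/u2; ring.
  - by rewrite /F4 /q/= !mul0r !addr0.
  - rewrite /F4 /q/= !mul0r !addr0 => /eqP; rewrite subr_eq0 => /eqP F40.
    have := hb t x y; rewrite t0t tt1 -subr_gt0 xy -F40 lexx => /(_ isT isT isT).
    rewrite -/u1 -/u2; lra.
near (0 : R)^'+ => d.
have d0 : 0 < d by near: d; exact: nbhs_right_gt.
have dt : t + d <= t1.
  by rewrite -lerBrDl; near: d; apply: nbhs_right_le; rewrite subr_gt0.
have Zq : Z (q d).
  have mov z z0 : `|z - z0| <= M * (t - t0) ->
      `|z + d * u (t, z) - z0| <= M * (t + d - t0).
    move=> zz; rewrite addrAC (le_trans (ler_normD _ _))// addrAC mulrDr lerD//.
    rewrite normrM gtr0_norm// mulrC ler_wpM2r ?(ltW d0)//.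
    exact: uM.
  have box z z0 : `|z + d * u (t, z) - z0| <= M * (t + d - t0) ->
      (z0 - m <= z + d * u (t, z) <= z0 + m).
    move=> zz; rewrite -ler_distl (le_trans zz)// ler_wpM2l//.
    by rewrite lerD2r.
  move: F1p F2p; rewrite !subr_ge0 => /mov mx /mov my.
  rewrite /Z /Z2 /Z1 /=; do !split.
  - by rewrite /= in_itv/= dt andbT (le_trans t0t)// lerDl ltW.
  - by rewrite /= in_itv/= box.
  - by rewrite /= in_itv/= box.
  - by rewrite /F1/= subr_ge0.
  - by rewrite /F2/= subr_ge0.
  - by near: d.
  - by near: d.
have /= := maxt (q d) (mem_set Zq).
by rewrite gerDl leNgt d0.
Unshelve. all: by end_near. Qed.

End PairPropagation.

(** * Growth of the ratios and blow-up *)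

Lemma gt0_powRD {R : realType} (x a b : R) : 0 < x ->
  x `^ (a + b) = x `^ a * x `^ b.
Proof. by move=> x0; rewrite powRD// (gt_eqF x0) implybT. Qed.

Section BlowUp.
Context {R : realType}.
Variables (u : R * R -> R) (T : \bar R) (M : R).
Hypothesis uC1 : C1_on (slab T) u.
Hypothesis uM : forall p, slab T p -> `|u p| <= M.
Variables (s k : R).
Hypotheses (s0 : 0 <= s) (s1 : s <= 1) (k0 : 0 <= k).
Hypothesis forceL : forall t m x y : R, 0 < t -> (t%:E < T)%E ->
  (forall z, `|u (t, z)| <= m) -> x < y ->
  `|force u t x - force u t y| <= k * m * (y - x) `^ s.

Let alpha := (1 + s) / 2.

Let alpha_ge : 1 / 2 <= alpha. Proof. by rewrite /alpha; move: (s0) => ?; lra. Qed.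
Let alpha_le : alpha <= 1. Proof. by rewrite /alpha; move: (s1) => ?; lra. Qed.

(** While [`|u|] is at most [m], the ratio dominates the solution [b] of
    [b' = b ^ 2 / (8 * beta)] with initial value [r].  The constant [beta] bounds
    [h `^ (1 - alpha)] for the distance [h] of any pair of ratio at least [r]. *)
Lemma steepening (r m beta t0 t1 x0 y0 : R) :
  0 < r -> 0 < beta -> k * m <= r ^+ 2 / 8 ->
  (forall h, 0 < h -> r * h `^ alpha <= 2 * m -> h `^ (1 - alpha) <= beta) ->
  0 < t0 -> t0 <= t1 -> (t1%:E < T)%E ->
  (forall t z, t0 <= t <= t1 -> `|u (t, z)| <= m) ->
  (t1 - t0) / (8 * beta) < r^-1 ->
  x0 < y0 -> r * (y0 - x0) `^ alpha <= u (t0, x0) - u (t0, y0) ->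
  exists x y, [/\ x < y, `|x - x0| <= M * (t1 - t0), `|y - y0| <= M * (t1 - t0)
    & (r^-1 - (t1 - t0) / (8 * beta))^-1 * (y - x) `^ alpha
        <= u (t1, x) - u (t1, y)].
Proof.
move=> r0 beta0 km hbeta t00 t01 t1T um small xy0 pair0.
pose c := (8 * beta)^-1.
have c0 : 0 < c by rewrite invr_gt0; lra.
pose g (t : R) := r^-1 + c * t0 + t * - c.
have gE t : g t = r^-1 - (t - t0) / (8 * beta) by rewrite /g -/c; ring.
have g0 t : t0 <= t <= t1 -> 0 < g t <= r^-1.
  move=> /andP[t0t tt1]; rewrite gE; apply/andP; split.
    by rewrite subr_gt0; apply: le_lt_trans small; rewrite ler_wpM2r ?lerD2r//; exact: ltW.
  by rewrite gerBl mulr_ge0 ?subr_ge0//; exact: ltW.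
pose b (t : R) := (g t)^-1.
have br t : t0 <= t <= t1 -> r <= b t.
  by move=> /g0/andP[gp gr]; rewrite -[r]invrK lef_pV2// posrE invr_gt0.
have -> : (r^-1 - (t1 - t0) / (8 * beta))^-1 = b t1 by rewrite /b gE.
apply: (@pair_propagation R u T M uC1 uM b (fun t => c * b t ^+ 2)) => //.
- by move: alpha_ge; lra.
- move=> t tt; have /andP[gp _] := g0 t tt.
  have := @is_deriveV R g t _ 1 (lt0r_neq0 gp) (is_derive_affine t _ _).
  by move/is_derive_eq; apply; rewrite /b -[_ *: _]/(_ * _) exprVn; ring.
- move=> t x y tt xy pair.
  have /andP[t0t tt1] := tt.
  have h0 : 0 < y - x by rewrite subr_gt0.
  set P := (y - x) `^ (alpha - 1); set Q := (y - x) `^ alpha in pair *.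
  have P0 : 0 < P by exact: powR_gt0.
  have Q0 : 0 < Q by exact: powR_gt0.
  have bt := br t tt.
  have hs : (y - x) `^ s = P * Q.
    rewrite -gt0_powRD//.
    by congr (_ `^ _); rewrite /alpha; field.
  have uD : u (t, x) - u (t, y) <= 2 * m.
    have := um t x tt; have := um t y tt; rewrite !ler_norml; lra.
  have rQ : r * Q <= 2 * m.
    by apply: le_trans uD; apply: le_trans pair; rewrite ler_wpM2r// ltW.
  have bP : 1 <= beta * P.
    rewrite -(_ : (y - x) `^ (1 - alpha) * P = 1); last first.
      rewrite -gt0_powRD// (_ : 1 - alpha + (alpha - 1) = 0) ?powRr0//; ring.
    by rewrite ler_wpM2r ?(ltW P0)//; exact: hbeta.
  have fL := @forceL t m x y (lt_le_trans t00 t0t)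
    (le_lt_trans _ t1T) (fun z => um t z tt) xy.
  have {fL} : `|force u t x - force u t y| <= k * m * (P * Q).
    by rewrite -hs; apply: fL; rewrite lee_fin.
  rewrite ler_norml => /andP[fL _].
  have PQ : 0 < P * Q by rewrite mulr_gt0.
  have bt0 : 0 < b t by exact: lt_le_trans bt.
  have b2 : r ^+ 2 <= b t ^+ 2 by rewrite ler_pXn2r// nnegrE ltW.
  have kPQ : k * m * (P * Q) <= b t ^+ 2 / 8 * (P * Q).
    by rewrite ler_wpM2r ?(ltW PQ)//; lra.
  have cb : c * b t ^+ 2 * Q <= b t ^+ 2 / 8 * (P * Q).
    have -> : c * b t ^+ 2 * Q = b t ^+ 2 / 8 * Q * beta^-1.
      by rewrite /c invfM; ring.
    have -> : b t ^+ 2 / 8 * (P * Q) = b t ^+ 2 / 8 * Q * P by ring.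
    rewrite ler_wpM2l//; first by rewrite mulr_ge0 ?ltW// divr_gt0// exprn_gt0.
    by rewrite -[beta^-1]mul1r ler_pdivrMr// mulrC.
  have bD : 1 / 2 * b t ^+ 2 * (P * Q) <= alpha * b t * P * (u (t, x) - u (t, y)).
    have -> : 1 / 2 * b t ^+ 2 * (P * Q) = 1 / 2 * (b t * P * (b t * Q)) by ring.
    rewrite -[X in _ <= X * _]mulrA -[X in _ <= X]mulrA; apply: ler_pM => //.
      by rewrite !mulr_ge0 ?ltW.
    by rewrite ler_wpM2l// ltW// mulr_gt0.
  have : 0 < b t ^+ 2 * (P * Q) by rewrite mulr_gt0// exprn_gt0.
  lra.
- by rewrite /b gE subrr mul0r subr0 invrK.
Qed.

Variable B : R.
Hypotheses (B0 : 0 < B).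
Hypothesis supB : forall t a : R, 0 < t -> (t%:E < T)%E -> 0 < a ->
  (forall x y, x < y -> u (t, x) - u (t, y) <= a * (y - x) `^ alpha) ->
  forall z, `|u (t, z)| `^ (2 + s) <= B * a.

(** The bound on [`|u|] at a time at which all ratios are at most [2 * r]. *)
Definition amplitude (r : R) := (B * (2 * r)) `^ (2 + s)^-1.
(** A bound on [h `^ (1 - alpha)] for the distance [h] of a pair of ratio at least [r], when
    [`|u|] is at most [amplitude r]. *)
Definition spread (r : R) := (2 * amplitude r / r) `^ ((1 - alpha) / alpha).
(** The time within which a ratio [r] doubles. *)
Definition delay (r : R) := 4 * spread r / r.

Let alpha_gt0 : 0 < alpha.
Proof. by apply: lt_le_trans alpha_ge; rewrite divr_gt0. Qed.
Let expo_ge0 : 0 <= (1 - alpha) / alpha.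
Proof. by rewrite divr_ge0 ?(ltW alpha_gt0)// subr_ge0. Qed.
Let s2_gt0 : 0 < 2 + s.
Proof. by move: (s0) => ?; lra. Qed.

Lemma amplitude_gt0 r : 0 < r -> 0 < amplitude r.
Proof. by move=> r0; rewrite powR_gt0// !mulr_gt0. Qed.

Lemma spread_gt0 r : 0 < r -> 0 < spread r.
Proof. by move=> r0; rewrite powR_gt0// divr_gt0// mulr_gt0// amplitude_gt0. Qed.

Lemma delay_gt0 r : 0 < r -> 0 < delay r.
Proof. by move=> r0; rewrite divr_gt0// mulr_gt0// spread_gt0. Qed.

Lemma amplitude_double r : 0 < r -> amplitude (2 * r) <= 2 * amplitude r.
Proof.
move=> r0; rewrite /amplitude (_ : B * (2 * (2 * r)) = 2 * (B * (2 * r))); last by ring.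
rewrite powRM//; last by rewrite !mulr_ge0 ?ltW.
rewrite ler_wpM2r ?powR_ge0//.
rewrite -[leRHS]powRr1// ler_powR ?ler1n//.
by rewrite invf_le1//; move: (s0) => ?; lra.
Qed.

Lemma delay_double r : 0 < r -> delay (2 * r) <= delay r / 2.
Proof.
move=> r0; rewrite /delay invfM (_ : _ / r / 2 = 4 * spread r * (2^-1 * r^-1)); last by ring.
rewrite ler_wpM2r ?mulr_ge0 ?invr_ge0 ?(ltW r0)// ler_wpM2l// /spread.
have a0 := amplitude_gt0 r0; have a20 : 0 < amplitude (2 * r) by rewrite amplitude_gt0// mulr_gt0.
apply: ge0_ler_powR => //; first by rewrite nnegrE !divr_ge0 ?mulr_ge0 ?(ltW a20) ?(ltW r0).
  by rewrite nnegrE !divr_ge0 ?mulr_ge0 ?(ltW a0) ?(ltW r0).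
rewrite (_ : 2 * amplitude (2 * r) / (2 * r) = amplitude (2 * r) / r); last first.
  by field; rewrite gt_eqF.
by rewrite ler_wpM2r ?invr_ge0 ?(ltW r0)// amplitude_double.
Qed.

Lemma spreadP (r m h : R) : 0 < r -> 0 < m -> 0 < h -> r * h `^ alpha <= 2 * m ->
  h `^ (1 - alpha) <= (2 * m / r) `^ ((1 - alpha) / alpha).
Proof.
move=> r0 m0 h0 rh.
have -> : h `^ (1 - alpha) = (h `^ alpha) `^ ((1 - alpha) / alpha).
  by rewrite -powRrM mulrC divfK// gt_eqF.
apply: ge0_ler_powR => //; rewrite ?nnegrE ?powR_ge0//.
  by rewrite divr_ge0 ?mulr_ge0 ?(ltW m0) ?(ltW r0).
by rewrite ler_pdivlMr// mulrC.
Qed.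

Lemma ratio_doubling (r t0 x0 y0 : R) : 0 < r -> k * amplitude r <= r ^+ 2 / 8 ->
  0 < t0 -> ((t0 + delay r)%:E < T)%E ->
  x0 < y0 -> r * (y0 - x0) `^ alpha <= u (t0, x0) - u (t0, y0) ->
  exists t x y, [/\ t0 <= t <= t0 + delay r, x < y &
    2 * r * (y - x) `^ alpha <= u (t, x) - u (t, y)].
Proof.
move=> r0 kr t00 tT xy0 pair0.
have d0 := delay_gt0 r0.
have [//|H] := pselect (exists t x y, [/\ t0 <= t <= t0 + delay r, x < y &
    2 * r * (y - x) `^ alpha <= u (t, x) - u (t, y)]).
have a0 := amplitude_gt0 r0.
have um t z : t0 <= t <= t0 + delay r -> `|u (t, z)| <= amplitude r.
  move=> tt; have /andP[t0t tt1] := tt.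
  have : `|u (t, z)| `^ (2 + s) <= B * (2 * r).
    apply: supB => //; [exact: lt_le_trans t0t| |by rewrite mulr_gt0|].
      by apply: le_lt_trans tT; rewrite lee_fin.
    move=> x y xy; rewrite leNgt; apply/negP => Hxy; apply: H.
    by exists t, x, y; split => //; exact: ltW.
  move=> hz; rewrite -[leLHS]powRr1// -(@divff _ (2 + s)) ?gt_eqF// powRrM.
  apply: ge0_ler_powR => //; rewrite ?nnegrE ?powR_ge0//.
    by rewrite invr_ge0 ltW.
  by rewrite !mulr_ge0 ?(ltW B0) ?(ltW r0).
have e : delay r / (8 * spread r) = r^-1 / 2.
  by rewrite /delay; have := spread_gt0 r0; move=> sp; field; rewrite !gt_eqF.
have [||x [y [xy _ _ pair]]] := @steepening r (amplitude r) (spread r) t0 (t0 + delay r) x0 y0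
  r0 (spread_gt0 r0) kr (fun h => @spreadP r _ h r0 a0) t00 _ tT um _ xy0 pair0.
- by rewrite lerDl ltW.
- by rewrite [t0 + _]addrC addrK e; have : 0 < r^-1; [rewrite invr_gt0|lra].
exists (t0 + delay r), x, y; split => //; first by rewrite lexx lerDl ltW.
apply: le_trans pair; rewrite [t0 + _]addrC addrK e.
by rewrite (_ : (r^-1 - r^-1 / 2)^-1 = 2 * r)//; field; rewrite gt_eqF.
Qed.

Lemma ratio_iterate (r t0 x0 y0 : R) (n : nat) : 0 < r -> k * amplitude r <= r ^+ 2 / 8 ->
  0 < t0 -> ((t0 + 2 * delay r)%:E < T)%E ->
  x0 < y0 -> r * (y0 - x0) `^ alpha <= u (t0, x0) - u (t0, y0) ->
  exists t x y, [/\ t0 <= t <= t0 + 2 * delay r, x < y &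
    2 ^+ n * r * (y - x) `^ alpha <= u (t, x) - u (t, y)].
Proof.
elim: n r t0 x0 y0 => [|n IHn] r t0 x0 y0 r0 kr t00 tT xy0 pair0.
  by exists t0, x0, y0; split; rewrite ?expr0 ?mul1r// lexx lerDl mulr_ge0// ltW// delay_gt0.
have d0 := delay_gt0 r0.
have [|t [x [y [/andP[t0t tt] xy pair]]]] := @ratio_doubling r t0 x0 y0 r0 kr t00 _ xy0 pair0.
  by apply: le_lt_trans tT; rewrite lee_fin lerD2l; lra.
have dd := delay_double r0.
have tt' : t + 2 * delay (2 * r) <= t0 + 2 * delay r by lra.
have [||||//|//|t' [x' [y' [/andP[tt1 tt2] xy' pair']]]] := IHn (2 * r) t x y.
- by rewrite mulr_gt0.
- rewrite (le_trans (ler_wpM2l k0 (amplitude_double r0)))//; rewrite exprMn; move: kr; nra.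
- exact: lt_le_trans t0t.
- by apply: le_lt_trans tT; rewrite lee_fin.
exists t', x', y'; split => //.
  by rewrite (le_trans t0t tt1) (le_trans tt2 tt').
by rewrite exprSr -[2 ^+ n * 2 * r]mulrA.
Qed.

(** A ratio that is large compared with the crude bound [M] on [u] leads to a contradiction:
    within the time [8 / r] it would exceed the Lipschitz constant [L] of [u] on the compact set
    that the pair can reach. *)
Lemma collision (r t0 x0 y0 : R) : 0 < r -> k * M <= r ^+ 2 / 8 -> 0 < M -> 2 * M <= r ->
  0 < t0 -> ((t0 + 8 / r)%:E < T)%E ->
  x0 < y0 -> r * (y0 - x0) `^ alpha <= u (t0, x0) - u (t0, y0) -> False.
Proof.
move=> r0 kM M0 Mr t00 tT xy0 pair0.
have e8 : 0 < 8 / r by rewrite divr_gt0.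
pose m := M * (8 / r).
have m0 : 0 < m by rewrite mulr_gt0.
have [L L0 lip] := lipschitz_compact (x0 - m) (y0 + m) uC1 t00 tT.
(* The time at which the Riccati solution started at [r] takes the value [r + L]. *)
pose t1 := t0 + 8 * (r^-1 - (r + L)^-1).
have rL : 0 < r + L by rewrite addr_gt0.
have iL : 0 < (r + L)^-1 < r^-1.
  by rewrite invr_gt0 rL ltf_pV2 ?posrE// ltrDl.
have tt1 : t0 <= t1 <= t0 + 8 / r by rewrite /t1; move: iL; lra.
have /andP[t01 t18] := tt1.
have t1T : (t1%:E < T)%E by apply: le_lt_trans tT; rewrite lee_fin.
have small h : 0 < h -> r * h `^ alpha <= 2 * M -> h `^ (1 - alpha) <= 1.
  move=> h0 rh; rewrite (le_trans (spreadP r0 M0 h0 rh))//.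
  apply: (@le_trans _ _ ((1 : R) `^ ((1 - alpha) / alpha))); last by rewrite powR1.
  apply: ge0_ler_powR => //; rewrite ?nnegrE//.
    by rewrite divr_ge0 ?mulr_ge0 ?(ltW M0) ?(ltW r0).
  by rewrite ler_pdivrMr// mul1r.
have uMt t z : t0 <= t <= t1 -> `|u (t, z)| <= M.
  move=> /andP[t0t tt]; apply: uM; split; first exact: lt_le_trans t0t.
  by apply: le_lt_trans t1T; rewrite lee_fin.
have [|x [y [xy xx yy pair]]] := @steepening r M 1 t0 t1 x0 y0 r0 ltr01 kM small t00 t01 t1T uMt _ xy0 pair0.
  by rewrite mulr1 /t1; move: iL; lra.
have h0 : 0 < y - x by rewrite subr_gt0.
have bE : (r^-1 - (t1 - t0) / (8 * 1))^-1 = r + L.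
  by rewrite /t1 -[RHS]invrK; congr (_^-1); field; rewrite !gt_eqF.
rewrite bE in pair.
have mle : M * (t1 - t0) <= m by rewrite ler_wpM2l ?(ltW M0)// lerBlDl.
have D2 : u (t1, x) - u (t1, y) <= 2 * M.
  have := uMt t1 x; have := uMt t1 y; rewrite t01 lexx => /(_ isT) + /(_ isT).
  by rewrite !ler_norml; lra.
have hs : (y - x) `^ (1 - alpha) <= 1.
  apply: small => //; apply: le_trans D2; apply: le_trans pair.
  by rewrite ler_wpM2r ?powR_ge0// lerDl ltW.
have DL : u (t1, x) - u (t1, y) <= L * (y - x).
  rewrite (le_trans (ler_norm _))// distrC; apply: lip; last 1 first.
  - by move: yy; rewrite ler_distl => /andP[_ /le_trans]; apply; rewrite lerD2l.
  - by rewrite t01.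
  - by move: xx; rewrite ler_distl => /andP[+ _]; apply: le_trans; rewrite lerD2l lerN2.
  - exact: ltW.
have hE : y - x = (y - x) `^ (1 - alpha) * (y - x) `^ alpha.
  by rewrite -gt0_powRD// subrK powRr1// ltW.
have Q0 : 0 < (y - x) `^ alpha by exact: powR_gt0.
have := le_trans pair DL; rewrite {2}hE mulrA ler_pM2r// => bad.
have : L * (y - x) `^ (1 - alpha) <= L * 1 by rewrite ler_wpM2l// ltW.
by rewrite mulr1 => /(le_trans bad); rewrite gerDr leNgt r0.
Qed.

(** A pair of ratio [r] at time [t0] bounds the lifespan. *)
Lemma blow_up (r t0 x0 y0 : R) : 0 < r -> k * amplitude r <= r ^+ 2 / 8 ->
  0 < t0 -> x0 < y0 -> r * (y0 - x0) `^ alpha <= u (t0, x0) - u (t0, y0) ->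
  (T <= (t0 + 2 * delay r)%:E)%E.
Proof.
move=> r0 kr t00 xy0 pair0; rewrite leNgt; apply/negP => tT.
have d0 := delay_gt0 r0.
have st0 x : slab T (t0, x).
  by split => //=; apply: le_lt_trans tT; rewrite lee_fin lerDl mulr_ge0// ltW.
have M0 : 0 < M.
  rewrite lt0r (le_trans _ (uM (st0 x0)))// andbT; apply/eqP => M0.
  have := uM (st0 x0); have := uM (st0 y0); rewrite M0 !normr_le0 => /eqP uy /eqP ux.
  move: pair0; rewrite ux uy subrr leNgt mulr_gt0//.
  by rewrite powR_gt0// subr_gt0.
have [e e0 eT] : exists2 e : R, 0 < e & ((t0 + 2 * delay r + e)%:E < T)%E.
  move: tT; case: (T) => [T'| |//]; last by exists 1 => //; rewrite ltry.
  rewrite lte_fin => tT; exists ((T' - (t0 + 2 * delay r)) / 2).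
    by rewrite divr_gt0// subr_gt0.
  by rewrite lte_fin; lra.
pose rho := 1 + 2 * M + 8 / e + 8 * (k * M).
have [n hn] : exists n : nat, rho <= 2 ^+ n * r.
  have [n nr] : exists n : nat, rho / r < n%:R.
    by exists (Num.truncn (rho / r)).+1; rewrite truncnS_gt.
  exists n; rewrite -ler_pdivrMr//; apply: (le_trans (ltW nr)).
  by rewrite -natrX ler_nat ltnW// ltn_expl.
have [t [x [y [/andP[t0t tt] xy pair]]]] := ratio_iterate n r0 kr t00 tT xy0 pair0.
have kM0 : 0 <= k * M by rewrite mulr_ge0// ltW.
have e8 : 0 < 8 / e by rewrite divr_gt0.
set r' := 2 ^+ n * r in hn pair.
have r'1 : 1 <= r' by apply: le_trans hn; rewrite /rho; move: (M0) => ?; lra.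
apply: (@collision r' t x y _ _ M0 _ _ _ xy pair).
- exact: lt_le_trans r'1.
- rewrite ler_pdivlMr// mulrC; apply: (@le_trans _ _ r').
    by apply: le_trans hn; rewrite /rho; move: (M0) => ?; lra.
  by rewrite expr2 ler_peMl// (le_trans _ r'1).
- by apply: le_trans hn; rewrite /rho; lra.
- exact: lt_le_trans t0t.
- apply: le_lt_trans eT; rewrite lee_fin lerD// ler_pdivrMr; last exact: lt_le_trans r'1.
  rewrite mulrC -ler_pdivrMr//; apply: le_trans hn; rewrite /rho; move: (M0) => ?; lra.
Qed.

End BlowUp.

(** * A smooth step function *)

Section Bump.
Context {R : realType}.
Implicit Types (f g : R -> R) (p : {poly R}).

(** [f] is [n] times differentiable. *)
Fixpoint smooth_upto (n : nat) f : Prop :=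
  if n is m.+1 then (forall x : R, derivable f x 1) /\ smooth_upto m (f^`())%classic
  else True.

Lemma smooth_uptoP f : (forall n, smooth_upto n f) ->
  forall n (x : R), derivable (derive1n n f) x 1.
Proof.
move=> sf n; elim: n f sf => [|n IHn] f sf x; first by case: (sf 1%N).
by rewrite derive1Sn; apply: IHn => m; case: (sf m.+1).
Qed.

Lemma smooth_upto_is_derive f (f' : R -> R) n :
  (forall x : R, is_derive x 1 f (f' x)) ->
  smooth_upto n f' -> smooth_upto n.+1 f.
Proof.
move=> df sf'; split; first by move=> x; case: (df x).
rewrite (_ : f^`()%classic = f')//; apply/funext => x.
by rewrite derive1E; case: (df x).
Qed.

Lemma smooth_upto_le n m f : (n <= m)%N -> smooth_upto m f -> smooth_upto n f.
Proof.
elim: n m f => [//|n IHn] [//|m] f nm [df sf]; split => //.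
exact: IHn sf.
Qed.

Let derP f (x : R) : derivable f x 1 -> is_derive x 1 f ((f^`())%classic x).
Proof. by move=> df; rewrite derive1E; apply: DeriveDef. Qed.

Lemma smooth_uptoD n f g : smooth_upto n f -> smooth_upto n g ->
  smooth_upto n (fun x => f x + g x).
Proof.
elim: n f g => [//|n IHn] f g [df sf] [dg sg].
apply: (@smooth_upto_is_derive _ (fun x => (f^`())%classic x + (g^`())%classic x)).
  by move=> x; exact: (is_deriveD (derP (df x)) (derP (dg x))).
exact: IHn.
Qed.

Lemma smooth_uptoM n f g : smooth_upto n f -> smooth_upto n g ->
  smooth_upto n (fun x => f x * g x).
Proof.
elim: n f g => [//|n IHn] f g sf sg.
have [[df sf'] [dg sg']] := (sf, sg).
apply: (@smooth_upto_is_derive _ (fun x => f x * (g^`())%classic x + g x * (f^`())%classic x)).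
  by move=> x; exact: (is_deriveM (derP (df x)) (derP (dg x))).
by apply: smooth_uptoD; apply: IHn => //; apply: (@smooth_upto_le _ n.+1).
Qed.

Lemma smooth_upto_cst n (c : R) : smooth_upto n (fun _ => c).
Proof.
elim: n c => [//|n IHn] c.
exact: (smooth_upto_is_derive (fun x => is_derive_cst c x 1) (IHn 0)).
Qed.

Lemma smooth_upto_affine n f (a c : R) : smooth_upto n f ->
  smooth_upto n (fun x => f (a + x * c)).
Proof.
elim: n f => [//|n IHn] f [df sf].
refine (@smooth_upto_is_derive _ (fun x => (f^`())%classic (a + x * c) * c) _ _ _).
  move=> x; apply: (is_derive1_comp (f := f) (g := fun x => a + x * c)).
    exact: derP.
  exact: is_derive_affine.
by apply: smooth_uptoM; [exact: IHn|exact: smooth_upto_cst].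
Qed.

(** The functions [p (1 / x) * exp (- 1 / x)], extended by [0] for [x <= 0].  The derivative of
    such a function is of the same form, so all of them are smooth. *)
Definition flat p (x : R) : R := if 0 < x then p.[x^-1] * expR (- x^-1) else 0.

Lemma poly_expRN_bounded p : exists C : R, forall y : R, 0 <= y ->
  `|p.[y] * expR (- y)| <= C.
Proof.
exists (\sum_(i < size p) `|p`_i| * i`!%:R) => y y0.
rewrite horner_coef mulr_suml (le_trans (ler_norm_sum _ _ _))//.
apply: ler_sum => i _; rewrite -mulrA normrM ler_wpM2l//.
rewrite ger0_norm ?mulr_ge0 ?exprn_ge0 ?expR_ge0//.
rewrite expRN ler_pdivrMr ?expR_gt0//.
case: (nat_of_ord i) => [|j].
  by rewrite expr0 fact0 mul1r -[leLHS]expR0 ler_expR.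
rewrite mulrC -ler_pdivrMr ?ltr0n ?fact_gt0//.
by apply: le_trans (expR_ge1Dxn j y0); rewrite lerDr.
Qed.

Lemma is_derive_flat p (x : R) : is_derive x 1 (flat p) (flat ('X^2 * (p - p^`())) x).
Proof.
have [x0|x0|->] := ltgtP x 0.
- have -> : flat ('X^2 * (p - p^`())) x = 0 by rewrite /flat ltNge ltW.
  apply: (@near_eq_is_derive _ _ _ (cst 0)) => /=.
  near=> y; rewrite /flat ltNge ltW//; near: y; exact: lt_nbhsl.
- have xi : is_derive x 1 (fun y : R => y^-1) (- x ^- 2).
    have := @is_deriveV R id x 1 1 (lt0r_neq0 x0) (is_derive_id _ _).
    by move/is_derive_eq; apply; rewrite -[_ *: _]/(_ * _) mulr1.
  have d1 := is_derive1_comp (is_derive_poly p x^-1) xi.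
  have d2 := @is_derive1_comp _ expR (fun y : R => - y^-1) _ _ _ (is_derive_expR (- x^-1)) (is_deriveN xi).
  have d3 := is_deriveM d1 d2.
  have E : flat ('X^2 * (p - p^`())) x = p.[x^-1] * (expR (- x^-1) * - - x ^- 2)
     + expR (- x^-1) * (p^`().[x^-1] * - x ^- 2).
    by rewrite /flat x0 hornerM hornerXn hornerD hornerN opprK exprVn; ring.
  rewrite E; apply: (near_eq_is_derive _ d3).
  near=> y; rewrite /flat ifT//; near: y; exact: lt_nbhsr.
- have -> : flat ('X^2 * (p - p^`())) 0 = 0 by rewrite /flat ltxx.
  have [C hC] := poly_expRN_bounded ('X^2 * p).
  have C0 : 0 <= C by apply: le_trans (hC 0 _).
  have H : h^-1 *: ((flat p \o shift 0) (h *: 1) - flat p 0) @[h --> 0^'] --> (0 : R).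
    apply/cvgr0Pnorm_le => e e0; near=> h.
    rewrite /= addr0 -[h *: 1]/(h * 1) mulr1 -[_ *: _]/(_ * _).
    rewrite [flat p 0]/flat ltxx subr0 /flat; case: ifP => h0; last by rewrite mulr0 normr0 ltW.
    have hi : 0 <= h^-1 by rewrite invr_ge0 ltW.
    have := hC h^-1 hi; rewrite hornerM hornerXn => hCh.
    rewrite [X in `|X|](_ : _ = h * (h^-1 ^+ 2 * p.[h^-1] * expR (- h^-1))); last first.
      have : h != 0 by rewrite gt_eqF.
      by move: (p.[h^-1]) (expR _) => P E ?; field.
    rewrite normrM; apply: (@le_trans _ _ (`|h| * (C + 1))); first by rewrite ler_wpM2l// (le_trans hCh)// lerDl.
    rewrite -ler_pdivlMr; last by rewrite ltr_wpDl.
    by near: h; apply: dnbhs0_le; rewrite divr_gt0// ltr_wpDl.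
  apply: DeriveDef; first by apply/cvg_ex; exists 0.
  exact/cvg_lim.
Unshelve. all: by end_near. Qed.

Lemma smooth_upto_flat n p : smooth_upto n (flat p).
Proof.
elim: n p => [//|n IHn] p; apply: smooth_upto_is_derive; first exact: is_derive_flat.
exact: IHn.
Qed.

Lemma flat_ge0 x : 0 <= flat 1 x.
Proof. by rewrite /flat; case: ifP => // _; rewrite hornerC mul1r expR_ge0. Qed.

Lemma flat_le1 x : flat 1 x <= 1.
Proof.
rewrite /flat; case: ifP => // x0.
by rewrite hornerC mul1r -[leRHS]expR0 ler_expR oppr_le0 invr_ge0 ltW.
Qed.

(** A smooth function, positive on the open unit interval and [0] elsewhere. *)
Definition flat_bump (x : R) : R := flat 1 x * flat 1 (1 + x * -1).

Lemma smooth_upto_bump n : smooth_upto n flat_bump.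
Proof.
apply: smooth_uptoM; first exact: smooth_upto_flat.
by apply: (@smooth_upto_affine n (flat 1) 1 (-1)); exact: smooth_upto_flat.
Qed.

Lemma bump_ge0 x : 0 <= flat_bump x.
Proof. by rewrite mulr_ge0// flat_ge0. Qed.

Lemma bump_le1 x : flat_bump x <= 1.
Proof. by rewrite mulr_ile1 ?flat_ge0 ?flat_le1. Qed.

Lemma bump_gt0 x : 0 < x < 1 -> 0 < flat_bump x.
Proof.
move=> /andP[x0 x1]; rewrite /flat_bump /flat x0 mulrN1 subr_gt0 x1 !hornerC !mul1r.
by rewrite mulr_gt0// expR_gt0.
Qed.

Lemma bump_eq0 x : x <= 0 \/ 1 <= x -> flat_bump x = 0.
Proof.
rewrite /flat_bump /flat mulrN1 subr_gt0; case=> x0.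
  by rewrite ltNge x0 mul0r.
by rewrite [X in _ * (if X then _ else _)]ltNge x0 mulr0.
Qed.

Lemma continuous_bump : continuous flat_bump.
Proof.
move=> x; apply/differentiable_continuous/derivable1_diffP.
by have [/(_ x)] := smooth_upto_bump 1.
Qed.

End Bump.

Section SmoothStep.
Context {R : realType}.
Notation MR := (measurableTypeR R).

Lemma MVT_is_derive (f f' : R -> R) (x y : R) : x <= y ->
  (forall z : R, is_derive z 1 f (f' z)) ->
  exists2 z, x <= z <= y & f y - f x = f' z * (y - x).
Proof.
move=> xy df.
have [|z zxy fE] := @MVT_segment R f f' x y xy (fun z _ => df z).
  by apply: derivable_within_continuous => z _; case: (df z).
by exists z => //; rewrite in_itv in zxy.
Qed.

(** A smooth function that increases from [0] to [1] on the unit interval, with its derivative. *)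
Lemma smooth_step : exists S beta : R -> R, exists2 C : R, 0 <= C &
  [/\ forall x : R, is_derive x 1 S (beta x),
      forall x, 0 <= beta x <= C,
      continuous beta &
   [/\ forall n, smooth_upto n S,
      forall x, x <= 0 -> S x = 0,
      forall x, 1 <= x -> S x = 1,
      forall x, 0 <= S x <= 1 &
      forall x, x <= 0 \/ 1 <= x -> beta x = 0]].
Proof.
pose H0 (x : R) := (\int[leb]_(t in `]-oo, x]) flat_bump t)%R.
have ib : integ setT (@flat_bump R).
  refine (@integ_extend R `[0, 1] (@flat_bump R) _ _ _) => //.
    move=> x /= /negP; rewrite in_itv/= negb_and -!ltNge.
    by move=> /orP[?|?]; apply: bump_eq0; [left|right]; exact: ltW.
  by apply: integ_segment; apply: continuous_subspaceT; exact: continuous_bump.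
have dH0 (x : R) : is_derive x 1 H0 (flat_bump x).
  have [|||dH EH] := @continuous_FTC1 R (@flat_bump R) -oo%O x (x + 1) _ _ _ (@continuous_bump R x).
  - by rewrite ltrDl.
  - by apply: integrableS ib.
  - by rewrite ltNyr.
  - by rewrite derive1E in EH; exact: (DeriveDef dH EH).
have up x y : x <= y -> H0 x <= H0 y.
  move=> xy; have [z _ E] := MVT_is_derive xy dH0.
  by rewrite -subr_ge0 E mulr_ge0 ?bump_ge0 ?subr_ge0.
have H0l x : x <= 0 -> H0 x = H0 0.
  move=> x0; have [z /andP[_ z0] E] := MVT_is_derive x0 dH0.
  by apply/esym/eqP; rewrite -subr_eq0 E bump_eq0 ?mul0r//; left.
have H0r x : 1 <= x -> H0 x = H0 1.
  move=> x0; have [z /andP[z0 _] E] := MVT_is_derive x0 dH0.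
  by apply/eqP; rewrite -subr_eq0 E bump_eq0 ?mul0r//; right.
have c0 : 0 < H0 1 - H0 0.
  have q : (1 / 4 : R) <= 3 / 4 by lra.
  have [z zq E] := MVT_is_derive q dH0.
  have : 0 < H0 (3 / 4) - H0 (1 / 4).
    by rewrite E mulr_gt0 ?bump_gt0//; move: zq; lra.
  have : H0 (3 / 4) <= H0 1 by apply: up; lra.
  have : H0 0 <= H0 (1 / 4) by apply: up; lra.
  lra.
set c := H0 1 - H0 0 in c0.
pose S x := c^-1 * (H0 x - H0 0); pose beta x := c^-1 * @flat_bump R x.
have ci : 0 <= c^-1 by rewrite invr_ge0 ltW.
have dS (x : R) : is_derive x 1 S (beta x).
  have := is_deriveZ c^-1 (is_deriveB (dH0 x) (is_derive_cst (H0 0) x 1)).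
  by move/is_derive_eq; apply; rewrite subr0.
exists S, beta, c^-1; first by [].
split => //.
- by move=> x; rewrite /beta mulr_ge0 ?bump_ge0//= ler_piMr// bump_le1.
- by move=> x; apply: cvgM; [exact: cvg_cst|exact: continuous_bump].
- split.
  + case=> [//|n]; apply: (smooth_upto_is_derive dS).
    by apply: smooth_uptoM; [exact: smooth_upto_cst|exact: smooth_upto_bump].
  + by move=> x x0; rewrite /S H0l// subrr mulr0.
  + by move=> x x1; rewrite /S H0r// mulVf// gt_eqF.
  + move=> x; have [x0|x0] := leP x 0; first by rewrite /S H0l// subrr mulr0 lexx ler01.
    rewrite /S mulr_ge0 ?subr_ge0 ?up ?(ltW x0)//= mulrC ler_pdivrMr// mul1r lerD2r.
    by have [x1|x1] := leP x 1; [exact: up|rewrite H0r// ltW].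
  + by move=> x x01; rewrite /beta bump_eq0// mulr0.
Qed.

Lemma Rintegral_FTC (f F : R -> R) (a b : R) : a < b ->
  (forall x : R, is_derive x 1 F (f x)) -> continuous f ->
  Rintegral leb `[a, b] f = F b - F a.
Proof.
move=> ab dF cf.
have cF : continuous F.
  by move=> x; apply/differentiable_continuous/derivable1_diffP; case: (dF x).
rewrite /Rintegral (@continuous_FTC2 R f F a b ab)//.
- exact: continuous_subspaceT.
- split.
  + by move=> x _; case: (dF x).
  + exact/cvg_at_right_filter/cF.
  + exact/cvg_at_left_filter/cF.
- by move=> x _; rewrite derive1E; case: (dF x).
Qed.

(** * Integrable functions with an integrable weak derivative *)

Lemma integ_ball (G : R -> R) (a r c : R) : integ setT G ->
  integ (ball a r : set MR) (fun y => G y - c).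
Proof.
move=> iG; have mb : measurable (ball a r : set MR) by exact: measurable_ball.
rewrite (_ : EFin \o _ = (fun y => (G y)%:E - c%:E)%E)//.
apply: integrableB => //; first exact: integrableS iG.
apply: (@measurable_bounded_integrable _ MR R leb (cst c)) => //.
  have [r0|r0] := leP 0 r; first by have := lebesgue_measure_ball a r0 => /= ->; exact: ltry.
  by rewrite (ball0 _ _).2 ?measure0// ltW.
by exists `|c|; split; [exact: num_real|move=> x cx y _; exact: ltW].
Qed.

Lemma lebesgue_pt_small (G : R -> R) (a e : R) : integ setT G ->
  lebesgue_pt G a -> 0 < e ->
  \forall r \near 0^'+,
    Rintegral leb (ball a r : set MR) (fun y => `|G y - G a|) <= e * r.
Proof.
move=> iG Ga e0.
have /fine_cvgP[_ /cvgrPdist_lt/(_ _ (divr_gt0 e0 (ltr0Sn R 1)))] := Ga.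
apply: filterS2 (nbhs_right_gt 0) => r r0 /=.
have mb : measurable (ball a r : set MR) by exact: measurable_ball.
have iA : integ (ball a r : set MR) (fun y => `|G y - G a|).
  by apply: integ_norm => //; exact: integ_ball.
have -> : davg G a r = ((r *+ 2)^-1 * Rintegral leb (ball a r : set MR) (fun y => `|G y - G a|))%:E.
  rewrite /davg /iavg lebesgue_measure_ball ?(ltW r0)// EFinM; congr (_ * _)%E.
    by rewrite inver gt_eqF// mulrn_wgt0.
  by rewrite fineK//; exact: integrable_fin_num iA.
rewrite /= sub0r normrN ger0_norm; last first.
  by rewrite mulr_ge0 ?invr_ge0 ?mulrn_wge0 ?(ltW r0)// Rintegral_ge0.
rewrite mulrC ltr_pdivrMr ?mulrn_wgt0// => /ltW/le_trans; apply.
by rewrite -[r *+ 2]mulr_natr mulrC mulrACA divff// mulr1 mulrC.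
Qed.

End SmoothStep.

Section Approx.
Context {R : realType}.
Notation MR := (measurableTypeR R).
Variables (S beta : R -> R) (C : R).
Hypothesis C0 : 0 <= C.
Hypothesis dS : forall x : R, is_derive x 1 S (beta x).
Hypothesis betaC : forall x, 0 <= beta x <= C.
Hypothesis cbeta : continuous beta.
Hypothesis Sl : forall x, x <= 0 -> S x = 0.
Hypothesis Sr : forall x, 1 <= x -> S x = 1.
Hypothesis beta_out : forall x, x <= 0 \/ 1 <= x -> beta x = 0.

(** The step function sharpened by the factor [n] and moved to [a]. *)
Definition scaled (f : R -> R) (a n x : R) := f (- (n * a) + x * n).

(** The derivative of [scaled S a n], an approximate Dirac mass at [a]. *)
Definition delta (a n x : R) := beta (- (n * a) + x * n) * n.

Lemma is_derive_scaled (a n x : R) : is_derive x 1 (scaled S a n) (delta a n x).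
Proof.
exact: (@is_derive1_comp _ S (fun x => - (n * a) + x * n) x _ _ (dS _)
  (is_derive_affine x _ _)).
Qed.

Lemma continuous_delta a n : continuous (delta a n).
Proof.
move=> x; apply: cvgM; last exact: cvg_cst.
apply: (@cvg_comp _ _ _ (fun x => - (n * a) + x * n) beta _ (nbhs (- (n * a) + x * n))).
  by apply: cvgD; [exact: cvg_cst|apply: cvgM; [exact: cvg_id|exact: cvg_cst]].
exact: cbeta.
Qed.

Lemma delta_out a n x : 0 < n -> ~ ball a (2 / n) x -> delta a n x = 0.
Proof.
move=> n0 ax; rewrite /delta beta_out ?mul0r//.
have [xa|xa] := ltP a x; last first.
  left; have : x * n <= a * n by rewrite ler_wpM2r// ltW.
  lra.
right; rewrite leNgt; apply/negP => H; apply: ax.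
rewrite /ball/= ltr_distlC; apply/andP; split.
  by rewrite ltrBlDr (lt_trans xa)// ltrDl divr_gt0.
have : (x - a) * n < 1 by move: H; lra.
rewrite -ltr_pdivlMr// => H'.
have : 1 / n < 2 / n by rewrite ltr_pM2r ?invr_gt0//; lra.
lra.
Qed.

Lemma integ_delta a n : 0 < n -> integ setT (delta a n).
Proof.
move=> n0; refine (@integ_extend R `[a - 2 / n, a + 2 / n] (delta a n) _ _ _) => //.
  move=> x /= ax; apply: delta_out => // bx; apply: ax.
  by move: bx; rewrite /ball/= ltr_distlC in_itv/= => /andP[? ?]; rewrite !ltW.
by apply: integ_segment; apply: continuous_subspaceT; exact: continuous_delta.
Qed.

Lemma Rintegral_delta a n : 0 < n -> Rintegral leb setT (delta a n) = 1.
Proof.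
move=> n0; have ab : a - 2 / n < a + 2 / n.
  by have : 0 < 2 / n; [rewrite divr_gt0|lra].
rewrite -(@Rintegral_extend R `[a - 2 / n, a + 2 / n]); last first.
  move=> x /= ax; apply: delta_out => // bx; apply: ax.
  by move: bx; rewrite /ball/= ltr_distlC in_itv/= => /andP[? ?]; rewrite !ltW.
rewrite (Rintegral_FTC ab (is_derive_scaled a n) (@continuous_delta a n)).
have E1 : - (n * a) + (a - 2 / n) * n = - 2 by field; rewrite gt_eqF.
have E2 : - (n * a) + (a + 2 / n) * n = 2 by field; rewrite gt_eqF.
rewrite /scaled E1 E2 Sr ?Sl ?subr0//; lra.
Qed.

Lemma delta_cvg (G : R -> R) a : integ setT G -> lebesgue_pt G a ->
  Rintegral leb setT (fun x => G x * delta a n.+1%:R x) @[n --> \oo] --> G a.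
Proof.
move=> iG Ga; apply/cvgrPdist_le => e e0.
have C1 : 0 < 2 * (C + 1) by rewrite mulr_gt0// ltr_wpDl.
have := lebesgue_pt_small iG Ga (divr_gt0 e0 C1).
move=> [r /= r0 hr]; near=> n.
have hN : 2 / r < n.+1%:R.
  near: n; exists (Num.truncn (2 / r)).+1 => // n /= kn.
  by apply: (lt_le_trans (truncnS_gt _)); rewrite ler_nat (leq_trans kn).
set N : R := n.+1%:R; have N0 : 0 < N by rewrite ltr0n.
have iGd : integ setT (fun x => G x * delta a N x).
  apply: (@integ_mul_bounded R setT G (delta a N) (C * N)) => //.
    exact: continuous_measurable_fun (@continuous_delta a N).
  move=> x _; have /andP[b0 bC] := betaC (- (N * a) + x * N).
  by rewrite /delta normrM !ger0_norm ?(ltW N0)// ler_wpM2r// ltW.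
have id := integ_delta a N0.
have icd : integ setT (fun x => G a * delta a N x).
  rewrite (_ : EFin \o _ = fun x => ((G a)%:E * (delta a N x)%:E)%E)//.
  exact: integrableZl.
rewrite -[X in `|X - _|]mulr1 -(Rintegral_delta a N0) -RintegralZl// -RintegralB//.
have mb : measurable (ball a (2 / N) : set MR) by exact: measurable_ball.
rewrite -(@Rintegral_extend R (ball a (2 / N))); last first.
  by move=> x ax; rewrite -/(delta a N x) !(delta_out N0 ax) !mulr0 subrr.
have ib := integ_norm mb (integ_ball a (2 / N) (G a) iG).
apply: (@le_trans _ _ (Rintegral leb (ball a (2 / N) : set MR) (fun x => C * N * `|G x - G a|))).
  apply: Rintegral_norm_le => //.
  - by apply: integrableS (integrableB _ icd iGd) => //.
  - rewrite (_ : EFin \o _ = fun x => ((C * N)%:E * (`|G x - G a|)%:E)%E)//.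
    exact: integrableZl.
  - move=> x _; rewrite -mulrBl normrM distrC mulrC ler_wpM2r//.
    have /andP[b0 bC] := betaC (- (N * a) + x * N).
    by rewrite /delta normrM !ger0_norm ?(ltW N0)// ler_wpM2r// ltW.
rewrite RintegralZl//.
have N2 : 0 < 2 / N by rewrite divr_gt0.
have : Rintegral leb (ball a (2 / N) : set MR) (fun y => `|G y - G a|) <= e / (2 * (C + 1)) * (2 / N).
  apply: hr => //=; rewrite /ball/= sub0r normrN gtr0_norm//.
  by rewrite ltr_pdivrMr// mulrC -ltr_pdivrMr.
move=> H; apply: (le_trans (ler_wpM2l (mulr_ge0 C0 (ltW N0)) H)).
have -> : C * N * (e / (2 * (C + 1)) * (2 / N)) = e * (C / (C + 1)).
  by field; rewrite !gt_eqF// ltr_wpDl.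
rewrite ler_piMr ?(ltW e0)// ler_pdivrMr ?ltr_wpDl// mul1r lerDl//.
Unshelve. all: by end_near. Qed.

Lemma plateau_cvg a b x : a < b ->
  scaled S a n.+1%:R x - scaled S b n.+1%:R x @[n --> \oo] -->
  (if (a < x) && (x <= b) then 1 else 0 : R).
Proof.
move=> ab.
have step c : scaled S c n.+1%:R x @[n --> \oo] --> (if c < x then 1 else 0 : R).
  case: ltP => cx; last first.
    apply: cvg_near_cst; apply: nearW => n; apply/eqP; rewrite /scaled Sl//.
    have : x * n.+1%:R <= c * n.+1%:R by rewrite ler_wpM2r.
    lra.
  apply: cvg_near_cst; have xc : 0 < x - c by rewrite subr_gt0.
  have [k hk] : exists k : nat, 1 / (x - c) < k%:R.
    by exists (Num.truncn (1 / (x - c))).+1; exact: truncnS_gt.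
  exists k => // n /= kn; apply/eqP; rewrite /scaled Sr//.
  have : 1 / (x - c) <= n.+1%:R.
    by apply: (le_trans (ltW hk)); rewrite ler_nat (leq_trans kn).
  rewrite ler_pdivrMr//; lra.
have -> : (if (a < x) && (x <= b) then 1 else 0 : R) =
    (if a < x then 1 else 0) - (if b < x then 1 else 0).
  by case: (ltP b x) => bx; rewrite ?(lt_trans ab bx) ?andbT ?andbF ?subrr ?subr0.
exact: cvgB (step a) (step b).
Qed.

End Approx.

Section WeakDerivative.
Context {R : realType}.
Notation MR := (measurableTypeR R).
Variables (G K : R -> R).
Hypotheses (iG : integ setT G) (iK : integ setT K).
Hypothesis GK : weak_derivative G K.

(** Lemma of du Bois-Reymond: testing the weak derivative against smooth approximations of the
    indicator of the interval from [a] to [b] and passing to the limit. *)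
Lemma du_bois_reymond (a b : R) : a < b -> lebesgue_pt G a -> lebesgue_pt G b ->
  G b - G a = Rintegral leb `]a, b] K.
Proof.
move=> ab Ga Gb.
have [S [beta [C C0 [dS betaC cbeta [smS Sl Sr S01 bout]]]]] := @smooth_step R.
pose phi n x := scaled S a n.+1%:R x - scaled S b n.+1%:R x.
have dphi n (x : R) : is_derive x 1 (phi n)
    (delta beta a n.+1%:R x - delta beta b n.+1%:R x).
  exact: (is_deriveB (is_derive_scaled dS a n.+1%:R x) (is_derive_scaled dS b n.+1%:R x)).
have dphiE n : (phi n)^`()%classic =
    fun x => delta beta a n.+1%:R x - delta beta b n.+1%:R x.
  by apply/funext => x; rewrite derive1E; case: (dphi n x).
have tphi n : test_function (phi n).
  split.
    apply: smooth_uptoP => m; rewrite /phi /scaled.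
    have -> : (fun x => S (- (n.+1%:R * a) + x * n.+1%:R) - S (- (n.+1%:R * b) + x * n.+1%:R)) =
      (fun x => S (- (n.+1%:R * a) + x * n.+1%:R) + (-1) * S (- (n.+1%:R * b) + x * n.+1%:R)).
      by apply/funext => x; rewrite mulN1r.
    apply: smooth_uptoD; first exact: smooth_upto_affine.
    by apply: smooth_uptoM; [exact: smooth_upto_cst|exact: smooth_upto_affine].
  apply: (subclosed_compact _ (@segment_compact _ a (b + 1))); first exact: closed_closure.
  rewrite [X in _ `<=` X](closure_id _).1; last exact: itv_closed.
  apply: closure_subset => x /= /eqP phix; rewrite in_itv/=; apply/andP; split.
    rewrite leNgt; apply/negP => xa; apply: phix; rewrite /phi /scaled.
    have n0 : (0 : R) <= n.+1%:R by [].
    have : x * n.+1%:R <= a * n.+1%:R by rewrite ler_wpM2r// ltW.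
    have : x * n.+1%:R <= b * n.+1%:R by rewrite ler_wpM2r// ltW// (lt_trans xa).
    move=> ? ?; rewrite !Sl ?subrr//; lra.
  rewrite leNgt; apply/negP => xb; apply: phix; rewrite /phi /scaled.
  have n0 : (1 : R) <= n.+1%:R by rewrite ler1n.
  have H c : c <= b -> 1 <= - (n.+1%:R * c) + x * n.+1%:R.
    move=> cb; have -> : - (n.+1%:R * c) + x * n.+1%:R = n.+1%:R * (x - c) by ring.
    rewrite -[leLHS]mulr1 ler_pM//; lra.
  by rewrite !Sr ?subrr// H// ltW.
have phi1 n x : `|phi n x| <= 1.
  have /andP[] := S01 (- (n.+1%:R * a) + x * n.+1%:R).
  have /andP[] := S01 (- (n.+1%:R * b) + x * n.+1%:R).
  rewrite /phi /scaled ler_norml => ? ? ? ?; apply/andP; split; lra.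
have idel n c : integ setT (fun x => G x * delta beta c n.+1%:R x).
  apply: (@integ_mul_bounded R setT G (delta beta c n.+1%:R) (C * n.+1%:R)) => //.
    exact: continuous_measurable_fun (@continuous_delta R beta cbeta c n.+1%:R).
  move=> x _; have /andP[b0 bC] := betaC (- (n.+1%:R * c) + x * n.+1%:R).
  by rewrite /delta normrM !ger0_norm// ler_wpM2r.
have L1 : Rintegral leb setT (fun x => G x * (phi n)^`()%classic x) @[n --> \oo] --> G a - G b.
  pose A c n := Rintegral leb setT (fun x => G x * delta beta c n.+1%:R x).
  have LA : A a n - A b n @[n --> \oo] --> G a - G b.
    apply: cvgB; [exact: (delta_cvg C0 dS betaC cbeta Sl Sr bout iG Ga)|].
    exact: (delta_cvg C0 dS betaC cbeta Sl Sr bout iG Gb).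
  rewrite [X in X @ _ --> _](_ : _ = fun n => A a n - A b n)//.
  apply/funext => n; rewrite /A -RintegralB//.
  by apply: eq_Rintegral => x _; rewrite dphiE mulrBr.
have L2 : Rintegral leb setT (fun x => K x * phi n x) @[n --> \oo] -->
    Rintegral leb setT (fun x => K x * (if (a < x) && (x <= b) then 1 else 0)).
  apply: (@Rintegral_dct R setT _ _ (fun x => `|K x|)) => //.
  - move=> n; apply: measurable_funM; first exact: integ_measurable.
    apply: continuous_measurable_fun => x; apply/differentiable_continuous/derivable1_diffP.
    by case: (dphi n x).
  - by move=> x _; apply: cvgM; [exact: cvg_cst|exact: plateau_cvg].
  - exact: integ_norm.
  - by move=> n x _; rewrite normrM ler_piMr.
have L3 : Rintegral leb setT (fun x => K x * phi n x) @[n --> \oo] --> G b - G a.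
  rewrite -opprB [X in X @ _ --> _](_ : _ =
    fun n => - Rintegral leb setT (fun x => G x * (phi n)^`()%classic x)).
    exact: cvgN.
  by apply/funext => n; rewrite GK ?opprK.
rewrite (cvg_unique _ L3 L2)// [RHS]Rintegral_mkcond; apply: eq_Rintegral => x _.
rewrite patchE; case: ifPn => [/andP[ax xb]|H].
  by rewrite mem_set ?mulr1//= in_itv/= ax xb.
by rewrite memNset ?mulr0//= in_itv/=; exact/negP.
Qed.

Definition primitive (f : R -> R) (x : R) : R := Rintegral leb `]-oo, x] f.

Lemma primitiveB (f : R -> R) (a b : R) : integ setT f -> a < b ->
  primitive f b - primitive f a = Rintegral leb `]a, b] f.
Proof.
move=> If ab; apply: Rintegral_itvB => //; first exact: integrableS If.
by rewrite bnd_simp ltW.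
Qed.

Lemma continuous_primitive (f : R -> R) : integ setT f -> continuous (primitive f).
Proof.
move=> If x; pose a := x - 1; pose b := x + 1.
have ab : a < b by rewrite /a /b; lra.
have Iab : integ `[a, b] f by exact: integrableS If.
have xab : x \in `]a, b[ by rewrite in_itv/= /a /b; apply/andP; split; lra.
have cx := within_continuous_continuous ab
  (parameterized_integral_continuous (ltW ab) Iab) xab.
have E y : y \in `]a, b[ -> primitive f y = primitive f a + parameterized_integral leb a y f.
  rewrite in_itv/= => /andP[ay yb]; apply/eqP; rewrite addrC -subr_eq primitiveB//.
  by apply/eqP; apply: Rintegral_itv_obnd_cbnd; exact: integrableS If.
rewrite /continuous_at E//.
have H : (primitive f a + parameterized_integral leb a y f) @[y --> x] -->
    primitive f a + parameterized_integral leb a x f.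
  by apply: cvgD; [exact: cvg_cst|exact: cx].
apply: (cvg_trans _ H); apply: near_eq_cvg; near=> y; apply/esym/E.
by near: y; exact: near_in_itvoo.
Unshelve. all: by end_near. Qed.

Lemma leb_setT_gt0 : (0 < leb [set: MR])%E.
Proof.
have := @lebesgue_measure_itv R `]-oo, +oo[; rewrite set_itvNyy => H.
by rewrite [X in (_ < X)%E](H : leb [set: MR] = _)/= ltry.
Qed.

Lemma weak_primitive : exists c, {ae leb, forall x, G x = primitive K x + c}.
Proof.
have aeG := lebesgue_differentiation (open_integrable_locally openT iG).
have PF := @ae_properfilter_algebraOfSetsType _ _ _ _ leb_setT_gt0.
have [x0 Gx0] := @filter_ex _ _ PF _ aeG.
exists (G x0 - primitive K x0); apply: filterS aeG => x Gx.
have [xx0|xx0|->] := ltgtP x x0; last by ring.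
- have := du_bois_reymond xx0 Gx Gx0; rewrite -primitiveB//; lra.
- have := du_bois_reymond xx0 Gx0 Gx; rewrite -primitiveB//; lra.
Qed.

(** Two continuous functions that agree almost everywhere agree. *)
Lemma continuous_ae_eq (f g : R -> R) : continuous f -> continuous g ->
  {ae leb, forall x, f x = g x} -> f =1 g.
Proof.
move=> cf cg [N [mN N0 fgN]] x; apply/eqP; apply/negPn/negP => fgx.
have : {for x, continuous (fun x => `|f x - g x|)}.
  by apply: cvg_norm; apply: cvgB; [exact: cf|exact: cg].
have p : 0 < `|f x - g x| by rewrite normr_gt0 subr_eq0.
move=> /cvgr_gt/(_ _ p)[e /= e0 he].
have : (leb (ball x e : set MR) <= leb N)%E.
  apply: le_measure; rewrite ?inE//; first exact: measurable_ball.
  move=> y xy; apply: fgN => fgy; have := he y xy; rewrite /= fgy subrr normr0 ltxx.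
  by [].
have := lebesgue_measure_ball x (ltW e0) => /= ->; rewrite N0 lee_fin leNgt.
by rewrite mulrn_wgt0.
Qed.

(** An even function has an odd weak derivative.  Both sides are compared through the primitive of
    [K], which is continuous, hence even everywhere, and which has derivative [K] almost
    everywhere. *)
Lemma weak_derivative_odd : {ae leb, forall x : R, G (- x) = G x} ->
  {ae leb, forall x : R, K (- x) = - K x}.
Proof.
move=> Geven; have [c Gc] := weak_primitive.
have FF := ae_filter_ringOfSetsType (@leb R).
have reflect_ae (P : R -> Prop) : {ae leb, forall x, P x} -> {ae leb, forall x, P (- x)}.
  by move=> /(ae_reflect 0); apply: filterS => x; rewrite sub0r.
have cP := continuous_primitive iK.
have Peven : (fun x => primitive K (- x)) =1 primitive K.
  apply: continuous_ae_eq => //.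
    move=> x; apply: (@continuous_comp _ _ _ -%R (primitive K)).
      exact: opp_continuous.
    exact: cP.
  apply: filterS3 Geven Gc (reflect_ae _ Gc) => x e1 e2 e3.
  by apply: (@addIr _ c); rewrite -e2 -e3.
have iK' y : leb.-integrable [set` Interval -oo%O (BRight y)] (EFin \o K).
  exact: integrableS iK.
have dP := FTC1Ny iK' (open_integrable_locally openT iK).
apply: filterS2 dP (reflect_ae _ dP) => x [d1 e1] [d2 e2].
rewrite -e1 -e2.
have D1 : is_derive (- x) 1 (primitive K) ((primitive K)^`()%classic (- x)).
  by rewrite derive1E; exact: DeriveDef.
have := @is_derive1_comp _ (primitive K) -%R x _ _ D1 (is_deriveN (is_derive_id x 1)).
rewrite (_ : _ \o _ = primitive K); last exact/funext/Peven.
by move=> [_]; rewrite -derive1E mulrN1 => ->; rewrite opprK.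
Qed.

End WeakDerivative.

(** * The derivative of a convolution *)

Section ConvolDerivative.
Context {R : realType}.
Notation MR := (measurableTypeR R).
Variables (G K w : R -> R) (M : R).
Hypotheses (iG : integ setT G) (iK : integ setT K).
Hypothesis GK : weak_derivative G K.
Hypotheses (cw : continuous w) (wM : forall y, `|w y| <= M).

Let mw : measurable_fun [set: MR] w.
Proof. exact: continuous_measurable_fun. Qed.

Let mwx x : measurable_fun [set: MR] (fun z => w (x - z)).
Proof. exact: (measurableT_comp mw (measurable_subl x)). Qed.

Lemma convol_shift x th : convol K w (x + th) =
  Rintegral leb setT (fun z => K (z + th) * w (x - z)).
Proof.
rewrite (convolC _ iK mw wM) -(@Rintegral_shift _ th (fun z => K z * w (x + th - z))).
  by apply: eq_Rintegral => z _; congr (_ * w _); ring.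
exact: (@integ_mul_bounded _ _ _ _ M).
Qed.

(** The increments of [convol G w] are the integrals of [convol K w], by Fubini and because [G] is
    a primitive of [K]. *)
Lemma convol_increment x d : 0 < d ->
  convol G w (x + d) - convol G w x = Rintegral leb `]0, d] (fun th => convol K w (x + th)).
Proof.
move=> d0.
pose I : R -> R := \1_(`]0, d]%classic : set MR).
have mI : measurable_fun [set: MR] I by exact: measurable_indic.
have I01 th : `|I th| <= 1.
  by rewrite /I indicE; case: (_ \in _); rewrite ?normr1 ?normr0.
have iI : integ setT I by exact: integ_indic.
pose f (p : R * R) := I p.1 * (K (p.2 + p.1) * w (x - p.2)).
have mf : measurable_fun [set: MR * MR] f.
  apply: measurable_funM.
    exact: (measurableT_comp mI measurable_fst).
  apply: measurable_funM.
    apply: (measurableT_comp (integ_measurable measurableT iK)).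
    by apply: measurable_funD; [exact: measurable_snd|exact: measurable_fst].
  exact: (measurableT_comp (mwx x) measurable_snd).
have iKw th : integ setT (fun z => K (z + th) * w (x - z)).
  apply: (@integ_mul_bounded _ _ _ _ M) => //; exact: (integrable_shift th iK).
have f1 th : integ setT (fun z => f (th, z)).
  exact: (integZl (I th) measurableT (iKw th)).
have IKz z : integ setT (fun th => I th * K (z + th)).
  rewrite (_ : (fun th => I th * K (z + th)) = (fun th => K (th + z) * I th)); last first.
    by apply/funext => th; rewrite mulrC addrC.
  apply: (@integ_mul_bounded _ _ _ _ 1) => //; exact: (integrable_shift z iK).
have f2 z : integ setT (fun th => f (th, z)).
  rewrite (_ : (fun th => f (th, z)) = fun th => I th * K (z + th) * w (x - z)); last first.
    by apply/funext => th; rewrite /f/= mulrA.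
  exact: (integZr (w (x - z)) measurableT (IKz z)).
pose k := Rintegral leb setT (fun z => `|K z|).
have [||_ _ E] := @Rintegral_fubini R f (fun th => I th * (M * k)) mf f1 f2.
- exact: (integZr (M * k) measurableT iI).
- move=> th; rewrite /f/=.
  have I0 : 0 <= I th by rewrite /I indicE.
  under eq_Rintegral => z _ do rewrite normrM (ger0_norm I0).
  rewrite RintegralZl//; last exact: integ_norm.
  rewrite ler_wpM2l// /k -(@Rintegral_shift _ th (fun z => `|K z|)); last exact: integ_norm.
  have iKt : integ setT (fun z => `|K (z + th)|).
    by apply: integ_norm => //; exact: (integrable_shift th iK).
  rewrite -RintegralZl//; apply: le_Rintegral => //.
  + exact: integ_norm.
  + exact: (integZl M measurableT iKt).
  + by move=> z _; rewrite normrM mulrC ler_wpM2r.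
move: E; rewrite /f/=.
under eq_Rintegral => th _ do rewrite RintegralZl// -convol_shift.
rewrite (_ : Rintegral leb setT (fun th => I th * convol K w (x + th)) =
  Rintegral leb `]0, d] (fun th => convol K w (x + th))); last first.
  rewrite [RHS]Rintegral_mkcond; apply: eq_Rintegral => th _.
  by rewrite patchE /I indicE; case: (_ \in _); rewrite ?mul1r ?mul0r.
have EZ z : Rintegral leb setT (fun th => I th * (K (z + th) * w (x - z))) =
    (primitive K (z + d) - primitive K z) * w (x - z).
  under eq_Rintegral => th _ do rewrite mulrA.
  rewrite RintegralZr//.
  rewrite primitiveB ?ltrDl//; congr (_ * _).
  have iI' : integ setT (fun y => I (y - z) * K y).
    rewrite (_ : (fun y => _) = fun y => K y * I (y - z)); last first.
      by apply/funext => y; rewrite mulrC.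
    apply: (@integ_mul_bounded _ _ _ _ 1) => //.
    exact: (measurableT_comp mI (measurable_addr (- z))).
  transitivity (Rintegral leb setT (fun y => I (y - z) * K y)).
    rewrite -(@Rintegral_shift _ z (fun y => I (y - z) * K y))//.
    by apply: eq_Rintegral => th _; rewrite addrK [th + z]addrC.
  rewrite [RHS]Rintegral_mkcond; apply: eq_Rintegral => y _.
  rewrite patchE /I indicE.
  have -> : (y - z \in (`]0, d]%classic : set MR)) = (y \in (`]z, z + d]%classic : set MR)).
    by apply/idP/idP => /set_mem/=; rewrite in_itv/= => /andP[? ?]; apply/mem_set;
      rewrite /= in_itv/=; apply/andP; split; lra.
  by case: (_ \in _); rewrite ?mul1r ?mul0r.
move=> ->.
under [RHS]eq_Rintegral => z _ do rewrite EZ.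
have iGw y : integ setT (fun z => G z * w (y - z)).
  exact: (@integ_mul_bounded _ _ _ _ M).
have iGw' : integ setT (fun z => G (z + d) * w (x - z)).
  apply: (@integ_mul_bounded _ _ _ _ M) => //; exact: (integrable_shift d iG).
rewrite !(convolC _ iG mw wM).
rewrite -(@Rintegral_shift _ d (fun z => G z * w (x + d - z)))//.
have -> : Rintegral leb setT (fun z => G (z + d) * w (x + d - (z + d))) =
    Rintegral leb setT (fun z => G (z + d) * w (x - z)).
  by apply: eq_Rintegral => z _; congr (_ * w _); ring.
rewrite -RintegralB//.
have FF := ae_filter_ringOfSetsType (@leb R).
have [c Gc] := weak_primitive iG iK GK.
congr fine; apply: ae_eq_integral => //.
- by apply/measurable_EFinP; apply: integ_measurable => //; exact: (integB measurableT iGw' (iGw x)).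
- apply/measurable_EFinP; apply: measurable_funM; last exact: mwx.
  have mP : measurable_fun [set: MR] (primitive K).
    exact: continuous_measurable_fun (continuous_primitive iK).
  apply: measurable_funB => //.
  exact: (measurableT_comp mP (measurable_addr d)).
- apply: filterS2 Gc (ae_shift d Gc) => z e1 e2 _ /=; congr (_%:E).
  by rewrite e1 e2; ring.
Qed.

Lemma derive1_convol (x : R) : derivable (convol G w) x 1 ->
  (convol G w)^`()%classic x = convol K w x.
Proof.
move=> dF; pose F := convol G w; pose h := convol K w.
have ch : {for x, continuous h} by exact: (continuous_convol iK cw wM).
have L1 : d^-1 * (F (x + d) - F x) @[d --> 0^'+] --> F^`()%classic x.
  rewrite derive1E; apply: cvg_dnbhs_at_right.
  rewrite (_ : (fun d => _) = fun d => d^-1 *: ((F \o shift x) (d *: 1) - F x)); last first.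
    by apply/funext => d /=; rewrite -[d *: 1]/(d * 1) mulr1 [d + x]addrC.
  exact: dF.
apply: (cvg_unique _ L1) => //.
apply/cvgrPdist_le => e e0.
have /cvgrPdist_le/(_ _ e0)[r /= r0 hr] := ch.
near=> d.
have d0 : 0 < d by near: d; exact: nbhs_right_gt.
have dr : d < r by near: d; exact: nbhs_right_lt.
rewrite convol_increment//.
have hd : {within `[0, d], continuous (fun th => h (x + th))}.
  apply: continuous_subspaceT => th.
  apply: (@continuous_comp _ _ _ (fun th => x + th) h).
    by apply: cvgD; [exact: cvg_cst|exact: cvg_id].
  exact: (continuous_convol iK cw wM).
have ih : integ `]0, d] (fun th => h (x + th)).
  apply: (@integrableS _ MR R leb `[0, d]) => //; last exact: integ_segment.
  by move=> th /=; rewrite !in_itv/= => /andP[/ltW -> ->].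
have ic (r' : R) : integ `]0, d] (fun=> r').
  by apply: (@integ_bounded _ _ _ `|r'|) => //; exact: leb_bnd_lty.
have -> : h x - d^-1 * Rintegral leb `]0, d] (fun th => h (x + th)) =
    d^-1 * Rintegral leb `]0, d] (fun th => h x - h (x + th)).
  rewrite RintegralB//.
  by rewrite Rintegral_cst_bnd// subr0 mulrBr mulrCA mulVf ?mulr1// gt_eqF.
rewrite normrM gtr0_norm ?invr_gt0// mulrC ler_pdivrMr//.
rewrite -[X in _ <= _ * X]subr0 -(Rintegral_cst_bnd false false)//.
apply: Rintegral_norm_le => //; first exact: integB.
move=> th /=; rewrite in_itv/= => /andP[th0 thd]; apply: hr => /=.
by rewrite opprD addNKr normrN gtr0_norm// (le_lt_trans thd).
Unshelve. all: by end_near. Qed.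

End ConvolDerivative.

(** * The source term and the amplitude *)

Section Force.
Context {R : realType}.
Notation MR := (measurableTypeR R).
Variables (G K : R -> R) (T : \bar R) (u : R * R -> R).
Hypotheses (iG : integ setT G) (iK : integ setT K).
Hypothesis GK : weak_derivative G K.
Hypotheses (uC1 : C1_on (slab T) u) (ueq : solves_eq G T u).

Lemma continuous_slice t : 0 < t -> (t%:E < T)%E -> continuous (fun x => u (t, x)).
Proof.
move=> t0 tT x; apply/differentiable_continuous/derivable1_diffP.
have [du _ _] := @uC1 (t, x) (conj t0 tT).
by case: (is_derive_space du).
Qed.

(** The equation along characteristics. *)
Lemma forceE t x (M : R) : 0 < t -> (t%:E < T)%E -> (forall y, `|u (t, y)| <= M) ->
  force u t x = convol K (fun y => u (t, y)) x.
Proof.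
move=> t0 tT uM.
have [du _ _] := @uC1 (t, x) (conj t0 tT).
have [dF E] := @ueq t x (conj t0 tT).
rewrite -(derive1_convol iG iK GK (continuous_slice t0 tT) uM dF) -E /force.
congr (_ + _).
have -> : (fun p => u p ^+ 2) = u ^+ 2 by apply/funext => p; rewrite fctE.
rewrite deriveX; last by apply: diff_derivable.
by rewrite expr1 -[_ *: _]/(_ * _); field.
Qed.

Lemma TV_seminorm_diff (s k h : R) : (TV_seminorm s K <= k%:E)%E -> 0 < h ->
  Rintegral leb setT (fun z => `|K (z + h) - K z|) <= k * h `^ s.
Proof.
move=> TVk h0.
have iKh : integ setT (fun z => K (z + h)) by exact: (integrable_shift h iK).
have : (Lnorm leb 1 (EFin \o (fun x => (K (x + h) - K x)%R)) / (h `^ s)%:E <= k%:E)%E.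
  by apply: le_trans TVk; apply: ereal_sup_ubound; exists h.
rewrite Lnorm1 => H.
have hs : 0 < h `^ s by exact: powR_gt0.
rewrite -ler_pdivrMr//.
have E : (\int[leb]_x `|(EFin \o (fun x => (K (x + h) - K x)%R)) x|)%E =
    (Rintegral leb setT (fun z => `|K (z + h) - K z|))%:E.
  rewrite fineK//.
  exact: (integrable_fin_num measurableT (integ_norm measurableT (integB measurableT iKh iK))).
by move: H; rewrite E inver gt_eqF// -EFinM lee_fin.
Qed.

Lemma force_holder (s k m t x y : R) : (TV_seminorm s K <= k%:E)%E ->
  0 < t -> (t%:E < T)%E -> (forall z, `|u (t, z)| <= m) -> x < y ->
  `|force u t x - force u t y| <= k * m * (y - x) `^ s.
Proof.
move=> TVk t0 tT um xy; rewrite !(forceE _ t0 tT um).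
have h0 : 0 < y - x by rewrite subr_gt0.
set w := fun y => u (t, y).
have cw : continuous w by exact: continuous_slice.
have mw : measurable_fun [set: MR] w by exact: continuous_measurable_fun.
have mwx : measurable_fun [set: MR] (fun z => w (x - z)).
  exact: (measurableT_comp mw (measurable_subl x)).
have iKh : integ setT (fun z => K (z + (y - x))) by exact: (integrable_shift (y - x) iK).
rewrite -{1}[y](subrKC x) (convol_shift iK cw um) (convolC x iK mw um) distrC.
rewrite -RintegralB//; first last.
- exact: (integ_mul_bounded measurableT mwx (fun z _ => um (x - z)) iK).
- exact: (integ_mul_bounded measurableT mwx (fun z _ => um (x - z)) iKh).
have m0 : 0 <= m by apply: le_trans (um 0).
rewrite mulrAC mulrC.
apply: le_trans (ler_wpM2l m0 (TV_seminorm_diff TVk h0)).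
have iD := integB measurableT iKh iK.
rewrite -RintegralZl//; last exact: integ_norm.
apply: Rintegral_norm_le => //.
- under eq_fun do rewrite -mulrBl.
  exact: (integ_mul_bounded measurableT mwx (fun z _ => um (x - z)) iD).
- exact: (integZl m measurableT (integ_norm measurableT iD)).
- by move=> z _; rewrite -mulrBl normrM mulrC ler_wpM2r//; exact: um.
Qed.

End Force.

Section SupBound.
Context {R : realType}.
Notation MR := (measurableTypeR R).

(** Below a positive value [v x], the one-sided Hoelder bound keeps [v] above half of that value
    on a segment of length [l], so that the [L^2] bound limits [v x]. *)
Lemma sup_bound_oneside (v : R -> R) (s a N x : R) : 0 <= s -> s <= 1 -> 0 < a -> 0 < N ->
  continuous v ->
  (forall x y, x < y -> v x - v y <= a * (y - x) `^ ((1 + s) / 2)) ->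
  (forall a b, a < b -> Rintegral leb `[a, b] (fun z => v z ^+ 2) <= 16 * N ^+ 2) ->
  0 < v x -> v x `^ (2 + s) <= 128 * N `^ (1 + s) * a.
Proof.
move=> s0 s1 a0 N0 cv va L2 mu0; set mu := v x in mu0 *.
pose alpha := (1 + s) / 2; pose l := (mu / (2 * a)) `^ alpha^-1.
have al0 : 0 < alpha by rewrite /alpha; lra.
have l0 : 0 < l by rewrite powR_gt0// divr_gt0// mulr_gt0.
have low z : x <= z <= x + l -> mu / 2 <= v z.
  move=> /andP[xz zl]; have [->|zx] := eqVneq z x; first by rewrite -/mu; lra.
  have xz' : x < z by rewrite lt_neqAle eq_sym zx.
  have h : (z - x) `^ alpha <= mu / (2 * a).
    have -> : mu / (2 * a) = l `^ alpha.
      rewrite /l -powRrM mulVf ?gt_eqF// powRr1// divr_ge0 ?(ltW mu0)//.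
      by rewrite mulr_ge0// ltW.
    apply: ge0_ler_powR; rewrite ?nnegrE ?(ltW al0) ?(ltW l0) ?subr_ge0//.
    by rewrite lerBlDl.
  have := va x z xz'; rewrite -/mu -/alpha => H.
  have : a * (z - x) `^ alpha <= a * (mu / (2 * a)) by rewrite ler_wpM2l// ltW.
  have -> : a * (mu / (2 * a)) = mu / 2 by field; rewrite gt_eqF.
  lra.
have xl : x < x + l by rewrite ltrDl.
have cv2 : continuous (fun z => v z ^+ 2) by move=> z; apply: cvgM; exact: cv.
have I1 : (mu / 2) ^+ 2 * l <= 16 * N ^+ 2.
  apply: le_trans (L2 x (x + l) xl).
  have -> : (mu / 2) ^+ 2 * l = (mu / 2) ^+ 2 * (x + l - x) by ring.
  rewrite -(Rintegral_cst_bnd true false)//.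
  apply: le_Rintegral => //.
  - by apply: (@integ_bounded _ _ _ `|(mu / 2) ^+ 2|) => //; exact: leb_bnd_lty.
  - by apply: integ_segment; exact: continuous_subspaceT.
  - move=> z /=; rewrite in_itv/= => /low hz.
    rewrite ler_sqr ?nnegrE//; first lra.
    apply: le_trans hz; lra.
have al1 : alpha <= 1 by rewrite /alpha; lra.
have I2 : mu ^+ 2 * l <= 64 * N ^+ 2.
  by move: I1; rewrite expr_div_n; lra.
have P0 : 0 <= mu ^+ 2 * l by rewrite mulr_ge0 ?sqr_ge0 ?(ltW l0).
have := @ge0_ler_powR R alpha (ltW al0) _ _ P0 (le_trans P0 I2) I2.
have sq (z : R) : 0 < z -> (z ^+ 2) `^ alpha = z `^ (1 + s).
  move=> z0; rewrite -powR_mulrn ?(ltW z0)// -powRrM; congr (_ `^ _).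
  by rewrite /alpha; field.
rewrite /= (powRM _ (sqr_ge0 mu) (ltW l0)) (@powRM _ 64 _ _ _ (sqr_ge0 N))//.
rewrite (sq _ mu0) (sq _ N0).
have -> : l `^ alpha = mu / (2 * a).
  rewrite /l -powRrM mulVf ?gt_eqF// powRr1// divr_ge0 ?(ltW mu0)//.
  by rewrite mulr_ge0// ltW.
have -> : mu `^ (2 + s) = mu `^ (1 + s) * mu.
  have -> : 2 + s = (1 + s) + 1 by ring.
  by rewrite gt0_powRD// powRr1// ltW.
move=> I3.
have B64 : (64 : R) `^ alpha <= 64.
  by rewrite -[leRHS]powRr1//; apply: ler_powR => //; rewrite ler1n.
have NN : 0 <= N `^ (1 + s) by exact: powR_ge0.
have I4 : 64 `^ alpha * N `^ (1 + s) <= 64 * N `^ (1 + s) by rewrite ler_wpM2r.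
have := le_trans I3 I4; rewrite mulrA ler_pdivrMr ?mulr_gt0//; lra.
Qed.

Lemma sup_bound (v : R -> R) (s a N x : R) : 0 <= s -> s <= 1 -> 0 < a -> 0 < N ->
  continuous v ->
  (forall x y, x < y -> v x - v y <= a * (y - x) `^ ((1 + s) / 2)) ->
  (forall a b, a < b -> Rintegral leb `[a, b] (fun z => v z ^+ 2) <= 16 * N ^+ 2) ->
  `|v x| `^ (2 + s) <= 128 * N `^ (1 + s) * a.
Proof.
move=> s0 s1 a0 N0 cv va L2; have [x0|x0|->] := ltgtP (v x) 0; last first.
- rewrite normr0 powR0; last by rewrite gt_eqF//; lra.
  by rewrite mulr_ge0 ?(ltW a0)// mulr_ge0// powR_ge0.
- by rewrite gtr0_norm//; exact: sup_bound_oneside.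
rewrite ltr0_norm// -[in leLHS](opprK x).
apply: (@sup_bound_oneside (fun z => - v (- z)) s a N (- x)) => //.
- move=> z; apply: cvgN; apply: (@continuous_comp _ _ _ -%R v); first exact: opp_continuous.
  exact: cv.
- move=> y z yz; rewrite opprK addrC (_ : z - y = - y - - z); last by ring.
  by apply: va; rewrite ltrN2.
- move=> b c bc.
  apply: le_trans (L2 (- c) (- b) _); last by rewrite ltrN2.
  have cv2 : continuous (fun z => v z ^+ 2) by move=> z; apply: cvgM; exact: cv.
  have i2 : integ `[- c, - b] (fun z => v z ^+ 2).
    by apply: integ_segment; exact: continuous_subspaceT.
  rewrite Rintegral_mkcond [leRHS]Rintegral_mkcond.
  rewrite -(@Rintegral_reflect _ 0 ((fun z => v z ^+ 2) \_ `[- c, - b])); last first.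
    have mI : measurable (`[- c, - b]%classic : set MR) by [].
    by move: i2 => /(integrable_mkcond _ mI); rewrite restrict_EFin.
  rewrite le_eqVlt; apply/orP; left; apply/eqP/eq_Rintegral => z _.
  rewrite !patchE sub0r sqrrN.
  have -> : (z \in (`[b, c]%classic : set MR)) = (- z \in (`[- c, - b]%classic : set MR)).
    by apply/idP/idP => /set_mem/=; rewrite in_itv/= => /andP[? ?]; apply/mem_set;
      rewrite /= in_itv/=; apply/andP; split; lra.
  by [].
- by rewrite opprK oppr_gt0.
Qed.

End SupBound.

(** * Slowly varying weights *)

Section Weights.
Context {R : realType}.
Notation MR := (measurableTypeR R).
Implicit Types (L B : R).

(** An integrable nonnegative [C^1] function [f] with derivative [f'] that varies on the length
    scale [L]. *)
Definition weight L (f f' : R -> R) : Prop :=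
  [/\ forall x : R, is_derive x 1 f (f' x), continuous f', forall x, 0 <= f x,
      forall x, `|f' x| <= f x / L & integ setT f].

Lemma weight_continuous L (f f' : R -> R) : weight L f f' -> continuous f.
Proof.
by move=> [df _ _ _ _] x; apply/differentiable_continuous/derivable1_diffP; case: (df x).
Qed.

Lemma weightD L (f f' g g' : R -> R) : weight L f f' -> weight L g g' ->
  weight L (fun x => f x + g x) (fun x => f' x + g' x).
Proof.
move=> [df cf f0 fL If] [dg cg g0 gL Ig]; split.
- by move=> x; exact: (is_deriveD (df x) (dg x)).
- by move=> x; apply: cvgD; [exact: cf|exact: cg].
- by move=> x; rewrite addr_ge0.
- by move=> x; rewrite (le_trans (ler_normD _ _))// mulrDl lerD.
- exact: integD.
Qed.

Lemma convol_L1 (kap f : R -> R) B : (forall z, 0 <= kap z) -> integ setT kap ->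
  continuous f -> (forall x, 0 <= f x) -> (forall x, f x <= B) -> integ setT f ->
  integ setT (convol kap f) /\
  Rintegral leb setT (convol kap f) = Rintegral leb setT kap * Rintegral leb setT f.
Proof.
move=> k0 ik cf f0 fB If.
have mf : measurable_fun [set: MR] f by exact: continuous_measurable_fun.
have fB' x : `|f x| <= B by rewrite ger0_norm.
pose F (p : R * R) := kap (p.2 - p.1) * f p.1.
have mF : measurable_fun [set: MR * MR] F.
  apply: measurable_funM.
    apply: (measurableT_comp (integ_measurable measurableT ik)).
    by apply: measurable_funB; [exact: measurable_snd|exact: measurable_fst].
  exact: (measurableT_comp mf measurable_fst).
have iky y : integ setT (fun x => kap (x - y)) by exact: (integrable_shift (- y) ik).
have Iky y : Rintegral leb setT (fun x => kap (x - y)) = Rintegral leb setT kap.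
  exact: (Rintegral_shift (- y) ik).
have F1 y : integ setT (fun x => F (y, x)) by exact: (integZr (f y) measurableT (iky y)).
have F2 x : integ setT (fun y => F (y, x)) by exact: (integ_convol x ik mf fB').
have E1 y : Rintegral leb setT (fun x => F (y, x)) = Rintegral leb setT kap * f y.
  by rewrite -(Iky y) -RintegralZr.
have ia : integ setT (fun y => Rintegral leb setT kap * f y) by exact: integZl.
have [|_ I1 E] := Rintegral_fubini mF F1 F2 ia.
  move=> y; rewrite -E1 le_eqVlt; apply/orP; left; apply/eqP/eq_Rintegral => x _.
  by rewrite ger0_norm// mulr_ge0.
split; first exact: I1.
rewrite -RintegralZl//; rewrite -[LHS]/(Rintegral leb setT (fun x => Rintegral leb setT (fun y => F (y, x)))).
by rewrite -E; apply: eq_Rintegral => y _; rewrite E1.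
Qed.

Lemma weight_conv L B (f f' kap : R -> R) : 0 < L -> weight L f f' -> (forall x, f x <= B) ->
  (forall z, 0 <= kap z) -> integ setT kap ->
  weight L (convol kap f) (convol kap f').
Proof.
move=> L0 Wf fB kap0 ik; have [df cf' f0 fL If] := Wf.
have cf := weight_continuous Wf.
have f'B x : `|f' x| <= B / L.
  by apply: le_trans (fL x) _; rewrite ler_wpM2r ?invr_ge0 ?(ltW L0).
have fB' x : `|f x| <= B by rewrite ger0_norm.
have mf : measurable_fun [set: MR] f by exact: continuous_measurable_fun.
have mf' : measurable_fun [set: MR] f' by exact: continuous_measurable_fun.
have E : convol kap f = fun x => Rintegral leb setT (fun z => kap z * f (x - z)).
  by apply/funext => x; rewrite (convolC x ik mf fB').
have dsub (x z : R) : is_derive x 1 (fun x => kap z * f (x - z)) (kap z * f' (x - z)).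
  have d1 : is_derive x 1 (fun x : R => - z + x * 1) 1 by exact: is_derive_affine.
  have d2 : is_derive x 1 (fun x : R => f (x - z)) (f' (x - z)).
    have := @is_derive1_comp _ f (fun x : R => - z + x * 1) x (f' (x - z)) 1.
    rewrite mulr1 addrC mulr1 (_ : f \o _ = fun x => f (x - z)); last first.
      by apply/funext => y /=; rewrite mulr1 addrC.
    by apply.
  by have := is_deriveZ (kap z) d2; rewrite [X in is_derive _ _ X _](_ : _ = fun x => kap z * f (x - z)).
have dE (x z : R) : partial1of2 (fun x z => kap z * f (x - z)) x z = kap z * f' (x - z).
  by rewrite /partial1of2 derive1E; case: (dsub x z).
have iG : integ setT (fun z => kap z * (B / L)) by exact: integZr.
have B0 : 0 <= B by apply: le_trans (fB 0).
have H1 x y : `](x - 1), (x + 1)[%classic y -> integ setT (fun z => kap z * f (y - z)).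
  move=> _; apply: (@integ_mul_bounded _ _ _ _ B) => //.
  exact: (measurableT_comp mf (measurable_subl y)).
have H2 x y z : `](x - 1), (x + 1)[%classic y -> setT z ->
    derivable (fun x => kap z * f (x - z)) y 1.
  by move=> _ _; case: (dsub y z).
have H3 z : 0 <= kap z * (B / L) by rewrite mulr_ge0// divr_ge0// ltW.
have H4 x y z : `](x - 1), (x + 1)[%classic y -> setT z ->
    `|partial1of2 (fun x z => kap z * f (x - z)) y z| <= kap z * (B / L).
  by move=> _ _; rewrite dE normrM ger0_norm// ler_wpM2l.
have Ix (x : R) : `](x - 1), (x + 1)[%classic x by rewrite /= in_itv/=; apply/andP; split; lra.
split.
- move=> x; rewrite E; apply: DeriveDef.
    exact: (@derivable_under_integral _ _ MR leb _ _ measurableT x _ _ (Ix x)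
      (H1 x) (H2 x) _ H3 iG (H4 x)).
  rewrite -derive1E (@differentiation_under_integral _ _ MR leb _ _ measurableT x _ _ (Ix x)
      (H1 x) (H2 x) _ H3 iG (H4 x)).
  rewrite (convolC x ik mf' f'B); apply: eq_Rintegral => z _; exact: dE.
- exact: (continuous_convol ik cf' f'B).
- by move=> x; apply: Rintegral_ge0 => z _; rewrite mulr_ge0.
- move=> x; rewrite (convolC x ik mf fB') (convolC x ik mf' f'B).
  have mfx : measurable_fun [set: MR] (fun z => f (x - z)).
    exact: (measurableT_comp mf (measurable_subl x)).
  have mfx' : measurable_fun [set: MR] (fun z => f' (x - z)).
    exact: (measurableT_comp mf' (measurable_subl x)).
  have i1 := integ_mul_bounded measurableT mfx (fun z _ => fB' (x - z)) ik.
  have i2 := integ_mul_bounded measurableT mfx' (fun z _ => f'B (x - z)) ik.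
  rewrite -RintegralZr//; apply: Rintegral_norm_le => //; first exact: integZr.
  by move=> z _; rewrite normrM ger0_norm// -mulrA ler_wpM2l.
- exact: (convol_L1 kap0 ik cf f0 fB If).1.
Qed.

(** The basic weight: a bump of height [1] and width [L], slowly varying. *)
Definition lorentz L (x : R) : R := (1 + (x / L) ^+ 2)^-1.

Lemma lorentz_ge0 L x : 0 <= lorentz L x.
Proof. by rewrite invr_ge0 addr_ge0// sqr_ge0. Qed.

Lemma lorentz_le1 L x : lorentz L x <= 1.
Proof. by rewrite invf_le1 ?ltr_wpDr ?sqr_ge0// lerDl sqr_ge0. Qed.

Lemma lorentz_ge L x : 0 < L -> `|x| <= L -> 1 / 2 <= lorentz L x.
Proof.
move=> L0 xL; rewrite div1r lef_pV2 ?posrE ?ltr_wpDr ?sqr_ge0//.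
have : (x / L) ^+ 2 <= 1; last by lra.
rewrite -[(x / L) ^+ 2]real_normK ?num_real// normrM normfV (gtr0_norm L0) exprn_ile1//.
  by rewrite divr_ge0// ltW.
by rewrite ler_pdivrMr// mul1r.
Qed.

Lemma integ_lorentz L : 1 <= L -> integ setT (lorentz L).
Proof.
move=> L1; have L0 : 0 < L by exact: lt_le_trans L1.
have D0 x : 0 < 1 + (x / L) ^+ 2 by rewrite ltr_wpDr ?sqr_ge0.
pose g (x : R) : R := (oneDsqr x)^-1.
have g0 x : 0 <= g x by rewrite invr_ge0 (le_trans ler01)// oneDsqr_ge1.
have cg : continuous g by exact: continuous_oneDsqrV.
have i1 : integ setT g.
  apply: (@introT _ _ (integrableP _ _ _)); split.
    by apply/measurable_EFinP; exact: (continuous_measurable_fun cg).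
  have E2 : (\int[leb]_x `|(EFin \o g) x|)%E = (\int[leb]_x (g x)%:E)%E.
    by apply: eq_integral => x _; rewrite /= ger0_norm.
  have ge x : g x = (g \o -%R) x by rewrite /g /= /oneDsqr sqrrN.
  have E3 : (\int[leb]_x (g x)%:E)%E = _ := @ge0_symfun_integralT R g g0 cg ge.
  rewrite E2 E3.
  by rewrite -set_itvcy integral0y_oneDsqr -EFinM ltry.
apply: (@le_integ R setT _ (fun x => L ^+ 2 * g x)) => //.
- apply: continuous_measurable_fun => x; apply: cvgV; first by rewrite gt_eqF.
  apply: cvgD; first exact: cvg_cst.
  by apply: cvgM; apply: cvgM; (exact: cvg_id || exact: cvg_cst).
- move=> x _; rewrite ger0_norm ?lorentz_ge0//.
  have o0 : 0 < oneDsqr x by apply: lt_le_trans (oneDsqr_ge1 x).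
  rewrite /lorentz /g ler_pdivlMr// mulrC ler_pdivrMr// /oneDsqr.
  rewrite mulrDr mulr1 expr_div_n mulrCA divff ?mulr1 ?expf_neq0 ?gt_eqF//.
  by rewrite lerD2r expr_ge1// ltW.
- exact: integZl.
Qed.

Lemma weight_lorentz L : 1 <= L ->
  weight L (lorentz L) (fun x => - lorentz L x ^+ 2 * (2 * (x / L) / L)).
Proof.
move=> L1; have L0 : 0 < L by exact: lt_le_trans L1.
have D0 x : 0 < 1 + (x / L) ^+ 2 by rewrite ltr_wpDr ?sqr_ge0.
have dx (x : R) : is_derive x 1 (fun y : R => 1 + (y / L) ^+ 2) (2 * (x / L) / L).
  have d1 : is_derive x 1 (fun y : R => 0 + y * L^-1) L^-1 by exact: is_derive_affine.
  have := is_deriveD (is_derive_cst (1 : R) x 1) (is_deriveM d1 d1).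
  rewrite [X in is_derive _ _ X _](_ : _ = fun y => 1 + (y / L) ^+ 2); last first.
    by apply/funext => y; rewrite -[LHS]/(1 + (0 + y / L) * (0 + y / L)) add0r.
  by move/is_derive_eq; apply; rewrite -[LHS]/(0 + ((0 + x / L) * L^-1 + (0 + x / L) * L^-1)); ring.
have dl (x : R) : is_derive x 1 (lorentz L) (- lorentz L x ^+ 2 * (2 * (x / L) / L)).
  have := @is_deriveV R (fun y : R => 1 + (y / L) ^+ 2) x _ 1 (lt0r_neq0 (D0 x)) (dx x).
  by move/is_derive_eq; apply; rewrite /lorentz exprVn -[LHS]/(_ * _).
have cl : continuous (lorentz L).
  by move=> x; apply/differentiable_continuous/derivable1_diffP; case: (dl x).
split => //.
- move=> x; apply: cvgM.
    by apply: cvgN; apply: cvgM; exact: cl.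
  apply: cvgM; last exact: cvg_cst.
  by apply: cvgM; [exact: cvg_cst|apply: cvgM; [exact: cvg_id|exact: cvg_cst]].
- exact: lorentz_ge0.
- move=> x; have l0 := lorentz_ge0 L x.
  have -> : - lorentz L x ^+ 2 * (2 * (x / L) / L) =
      lorentz L x * - (lorentz L x * (2 * (x / L))) * L^-1 by ring.
  rewrite 2!normrM (ger0_norm l0) [`|L^-1|]gtr0_norm ?invr_gt0//.
  rewrite ler_wpM2r ?invr_ge0 ?(ltW L0)// -[leRHS]mulr1 ler_wpM2l//.
  rewrite normrN normrM (ger0_norm l0) normrM (ger0_norm (ler0n _ 2)).
  rewrite /lorentz mulrC ler_pdivrMr// mul1r.
  have : 0 <= (`|x / L| - 1) ^+ 2 by exact: sqr_ge0.
  rewrite -[(x / L) ^+ 2]real_normK ?num_real//; nra.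
- exact: integ_lorentz.
Qed.

Lemma convolDr (kap f g : R -> R) B x : integ setT kap -> continuous f -> continuous g ->
  (forall y, `|f y| <= B) -> (forall y, `|g y| <= B) ->
  convol kap (fun y => f y + g y) x = convol kap f x + convol kap g x.
Proof.
move=> ik cf cg fB gB; rewrite /convol -RintegralD//.
- by apply: eq_Rintegral => y _; rewrite mulrDr.
- exact: (integ_convol x ik (continuous_measurable_fun cf) fB).
- exact: (integ_convol x ik (continuous_measurable_fun cg) gB).
Qed.

(** A weight that is almost invariant under convolution by a small kernel [kap].  It is a finite
    sum of the iterates of the Lorentzian under convolution by [kap / eps], whose integrals
    decrease geometrically; [chi] comes from the first iterate that is left out. *)
Lemma exists_weight (kap : R -> R) (eps L delta : R) : (forall z, 0 <= kap z) ->
  integ setT kap -> 0 < eps -> Rintegral leb setT kap <= eps / 2 -> 1 <= L -> 0 < delta ->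
  exists phi phi' chi : R -> R, weight L phi phi' /\
   [/\ forall x, lorentz L x <= phi x, forall x, phi x <= 2,
    forall x, convol kap phi x <= eps * phi x + chi x,
    forall x, 0 <= chi x & continuous chi /\ integ setT chi /\ Rintegral leb setT chi <= delta].
Proof.
move=> k0 ik e0 ke L1 d0; have L0 : 0 < L by exact: lt_le_trans L1.
pose kap' z := eps^-1 * kap z.
have k'0 z : 0 <= kap' z by rewrite mulr_ge0// invr_ge0 ltW.
have ik' : integ setT kap' by exact: integZl.
have k'2 : Rintegral leb setT kap' <= 1 / 2.
  by rewrite RintegralZl// mulrC ler_pdivrMr//; lra.
have k'ge : 0 <= Rintegral leb setT kap' by apply: Rintegral_ge0 => z _; exact: k'0.
pose it n := iter n (convol kap') (lorentz L).
pose it' n := iter n (convol kap') (fun x => - lorentz L x ^+ 2 * (2 * (x / L) / L)).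
have itP n : [/\ weight L (it n) (it' n), forall x, it n x <= 2^-1 ^+ n &
    Rintegral leb setT (it n) <= 2^-1 ^+ n * Rintegral leb setT (lorentz L)].
  elim: n => [|n [W B I]].
    split; first exact: weight_lorentz.
      by move=> x; rewrite expr0; exact: lorentz_le1.
    by rewrite expr0 mul1r.
  have [_ _ f0 _ If] := W.
  have cf := weight_continuous W.
  split; first exact: (weight_conv L0 W B k'0 ik').
    move=> x; have mf : measurable_fun [set: MR] (it n) by exact: continuous_measurable_fun.
    have B' y : `|it n y| <= 2^-1 ^+ n by rewrite ger0_norm.
    apply: (le_trans (ler_norm _)); apply: (le_trans (convol_bounded x ik' mf B')).
    under eq_Rintegral => z _ do rewrite ger0_norm//.
    by rewrite exprSr ler_wpM2l ?exprn_ge0// -div1r.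
  rewrite -[it n.+1]/(convol kap' (it n)) (convol_L1 k'0 ik' cf f0 B If).2.
  rewrite exprS -mulrA; apply: ler_pM => //; first by apply: Rintegral_ge0.
  by rewrite -div1r.
pose phi n x := \sum_(i < n.+1) it i x.
pose phi' n x := \sum_(i < n.+1) it' i x.
have phiS n : phi n.+1 = fun x => phi n x + it n.+1 x.
  by apply/funext => x; rewrite /phi big_ord_recr.
have phi'S n : phi' n.+1 = fun x => phi' n x + it' n.+1 x.
  by apply/funext => x; rewrite /phi' big_ord_recr.
have phi0E : phi 0%N = it 0%N by apply/funext => x; rewrite /phi big_ord_recr big_ord0 /= add0r.
have phi'0E : phi' 0%N = it' 0%N by apply/funext => x; rewrite /phi' big_ord_recr big_ord0 /= add0r.
have it0 n x : 0 <= it n x by have [[]] := itP n.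
have phiP n : [/\ weight L (phi n) (phi' n), forall x, lorentz L x <= phi n x,
    forall x, phi n x <= 2 - 2^-1 ^+ n &
    forall x, convol kap' (phi n) x <= phi n x + it n.+1 x].
  elim: n => [|n [W lo up cv]].
    rewrite phi0E phi'0E; have [W B I] := itP 0%N; split => //.
      by move=> x; rewrite expr0 (le_trans (B x))// expr0; lra.
    by move=> x; rewrite -[convol _ _ _]/(it 1%N x) lerDr.
  have [W' B' I'] := itP n.+1.
  rewrite phiS phi'S; split.
  - exact: weightD.
  - by move=> x; rewrite (le_trans (lo x))// lerDl.
  - move=> x; apply: (le_trans (lerD (up x) (B' x))).
    by rewrite exprS; set q := _ ^+ n; lra.
  - move=> x; have [_ _ p0 _ _] := W.
    have b1 y : `|phi n y| <= 2.
      by rewrite ger0_norm// (le_trans (up y))// gerBl exprn_ge0.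
    have b2 y : `|it n.+1 y| <= 2.
      rewrite ger0_norm// (le_trans (B' y))// (@le_trans _ _ 1) ?ler1n//.
      by rewrite exprn_ile1//; lra.
    rewrite (convolDr x ik' (weight_continuous W) (weight_continuous W') b1 b2).
    by rewrite lerD.
have [n hn] : exists n, eps * (2^-1 ^+ n.+1 * Rintegral leb setT (lorentz L)) <= delta.
  set I := Rintegral leb setT (lorentz L).
  have I0 : 0 <= I by apply: Rintegral_ge0 => x _; exact: lorentz_ge0.
  exists (Num.truncn (eps * I / delta)).+1; set n := (Num.truncn _).+1.
  have nI : eps * I / delta < n%:R by exact: truncnS_gt.
  rewrite mulrCA exprVn mulrC ler_pdivrMr ?exprn_gt0// [leRHS]mulrC -ler_pdivrMr//.
  apply: (le_trans (ltW nI)); rewrite -natrX ler_nat.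
  by rewrite (leq_trans (ltnW (ltn_expl n (ltnSn 1))))// leq_exp2l.
exists (phi n), (phi' n), (fun x => eps * it n.+1 x).
have [W lo up cv] := phiP n; have [W' B' I'] := itP n.+1.
split => //; split => //.
- by move=> x; rewrite (le_trans (up x))// gerBl exprn_ge0.
- move=> x; rewrite -mulrDr; have := ler_wpM2l (ltW e0) (cv x).
  apply: le_trans; have [_ _ p0 _ _] := W.
  have b1 y : `|phi n y| <= 2.
    by rewrite ger0_norm// (le_trans (up y))// gerBl exprn_ge0.
  have mp := continuous_measurable_fun (weight_continuous W).
  rewrite (convolC x ik mp b1) (convolC x ik' mp b1) -RintegralZl//; last first.
    exact: (integ_mul_bounded measurableT (measurableT_comp mp (measurable_subl x)) (fun z _ => b1 (x - z)) ik').
  rewrite le_eqVlt; apply/orP; left; apply/eqP/eq_Rintegral => z _.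
  by rewrite /kap' -mulrA mulrA divff ?mul1r// gt_eqF.
- by move=> x; rewrite mulr_ge0// ltW.
- split; first by move=> x; apply: cvgM; [exact: cvg_cst|exact: (weight_continuous W')].
  have [_ _ _ _ Iit] := W'.
  split; first exact: integZl.
  by rewrite RintegralZl//; apply: le_trans hn; rewrite ler_wpM2l// ltW.
Qed.

End Weights.

(** * The commutator with convolution by an odd kernel *)

(** Pointwise bound of the commutator integrand, symmetric in the two points [x] and [y].  Either
    the points are near and the weight [f] varies little, or [kR] is the full majorant of the
    kernel. *)
Lemma young_commutator {R : realType} (k kR c px py fx fy th : R) :
  `|c| <= k -> 0 <= th -> 0 <= fx -> 0 <= fy ->
  (kR = 0 /\ `|fx - fy| <= th * fx /\ `|fx - fy| <= th * fy) \/ kR = k ->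
  `|c * (px * py * (fx - fy))| <=
    2^-1 * (k * (th * (px ^+ 2 * fx)) + kR * (px ^+ 2 * (fx + fy)) +
            (k * (th * (py ^+ 2 * fy)) + kR * (py ^+ 2 * (fy + fx)))).
Proof.
move=> ck th0 fx0 fy0 H.
have k0 : 0 <= k by apply: le_trans ck.
have yg : `|px * py| <= 2^-1 * (px ^+ 2 + py ^+ 2).
  rewrite normrM -(real_normK (num_real px)) -(real_normK (num_real py)).
  have : 0 <= (`|px| - `|py|) ^+ 2 by exact: sqr_ge0.
  by rewrite sqrrB; set a := `|px|; set b := `|py|; lra.
have X0 := sqr_ge0 px; have Y0 := sqr_ge0 py.
rewrite !normrM -normrM; set d := `|fx - fy| in H *.
have d0 : 0 <= d by exact: normr_ge0.
apply: (@le_trans _ _ (k * (2^-1 * (px ^+ 2 + py ^+ 2) * d))).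
  by apply: ler_pM => //; rewrite ?mulr_ge0// ler_wpM2r.
have -> : 2^-1 * (k * (th * (px ^+ 2 * fx)) + kR * (px ^+ 2 * (fx + fy)) +
    (k * (th * (py ^+ 2 * fy)) + kR * (py ^+ 2 * (fy + fx)))) =
  2^-1 * ((px ^+ 2 * (k * (th * fx) + kR * (fx + fy))) +
          (py ^+ 2 * (k * (th * fy) + kR * (fx + fy)))) by ring.
have -> : k * (2^-1 * (px ^+ 2 + py ^+ 2) * d) =
  2^-1 * (px ^+ 2 * (k * d) + py ^+ 2 * (k * d)) by ring.
rewrite ler_wpM2l//; case: H => [[-> [h1 h2]]|->].
  by rewrite !mul0r !addr0; apply: lerD; rewrite ler_wpM2l// ler_wpM2l.
have h : d <= fx + fy.
  by apply: (le_trans (ler_normB _ _)); rewrite !ger0_norm.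
have kd : k * d <= k * (fx + fy) by rewrite ler_wpM2l.
by apply: lerD; rewrite ler_wpM2l// (le_trans kd)// lerDr !mulr_ge0.
Qed.

Lemma normB_le4 {R : realType} (a b : R) : `|a| <= 2 -> `|b| <= 2 -> `|a - b| <= 4.
Proof. by move=> a2 b2; rewrite (le_trans (ler_normB _ _))//; lra. Qed.

Lemma normD_le4 {R : realType} (a b : R) : `|a| <= 2 -> `|b| <= 2 -> `|a + b| <= 4.
Proof. by move=> a2 b2; rewrite (le_trans (ler_normD _ _))//; lra. Qed.

Section Commutator.
Context {R : realType}.
Notation MR := (measurableTypeR R).
Variables (K p phi : R -> R) (M theta r0 : R).
Hypothesis iK : integ setT K.
Hypothesis Kodd : {ae leb, forall x : R, K (- x) = - K x}.
Hypotheses (mp : measurable_fun [set: MR] p) (ip : integ setT p).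
Hypothesis pM : forall x, `|p x| <= M.
Hypotheses (cphi : continuous phi) (phi0 : forall x, 0 <= phi x) (phi2 : forall x, phi x <= 2).
Hypothesis theta0 : 0 <= theta.
Hypothesis slow : forall x y, `|x - y| <= r0 -> `|phi x - phi y| <= theta * phi x.

(** An even majorant of [`|K|]. *)
Definition even_kernel (z : R) : R := `|K z| + `|K (- z)|.
(** The part of [even_kernel] at distance more than [r0] from the origin. *)
Definition far_kernel (z : R) : R := if `|z| <= r0 then 0 else even_kernel z.

Lemma even_kernel_ge0 z : 0 <= even_kernel z.
Proof. exact: addr_ge0. Qed.

Lemma far_kernel_ge0 z : 0 <= far_kernel z.
Proof. by rewrite /far_kernel; case: ifP => // _; exact: even_kernel_ge0. Qed.

Lemma even_kernelN z : even_kernel (- z) = even_kernel z.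
Proof. by rewrite /even_kernel opprK addrC. Qed.

Lemma far_kernelN z : far_kernel (- z) = far_kernel z.
Proof. by rewrite /far_kernel normrN even_kernelN. Qed.

Lemma integ_even_kernel : integ setT even_kernel.
Proof.
apply: integD => //; first exact: integ_norm.
have : integ setT (fun z => `|K (0 - z)|).
  by apply: integ_norm => //; exact: (integrable_reflect 0 iK).
by rewrite (_ : (fun z => `|K (0 - z)|) = fun z => `|K (- z)|)//; apply/funext => z; rewrite sub0r.
Qed.

Lemma integ_far_kernel : integ setT far_kernel.
Proof.
apply: (@le_integ R setT _ even_kernel) => //; last exact: integ_even_kernel.
  apply: measurable_fun_ifT => //.
    apply: measurable_fun_ler => //.
  exact: (integ_measurable measurableT integ_even_kernel).
move=> z _; rewrite /far_kernel; case: ifP => _; rewrite ?normr0 ?even_kernel_ge0//.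
by rewrite ger0_norm// even_kernel_ge0.
Qed.

Let M0 : 0 <= M. Proof. exact: le_trans (pM 0). Qed.
Let mphi : measurable_fun [set: MR] phi. Proof. exact: continuous_measurable_fun. Qed.
Let phiN x : `|phi x| <= 2. Proof. by rewrite ger0_norm. Qed.

(* Integrability of a kernel times a bounded function, in each variable. *)
Let integ_kx (kap g : R -> R) B x : integ setT kap -> measurable_fun [set: MR] g ->
  (forall y, `|g y| <= B) -> integ setT (fun y => kap (x - y) * g y).
Proof. by move=> ik mg gB; apply: (@integ_mul_bounded _ _ _ _ B) => //; exact: (integrable_reflect x ik). Qed.

Let integ_ky (kap g : R -> R) B y : integ setT kap -> measurable_fun [set: MR] g ->
  (forall x, `|g x| <= B) -> integ setT (fun x => kap (x - y) * g x).
Proof. by move=> ik mg gB; apply: (@integ_mul_bounded _ _ _ _ B) => //; exact: (integrable_shift (- y) ik). Qed.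

Let measurable_k2 (kap : R -> R) : integ setT kap ->
  measurable_fun [set: MR * MR] (fun q : R * R => kap (q.1 - q.2)).
Proof.
move=> ik; apply: (measurableT_comp (integ_measurable measurableT ik)).
by apply: measurable_funB; [exact: measurable_fst|exact: measurable_snd].
Qed.

Let m1 (g : R -> R) : measurable_fun [set: MR] g -> measurable_fun [set: MR * MR] (fun q : R * R => g q.1).
Proof. by move=> mg; exact: (measurableT_comp mg measurable_fst). Qed.
Let m2 (g : R -> R) : measurable_fun [set: MR] g -> measurable_fun [set: MR * MR] (fun q : R * R => g q.2).
Proof. by move=> mg; exact: (measurableT_comp mg measurable_snd). Qed.

Let reflectE (kap : R -> R) x : integ setT kap ->
  Rintegral leb setT (fun y => kap (x - y)) = Rintegral leb setT kap.
Proof. exact: Rintegral_reflect. Qed.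

(** As [K] is odd, exchanging the two variables turns the factor [phi x] into
    [phi x - phi y]. *)
Let antisym : [/\ integ setT (fun x => p x * phi x * convol K p x),
  integ setT (fun x => Rintegral leb setT (fun y => K (x - y) * (p x * p y * (phi x - phi y)))) &
  2 * Rintegral leb setT (fun x => p x * phi x * convol K p x) =
  Rintegral leb setT (fun x => Rintegral leb setT (fun y => K (x - y) * (p x * p y * (phi x - phi y))))].
Proof.
pose F (q : R * R) := K (q.1 - q.2) * (p q.1 * p q.2 * phi q.1).
have mF : measurable_fun [set: MR * MR] F.
  apply: measurable_funM; first exact: measurable_k2.
  apply: measurable_funM; last exact: m1.
  by apply: measurable_funM; [exact: m1|exact: m2].
have ppM x y : `|p x * p y * phi x| <= M * M * 2.
  by rewrite !normrM; apply: ler_pM => //; apply: ler_pM.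
have ppM' x y : `|p x * p y * phi y| <= M * M * 2.
  by rewrite !normrM; apply: ler_pM => //; apply: ler_pM.
have F1 x : integ setT (fun y => F (x, y)).
  apply: (integ_kx x iK _ (ppM x)).
  by do 2 apply: measurable_funM => //.
have F2 y : integ setT (fun x => F (x, y)).
  apply: (integ_ky y iK _ (fun x => ppM x y)).
  by do 2 apply: measurable_funM => //.
pose k1 := Rintegral leb setT (fun z => `|K z|).
have ia : integ setT (fun x => `|p x| * (M * 2 * k1)) by apply: integZr => //; exact: integ_norm.
have [|I0 I E] := Rintegral_fubini mF F1 F2 ia.
  move=> x; rewrite /F /=.
  have iKx : integ setT (fun y => `|K (x - y)|).
    by apply: integ_norm => //; exact: (integrable_reflect x iK).
  rewrite mulrA /k1 -(reflectE x (integ_norm measurableT iK)) -RintegralZl//.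
  apply: le_Rintegral; [by []|exact: (integ_norm measurableT (F1 x))|exact: (integZl _ measurableT iKx)|].
  move=> y _; rewrite normrM mulrC ler_wpM2r// !normrM -mulrA ler_wpM2l//.
  by apply: ler_pM.
have E1 x : Rintegral leb setT (fun y => F (x, y)) = p x * phi x * convol K p x.
  rewrite /convol -(RintegralZl _ measurableT (integ_kx x iK mp pM)).
  by apply: eq_Rintegral => y _; rewrite /F /=; ring.
have i1 x : integ setT (fun y => K (x - y) * (p x * p y * phi y)).
  apply: (integ_kx x iK _ (ppM' x)).
  by do 2 apply: measurable_funM => //.
have FF := ae_filter_ringOfSetsType (@leb R).
have E2 y : Rintegral leb setT (fun x => F (x, y)) =
    - Rintegral leb setT (fun x => K (y - x) * (p y * p x * phi x)).
  rewrite -[RHS]mulN1r -RintegralZl//.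
  congr fine; apply: ae_eq_integral => //.
  - by apply/measurable_EFinP; exact: (integ_measurable measurableT (F2 y)).
  - apply/measurable_EFinP; apply: measurable_funM => //.
    exact: (integ_measurable measurableT (i1 y)).
  - apply: filterS (ae_reflect y Kodd) => x Kx _ /=; congr (_%:E).
    by rewrite /F /= -opprB Kx; ring.
have Ineg : integ setT (fun y => Rintegral leb setT (fun x => K (y - x) * (p y * p x * phi x))).
  have := integZl (-1) measurableT I.
  rewrite (_ : (fun _ => _) = fun y => Rintegral leb setT (fun x => K (y - x) * (p y * p x * phi x)))//.
  by apply/funext => y; rewrite E2 mulN1r opprK.
have EA : Rintegral leb setT (fun x => p x * phi x * convol K p x) =
    Rintegral leb setT (fun x => Rintegral leb setT (fun y => F (x, y))).
  by apply: eq_Rintegral => x _; rewrite E1.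
have IJ : integ setT (fun x => p x * phi x * convol K p x).
  move: I0; rewrite (_ : (fun _ => _) = fun x => p x * phi x * convol K p x)//.
  by apply/funext => x; rewrite E1.
pose g y := Rintegral leb setT (fun x => K (y - x) * (p y * p x * phi x)).
have EB : Rintegral leb setT (fun x => p x * phi x * convol K p x) = - Rintegral leb setT g.
  rewrite EA E; transitivity (Rintegral leb setT (fun y => -1 * g y)).
    by apply: eq_Rintegral => y _; rewrite E2 mulN1r.
  by rewrite RintegralZl// mulN1r.
have EH : (fun x => Rintegral leb setT (fun y => K (x - y) * (p x * p y * (phi x - phi y)))) =
    (fun x => p x * phi x * convol K p x - g x).
  apply/funext => x; rewrite -E1 /g -RintegralB//.
  by apply: eq_Rintegral => y _; rewrite /F /=; ring.
split; [exact: IJ|by rewrite EH; apply: integB|].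
rewrite EH RintegralB//.
by transitivity (Rintegral leb setT (fun x => p x * phi x * convol K p x) - Rintegral leb setT g);
  [rewrite -EB; ring|].
Qed.

Let ik := integ_even_kernel.
Let ikR := integ_far_kernel.
Let nk := Rintegral leb setT even_kernel.
Let nkR := Rintegral leb setT far_kernel.

Lemma integ_sqr_weight : integ setT (fun x => p x ^+ 2 * phi x).
Proof.
rewrite (_ : (fun x => _) = fun x => p x * (p x * phi x)); last first.
  by apply/funext => x; rewrite mulrA.
apply: (@integ_mul_bounded R setT p (fun x => p x * phi x) (M * 2)) => //.
  exact: measurable_funM.
by move=> x _; rewrite normrM; apply: ler_pM.
Qed.

Lemma integ_sqr_conv : integ setT (fun x => p x ^+ 2 * convol far_kernel phi x).
Proof.
have cc := continuous_convol ikR cphi phiN.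
rewrite (_ : (fun x => _) = fun x => p x * (p x * convol far_kernel phi x)); last first.
  by apply/funext => x; rewrite mulrA.
pose B := 2 * Rintegral leb setT (fun z => `|far_kernel z|).
apply: (@integ_mul_bounded R setT p _ (M * B)) => //.
  by apply: measurable_funM => //; exact: continuous_measurable_fun.
move=> x _; rewrite normrM; apply: ler_pM => //.
exact: (convol_bounded x ikR mphi phiN).
Qed.

(* The commutator integrand is at most the mean of [b (x, y)] and [b (y, x)]. *)
Let b (q : R * R) := even_kernel (q.1 - q.2) * (theta * (p q.1 ^+ 2 * phi q.1)) +
  far_kernel (q.1 - q.2) * (p q.1 ^+ 2 * (phi q.1 + phi q.2)).

Let p2M x : `|p x ^+ 2| <= M ^+ 2.
Proof. by rewrite normrX ler_sqr ?nnegrE. Qed.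

Let mp2 : measurable_fun [set: MR] (fun x => p x ^+ 2).
Proof. exact: measurable_funM. Qed.

Let b_ge0 q : 0 <= b q.
Proof.
rewrite /b; apply: addr_ge0.
  apply: mulr_ge0; first exact: even_kernel_ge0.
  by apply: mulr_ge0 => //; apply: mulr_ge0 => //; exact: sqr_ge0.
apply: mulr_ge0; first exact: far_kernel_ge0.
by apply: mulr_ge0; [exact: sqr_ge0|exact: addr_ge0].
Qed.

Let b1 x : integ setT (fun y => b (x, y)).
Proof.
refine (@integD _ _ (fun y => even_kernel (x - y) * (theta * (p x ^+ 2 * phi x)))
  (fun y => far_kernel (x - y) * (p x ^+ 2 * (phi x + phi y))) measurableT _ _).
  exact: (@integZr _ _ (fun y => even_kernel (x - y)) _ measurableT (integrable_reflect x ik)).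
apply: (@integ_kx far_kernel (fun y => p x ^+ 2 * (phi x + phi y)) (M ^+ 2 * 4)) => //.
  apply: measurable_funM => //.
  exact: measurable_funD.
move=> y; rewrite normrM; apply: ler_pM => //.
exact: (normD_le4 (phiN x) (phiN y)).
Qed.

Let b2 y : integ setT (fun x => b (x, y)).
Proof.
refine (@integD _ _ (fun x => even_kernel (x - y) * (theta * (p x ^+ 2 * phi x)))
  (fun x => far_kernel (x - y) * (p x ^+ 2 * (phi x + phi y))) measurableT _ _).
  apply: (@integ_ky even_kernel (fun x => theta * (p x ^+ 2 * phi x)) (theta * (M ^+ 2 * 2))) => //.
    apply: measurable_funM => //.
    exact: measurable_funM.
  move=> x; rewrite normrM ger0_norm// ler_wpM2l// normrM; apply: ler_pM => //.
apply: (@integ_ky far_kernel (fun x => p x ^+ 2 * (phi x + phi y)) (M ^+ 2 * 4)) => //.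
  apply: measurable_funM => //.
  exact: measurable_funD.
move=> x; rewrite normrM; apply: ler_pM => //.
exact: (normD_le4 (phiN x) (phiN y)).
Qed.

Let iKp x : integ setT (fun y => K (x - y) * (p x * p y * (phi x - phi y))).
Proof.
apply: (@integ_kx K (fun y => p x * p y * (phi x - phi y)) (M * M * 4)).
- exact: iK.
- apply: measurable_funM; first exact: measurable_funM.
  exact: measurable_funB.
- move=> y; rewrite normrM; apply: ler_pM => //; last exact: normB_le4.
  by rewrite normrM; exact: ler_pM.
Qed.

Let pointwise x y : `|K (x - y) * (p x * p y * (phi x - phi y))| <= 2^-1 * (b (x, y) + b (y, x)).
Proof.
rewrite /b /= -(even_kernelN (y - x)) -(far_kernelN (y - x)) opprB.
apply: young_commutator; [|exact: theta0|exact: phi0|exact: phi0|].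
  by rewrite /even_kernel lerDl.
rewrite /far_kernel; case: ifPn => [near|_]; [left|by right].
split; first by []; split; first exact: slow.
by rewrite distrC; apply: slow; rewrite distrC.
Qed.

Let b1E x : Rintegral leb setT (fun y => b (x, y)) =
  (theta * nk + nkR) * (p x ^+ 2 * phi x) + p x ^+ 2 * convol far_kernel phi x.
Proof.
have ikx : integ setT (fun y => even_kernel (x - y)) by exact: (integrable_reflect x ik).
have ikRx : integ setT (fun y => far_kernel (x - y)) by exact: (integrable_reflect x ikR).
have i3 : integ setT (fun y => far_kernel (x - y) * phi y) by exact: integ_kx.
transitivity (Rintegral leb setT (fun y =>
    (even_kernel (x - y) * (theta * (p x ^+ 2 * phi x)) +
     far_kernel (x - y) * (p x ^+ 2 * phi x)) +
    p x ^+ 2 * (far_kernel (x - y) * phi y))).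
  by apply: eq_Rintegral => y _; rewrite /b /=; ring.
rewrite RintegralD//; [|by apply: integD => //; exact: integZr|exact: integZl].
rewrite RintegralD//; [|exact: integZr|exact: integZr].
rewrite !RintegralZr// RintegralZl// (reflectE x ik) (reflectE x ikR).
by rewrite /nk /nkR /convol; ring.
Qed.

Lemma commutator_bound :
  integ setT (fun x => p x * phi x * convol K p x) /\
  `|2 * Rintegral leb setT (fun x => p x * phi x * convol K p x)| <=
  (theta * Rintegral leb setT even_kernel + Rintegral leb setT far_kernel) *
    Rintegral leb setT (fun x => p x ^+ 2 * phi x) +
  Rintegral leb setT (fun x => p x ^+ 2 * convol far_kernel phi x).
Proof.
have [I IH EJ] := antisym; split => //; rewrite EJ.
pose a x := (theta * nk + nkR) * (p x ^+ 2 * phi x) + p x ^+ 2 * convol far_kernel phi x.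
have ia : integ setT a.
  by apply: integD => //; [apply: integZl => //; exact: integ_sqr_weight|exact: integ_sqr_conv].
have mb : measurable_fun [set: MR * MR] b.
  apply: measurable_funD.
    apply: measurable_funM; first exact: measurable_k2.
    apply: (m1 (g := fun x => theta * (p x ^+ 2 * phi x))).
    apply: measurable_funM => //.
    exact: measurable_funM.
  apply: measurable_funM; first exact: measurable_k2.
  apply: measurable_funM; first exact: (m1 mp2).
  by apply: measurable_funD; [exact: (m1 mphi)|exact: (m2 mphi)].
have [|J1 J2 E] := Rintegral_fubini mb b1 b2 ia.
  move=> x; rewrite -[a x]/(_ + _) -b1E le_eqVlt; apply/orP; left; apply/eqP.
  by apply: eq_Rintegral => y _; rewrite ger0_norm.
have Ea : Rintegral leb setT a = Rintegral leb setT (fun x => Rintegral leb setT (fun y => b (x, y))).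
  by apply: eq_Rintegral => x _; rewrite b1E.
have E' : Rintegral leb setT (fun x => Rintegral leb setT (fun y => b (y, x))) =
    Rintegral leb setT a.
  by rewrite Ea; exact: esym E.
rewrite -RintegralZl; [|by []|exact: integ_sqr_weight].
rewrite -RintegralD; [|by []|exact: (integZl _ measurableT integ_sqr_weight)|exact: integ_sqr_conv].
rewrite -[leRHS]/(Rintegral leb setT a).
pose H x := Rintegral leb setT (fun y => K (x - y) * (p x * p y * (phi x - phi y))).
have Hb x : `|H x| <= 2^-1 * (Rintegral leb setT (fun y => b (x, y)) + Rintegral leb setT (fun y => b (y, x))).
  have i1 := b1 x; have i2 := b2 x.
  rewrite -(RintegralD measurableT i1 i2) -(RintegralZl _ measurableT (integD measurableT i1 i2)).
  apply: (Rintegral_norm_le measurableT (iKp x) (integZl _ measurableT (integD measurableT i1 i2))).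
  by move=> y _; exact: pointwise.
have -> : Rintegral leb setT a = Rintegral leb setT (fun x =>
    2^-1 * (Rintegral leb setT (fun y => b (x, y)) + Rintegral leb setT (fun y => b (y, x)))).
  rewrite (RintegralZl _ measurableT (integD measurableT J1 J2)) (RintegralD measurableT J1 J2).
  by rewrite -Ea E'; field.
apply: (Rintegral_norm_le measurableT IH (integZl _ measurableT (integD measurableT J1 J2))).
by move=> x _; exact: Hb.
Qed.

End Commutator.

(** * Contribution of the far field *)

Section Tail.
Context {R : realType}.
Notation MR := (measurableTypeR R).

(** The indicator of the segment from [- rho] to [rho]. *)
Definition window (rho : R) : R -> R := \1_(`[- rho, rho]%classic : set MR).

Lemma measurable_window rho : measurable_fun [set: MR] (window rho).
Proof. exact: measurable_indic. Qed.

Lemma integ_window rho : integ setT (window rho).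
Proof. exact: integ_indic. Qed.

Lemma window01 rho x : 0 <= window rho x <= 1.
Proof. by rewrite /window indicE; case: (_ \in _); rewrite ?lexx ler01. Qed.

Lemma window_eq1 rho x : `|x| <= rho -> window rho x = 1.
Proof. by rewrite ler_norml => xr; rewrite /window indicE mem_set//= in_itv. Qed.

Lemma Rintegral_window rho (f : R -> R) :
  Rintegral leb `[- rho, rho] f = Rintegral leb setT (fun x => window rho x * f x).
Proof.
rewrite Rintegral_mkcond; apply: eq_Rintegral => x _.
by rewrite patchE /window indicE; case: (_ \in _); rewrite ?mul1r ?mul0r.
Qed.

Lemma tail_cvg (h : R -> R) : integ setT h ->
  Rintegral leb setT (fun x => h x * (1 - window n%:R x)) @[n --> \oo] --> (0 : R).
Proof.
move=> ih; rewrite (_ : 0 = Rintegral leb setT (fun x : R => h x * 0)); last first.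
  by rewrite RintegralZr// mulr0.
apply: (@Rintegral_dct R setT (fun n x => h x * (1 - window n%:R x)) _ (fun x => `|h x|)) => //.
- move=> n; apply: measurable_funM; first exact: integ_measurable.
  by apply: measurable_funB => //; exact: measurable_window.
- move=> x _; apply: cvgM; first exact: cvg_cst.
  apply: cvg_near_cst; exists (Num.truncn `|x|).+1 => // n /= xn.
  rewrite window_eq1 ?subrr//; apply: (le_trans (ltW (truncnS_gt _))).
  by rewrite ler_nat.
- exact: integ_norm.
- move=> n x _; rewrite normrM ler_piMr//.
  by have /andP[? ?] := window01 n%:R x; rewrite ger0_norm ?subr_ge0// gerBl.
Qed.

(** Contribution of the far field to the nonlocal term. *)
Lemma nonlocal_tail (K k p q phi w : R -> R) (M B : R) :
  integ setT K -> (forall z, `|K z| <= k (- z)) -> integ setT k ->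
  measurable_fun [set: MR] p -> (forall x, `|p x| <= M) ->
  measurable_fun [set: MR] q -> (forall y, `|q y| <= M * w y) -> (forall y, 0 <= w y <= 1) ->
  measurable_fun [set: MR] w ->
  continuous phi -> (forall x, 0 <= phi x) -> (forall x, phi x <= B) -> integ setT phi ->
  `|Rintegral leb setT (fun x => p x * phi x * convol K q x)| <=
    M ^+ 2 * Rintegral leb setT (fun y => convol k phi y * w y).
Proof.
move=> iK Kk ik mp pM mq qw w01 mw cphi phi0 phiB iphi.
have M0 : 0 <= M by apply: le_trans (pM 0).
have qM y : `|q y| <= M.
  by have /andP[_ w1] := w01 y; rewrite (le_trans (qw y))// ler_piMr.
have k0 z : 0 <= k z by have := Kk (- z); rewrite opprK; apply: le_trans.
have mphi : measurable_fun [set: MR] phi by exact: continuous_measurable_fun.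
have phiN x : `|phi x| <= B by rewrite ger0_norm.
pose F (z : R * R) := K (z.1 - z.2) * (p z.1 * phi z.1 * q z.2).
have mF : measurable_fun [set: MR * MR] F.
  apply: measurable_funM.
    apply: (measurableT_comp (integ_measurable measurableT iK)).
    by apply: measurable_funB; [exact: measurable_fst|exact: measurable_snd].
  apply: measurable_funM; last exact: (measurableT_comp mq measurable_snd).
  by apply: measurable_funM;
    [exact: (measurableT_comp mp measurable_fst)|exact: (measurableT_comp mphi measurable_fst)].
have FM x y : `|p x * phi x * q y| <= M * B * M.
  by rewrite !normrM; apply: ler_pM => //; apply: ler_pM.
have F1 x : integ setT (fun y => F (x, y)).
  refine (@integ_mul_bounded R setT (fun y => K (x - y)) (fun y => p x * phi x * q y) _
    measurableT _ (fun y _ => FM x y) (integrable_reflect x iK)).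
  exact: measurable_funM.
have F2 y : integ setT (fun x => F (x, y)).
  refine (@integ_mul_bounded R setT (fun x => K (x - y)) (fun x => p x * phi x * q y) _
    measurableT _ (fun x _ => FM x y) (integrable_shift (- y) iK)).
  by apply: measurable_funM => //; exact: measurable_funM.
pose nK := Rintegral leb setT (fun z => `|K z|).
have iKx x : integ setT (fun y => `|K (x - y)|).
  exact: (integ_norm measurableT (integrable_reflect x iK)).
have ia : integ setT (fun x => phi x * (M * M * nK)) by exact: (integZr _ measurableT iphi).
have [|I0 I1 E] := Rintegral_fubini mF F1 F2 ia.
  move=> x; rewrite mulrA /nK -(Rintegral_reflect x (integ_norm measurableT iK)).
  rewrite -(RintegralZl _ measurableT (iKx x)).
  apply: (le_Rintegral measurableT (integ_norm measurableT (F1 x)) (integZl _ measurableT (iKx x))).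
  move=> y _; rewrite /F /= normrM mulrC ler_wpM2r//.
  have -> : phi x * (M * M) = M * phi x * M by ring.
  rewrite !normrM (ger0_norm (phi0 x)); apply: ler_pM => //; first exact: mulr_ge0.
  by rewrite ler_wpM2r.
have E1 : Rintegral leb setT (fun x => p x * phi x * convol K q x) =
    Rintegral leb setT (fun x => Rintegral leb setT (fun y => F (x, y))).
  apply: eq_Rintegral => x _; rewrite /convol -RintegralZl//.
    by apply: eq_Rintegral => y _; rewrite /F /=; ring.
  exact: (integ_convol x iK mq qM).
have [ic _] := convol_L1 k0 ik cphi phi0 phiB iphi.
have icw : integ setT (fun y => convol k phi y * w y).
  refine (@integ_mul_bounded R setT (convol k phi) w 1 measurableT mw _ ic) => y _.
  by have /andP[? ?] := w01 y; rewrite ger0_norm.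
rewrite E1 E -(RintegralZl _ measurableT icw).
apply: (Rintegral_norm_le measurableT I1 (integZl _ measurableT icw)) => y _.
have iky : integ setT (fun x => k (y - x) * phi x) by exact: (integ_convol y ik mphi phiN).
have -> : M ^+ 2 * (convol k phi y * w y) =
    Rintegral leb setT (fun x => (M ^+ 2 * w y) * (k (y - x) * phi x)).
  by rewrite (RintegralZl _ measurableT iky) /convol; ring.
apply: (Rintegral_norm_le measurableT (F2 y) (integZl _ measurableT iky)) => x _.
rewrite /F /= !normrM (ger0_norm (phi0 x)).
have -> : M ^+ 2 * w y * (k (y - x) * phi x) = k (y - x) * (M * phi x * (M * w y)) by ring.
apply: ler_pM => //; first by rewrite !mulr_ge0.
  by rewrite -[y - x]opprB; exact: Kk.
by apply: ler_pM => //; [exact: mulr_ge0|rewrite ler_wpM2r].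
Qed.

End Tail.

(** * The localised energy *)

Lemma nonlocal_arith {R : realFieldType} (f g A en eps X chi tl : R) :
  2 * f <= A * en + X -> g <= tl -> X <= eps * en + chi ->
  2 * (f + g) <= (A + eps) * en + chi + 2 * tl.
Proof. by move=> h1 h2 h3; rewrite mulrDl; lra. Qed.

Section Energy.
Context {R : realType}.
Notation MR := (measurableTypeR R).
Variables (u : R * R -> R) (T : \bar R).
Hypothesis uC1 : C1_on (slab T) u.

Let ut := 'D_((1, 0) : R * R) u.
Let ux := 'D_((0, 1) : R * R) u.

(** The energy of [u] on a segment, with weight [phi]. *)
Definition energy (phi : R -> R) (rho t : R) : R :=
  Rintegral leb `[- rho, rho] (fun x => u (t, x) ^+ 2 * phi x).

Lemma continuous_at_time (v : R * R -> R) t :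
  (forall x : R, {for (t, x), continuous v}) -> continuous (fun x => v (t, x)).
Proof.
move=> cv x; apply: (@cvg_comp_pair R R (nbhs x) _ (fun=> t) id t x v (cv x)) => //.
exact: cvg_cst.
Qed.

Lemma slab_between t : 0 < t -> (t%:E < T)%E ->
  exists t0 t1, [/\ 0 < t0, t0 < t, t < t1 & (t1%:E < T)%E].
Proof.
move=> t0 tT; exists (t / 2).
have [t1 tt1 t1T] : exists2 t1 : R, t < t1 & (t1%:E < T)%E.
  move: tT; case: (T) => [T'| |//]; last by exists (t + 1); [rewrite ltrDl|rewrite ltry].
  by rewrite lte_fin => tT; exists ((t + T') / 2); rewrite ?lte_fin; lra.
by exists t1; split => //; lra.
Qed.

Lemma is_derive_energy (phi : R -> R) (rho t : R) : continuous phi -> 0 < rho ->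
  0 < t -> (t%:E < T)%E ->
  is_derive t 1 (energy phi rho)
    (Rintegral leb `[- rho, rho] (fun x => 2 * u (t, x) * ut (t, x) * phi x)).
Proof.
move=> cphi rho0 t0 tT; have [ta [tb [ta0 tat ttb tbT]]] := slab_between t0 tT.
pose B : set (R * R) := `[ta, tb] `*` `[- rho, rho].
have slabI s x : ta <= s <= tb -> slab T (s, x).
  move=> /andP[s1 s2]; split => /=; first exact: lt_le_trans s1.
  by apply: le_lt_trans tbT; rewrite lee_fin.
have Bs p : B p -> slab T p.
  by case: p => s x [/=]; rewrite !in_itv/= => sI _; exact: slabI.
have cB : compact B by apply: compact_setX; exact: segment_compact.
pose h (p : R * R) := 2 * u p * ut p * phi p.2.
have ch p : slab T p -> {for p, continuous h}.
  case: p => s x sp; have [du cut _] := uC1 sp.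
  apply: cvgM; first apply: cvgM => //.
    by apply: cvgM; [exact: cvg_cst|exact: differentiable_continuous].
  by apply: (@cvg_comp _ _ _ snd phi _ (nbhs x)); [exact: cvg_snd|exact: cphi].
have [||/= pc /set_mem/= Bc maxc] := @compact_EVT_max _ R (fun p => `|h p|) B _ cB.
- by exists (t, 0); split; rewrite /= in_itv/= ?(ltW tat) ?(ltW ttb)//; apply/andP; split; lra.
- by apply: continuous_in_subspaceT => p /set_mem/Bs/ch; exact: cvg_norm.
have cus s x : slab T (s, x) -> continuous (fun x => u (s, x)).
  by move=> [s0 sT]; exact: (continuous_slice uC1 s0 sT).
have dsub (s x : R) : slab T (s, x) ->
    is_derive s 1 (fun s => u (s, x) ^+ 2 * phi x) (h (s, x)).
  move=> sp; have [du _ _] := uC1 sp.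
  have d1 := is_derive_time du.
  have d2 := is_deriveM (is_deriveX 2 d1) (is_derive_cst (phi x) s 1).
  rewrite [X in is_derive _ _ X _](_ : _ =
    ((fun s => u (s, x)) ^+ 2 * cst (phi x))%R); last first.
    by apply/funext => z; rewrite !fctE.
  move: d2 => /is_derive_eq; apply.
  rewrite scaler0 add0r /h /ut /= -[LHS]/(phi x * _) expr1.
  by rewrite -[X in phi x * X]/(2 * u (s, x) * _); ring.
have I1 s : `]ta, tb[%classic s -> integ (`[- rho, rho]%classic : set MR) (fun x => u (s, x) ^+ 2 * phi x).
  rewrite /= in_itv/= => /andP[s1 s2]; apply: integ_segment; apply: continuous_subspaceT => x.
  have := cus s 0 (slabI s 0 _); rewrite (ltW s1) (ltW s2) => /(_ isT) cu.
  by apply: cvgM; [apply: cvgM; exact: cu|exact: cphi].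
have dE (s x : R) : slab T (s, x) ->
    partial1of2 (fun s x => u (s, x) ^+ 2 * phi x) s x = h (s, x).
  by move=> sp; rewrite /partial1of2 derive1E; case: (dsub s x sp).
have Ioo (s : R) : `]ta, tb[%classic s -> ta <= s <= tb.
  by rewrite /= in_itv/= => /andP[s1 s2]; rewrite !ltW.
have It : `]ta, tb[%classic t by rewrite /= in_itv/= tat ttb.
have H2 s x : `]ta, tb[%classic s -> (`[- rho, rho]%classic : set MR) x ->
    derivable (fun s => u (s, x) ^+ 2 * phi x) s 1.
  by move=> /Ioo sI _; case: (dsub s x (slabI s x sI)).
pose g (x : MR) := `|h pc|.
have H3 x : 0 <= g x by exact: normr_ge0.
have ig : integ (`[- rho, rho]%classic : set MR) g.
  by apply: integ_segment; apply: continuous_subspaceT => x; exact: cvg_cst.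
have H4 s x : `]ta, tb[%classic s -> (`[- rho, rho]%classic : set MR) x ->
    `|partial1of2 (fun s x => u (s, x) ^+ 2 * phi x) s x| <= g x.
  move=> /Ioo sI xI; rewrite dE; last exact: slabI.
  by apply: maxc; rewrite inE; split => //=; rewrite in_itv.
have mI : measurable (`[- rho, rho]%classic : set MR) by exact: measurable_itv.
apply: DeriveDef.
  exact: (@derivable_under_integral _ _ MR leb _ _ mI t _ _ It I1 H2 _ H3 ig H4).
rewrite -derive1E (@differentiation_under_integral _ _ MR leb _ _ mI t _ _ It I1 H2 _ H3 ig H4).
by apply: eq_Rintegral => x _; rewrite dE//; apply: slabI; rewrite !ltW.
Qed.


Variables (G K : R -> R) (M : R).
Hypotheses (iG : integ setT G) (iK : integ setT K) (GK : weak_derivative G K).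
Hypothesis ueq : solves_eq G T u.
Hypothesis uM : forall p, slab T p -> `|u p| <= M.

(** The local part of the energy balance: [2 u^2 u_x phi] is, up to a term with [phi'], the
    derivative of [2 / 3 * u^3 * phi], which leaves boundary terms and a multiple of the energy. *)
Lemma energy_flux (L rho t : R) (phi phi' : R -> R) : 0 < L -> 0 < rho ->
  weight L phi phi' -> 0 < t -> (t%:E < T)%E ->
  Rintegral leb `[- rho, rho] (fun x => 2 * u (t, x) * ut (t, x) * phi x) <=
  2 * Rintegral leb `[- rho, rho]
        (fun x => u (t, x) * phi x * convol K (fun y => u (t, y)) x) +
  2 / 3 * (M / L) * energy phi rho t + 2 / 3 * M ^+ 3 * (phi rho + phi (- rho)).
Proof.
move=> L0 rho0 W t0 tT; have [dphi cphi' phi0 phiL iphi] := W.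
have cphi := weight_continuous W.
have sl x : slab T (t, x) by [].
have uMt x : `|u (t, x)| <= M by exact: uM.
have cu : continuous (fun x => u (t, x)) by exact: (continuous_slice uC1).
have cux : continuous (fun x => ux (t, x)).
  by apply: continuous_at_time => x; have [] := uC1 (sl x).
pose w x := convol K (fun y => u (t, y)) x.
have cw : continuous w by exact: (continuous_convol iK cu uMt).
pose F x := u (t, x) ^+ 3 * phi x.
pose c x := u (t, x) ^+ 3 * phi' x.
pose f x := 3 * u (t, x) ^+ 2 * ux (t, x) * phi x + c x.
pose e x := u (t, x) ^+ 2 * phi x.
have cX n : continuous (fun x => u (t, x) ^+ n).
  move=> x; exact: (@continuous_comp _ _ _ (fun x => u (t, x)) (fun y => y ^+ n) x (cu x) (@exprn_continuous _ n _)).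
have cc : continuous c by move=> x; apply: cvgM; [exact: cX|exact: cphi'].
have ce : continuous e by move=> x; apply: cvgM; [exact: cX|exact: cphi].
have cf : continuous f.
  move=> x; apply: cvgD; last exact: cc.
  apply: cvgM; last exact: cphi.
  by apply: cvgM; [apply: cvgM; [exact: cvg_cst|exact: cX]|exact: cux].
have cb : continuous (fun x => u (t, x) * phi x * w x).
  by move=> x; apply: cvgM; [apply: cvgM; [exact: cu|exact: cphi]|exact: cw].
have dF (x : R) : is_derive x 1 F (f x).
  have [du _ _] := uC1 (sl x).
  have d2 := is_deriveM (is_deriveX 3 (is_derive_space du)) (dphi x).
  rewrite [X in is_derive _ _ X _](_ : _ = ((fun x => u (t, x)) ^+ 3 * phi)%R); last first.
    by apply/funext => z; rewrite /F !fctE.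
  move: d2 => /is_derive_eq; apply.
  rewrite fctE -[LHS]/(u (t, x) ^+ 3 * phi' x + phi x * (3 * u (t, x) ^+ 2 * ux (t, x))).
  by rewrite /f /c; ring.
set I := (`[- rho, rho]%classic : set MR).
have mI : measurable I by exact: measurable_itv.
have ic h : continuous h -> integ I h.
  by move=> ch; apply: integ_segment; exact: continuous_subspaceT.
have E1 : Rintegral leb I (fun x => 2 * u (t, x) * ut (t, x) * phi x) =
   Rintegral leb I (fun x => 2 * (u (t, x) * phi x * w x) + (2 / 3 * c x - 2 / 3 * f x)).
  apply: eq_Rintegral => x _.
  have := forceE iG iK GK uC1 ueq x t0 tT uMt; rewrite -/(w x) /force => <-.
  by rewrite /f -[LHS]/(2 * u (t, x) * 'D_(1, 0) u (t, x) * phi x) -[ux (t, x)]/('D_(0, 1) u (t, x)); field.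
have icc := ic _ cc; have icf := ic _ cf; have icb := ic _ cb; have ice := ic _ ce.
have rr : - rho < rho by lra.
have ic1 := integZl (2 / 3) mI icc; have if1 := integZl (2 / 3) mI icf.
rewrite E1 (RintegralD mI (integZl 2 mI icb) (integB mI ic1 if1)) (RintegralB mI ic1 if1).
rewrite (RintegralZl _ mI icb) (RintegralZl _ mI icc) (RintegralZl _ mI icf).
rewrite (Rintegral_FTC rr dF cf) -addrA lerD2l.
have Mge0 : 0 <= M by exact: le_trans (uMt 0).
have cle : Rintegral leb I c <= M / L * energy phi rho t.
  rewrite /energy -/I -RintegralZl//; apply: le_Rintegral => //; first exact: integZl.
  move=> x _; apply: (le_trans (ler_norm _)); rewrite /c normrM.
  have -> : M / L * (u (t, x) ^+ 2 * phi x) = (u (t, x) ^+ 2 * M) * (phi x / L).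
    by field; rewrite gt_eqF.
  apply: ler_pM => //; rewrite exprSr normrM ger0_norm ?sqr_ge0//.
  by rewrite ler_wpM2l// sqr_ge0.
have Fle x : `|F x| <= M ^+ 3 * phi x.
  rewrite /F normrM (ger0_norm (phi0 x)) ler_wpM2r// normrX.
  by rewrite lerXn2r// nnegrE.
move: cle (Fle rho) (Fle (- rho)); rewrite !ler_norml => cle /andP[_ _] _.
move: (Fle rho) (Fle (- rho)); rewrite !ler_norml => /andP[h1 _] /andP[_ h2].
have : 2 / 3 * Rintegral leb I c <= 2 / 3 * (M / L * energy phi rho t).
  by rewrite ler_wpM2l//; lra.
move: h1 h2; rewrite -mulrA; set A := M / L * _; rewrite -mulrA mulrDr.
by lra.
Qed.

(** The nonlocal part of the energy balance.  The function is cut into its part [p] inside the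
    segment and its part [q] outside; the first is treated by the commutator bound, the second by
    the decay of the weight. *)
Lemma energy_nonlocal (rho t theta r0 eps : R) (phi chi : R -> R) :
  {ae leb, forall x : R, K (- x) = - K x} -> 0 < t -> (t%:E < T)%E ->
  continuous phi -> (forall x, 0 <= phi x) -> (forall x, phi x <= 2) -> integ setT phi ->
  0 <= theta -> (forall x y, `|x - y| <= r0 -> `|phi x - phi y| <= theta * phi x) ->
  (forall x, convol (far_kernel K r0) phi x <= eps * phi x + chi x) ->
  (forall x, 0 <= chi x) -> integ setT chi ->
  2 * Rintegral leb `[- rho, rho]
        (fun x => u (t, x) * phi x * convol K (fun y => u (t, y)) x) <=
  (theta * Rintegral leb setT (even_kernel K) + Rintegral leb setT (far_kernel K r0) + eps)
    * energy phi rho t + M ^+ 2 * Rintegral leb setT chi +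
  2 * (M ^+ 2 * Rintegral leb setT
         (fun y => convol (even_kernel K) phi y * (1 - window rho y))).
Proof.
move=> Kodd t0 tT cphi phi0 phi2 iphi th0 slow cchi chi0 ichi.
have uMt x : `|u (t, x)| <= M by exact: uM.
have Mge0 : 0 <= M by exact: le_trans (uMt 0).
have cu : continuous (fun x => u (t, x)) by exact: (continuous_slice uC1).
have mu : measurable_fun [set: MR] (fun x => u (t, x)) by exact: continuous_measurable_fun.
have mphi : measurable_fun [set: MR] phi by exact: continuous_measurable_fun.
pose w x := convol K (fun y => u (t, y)) x.
have cw : continuous w by exact: (continuous_convol iK cu uMt).
have mw : measurable_fun [set: MR] w by exact: continuous_measurable_fun.
pose W := window rho.
have mW : measurable_fun [set: MR] W by exact: measurable_window.
have W01 x : 0 <= W x <= 1 by exact: window01.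
have W1 x : 0 <= 1 - W x <= 1 by move: (W01 x); lra.
have m1W : measurable_fun [set: MR] (fun x => 1 - W x).
  by apply: measurable_funB.
pose p x := u (t, x) * W x.
pose q x := u (t, x) * (1 - W x).
have mp : measurable_fun [set: MR] p by exact: measurable_funM.
have mq : measurable_fun [set: MR] q by exact: measurable_funM.
have qW y : `|q y| <= M * (1 - W y).
  have /andP[h _] := W1 y.
  by rewrite /q normrM (ger0_norm h) ler_wpM2r.
have qM y : `|q y| <= M.
  by have /andP[_ h] := W1 y; rewrite (le_trans (qW y))// ler_piMr.
have pM y : `|p y| <= M.
  have /andP[h0 h1] := W01 y.
  by rewrite /p normrM (ger0_norm h0); apply: (le_trans (ler_wpM2r h0 (uMt y))); rewrite ler_piMr.
have ip : integ setT p.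
  rewrite (_ : p = fun x => W x * u (t, x)); last by apply/funext => x; rewrite /p mulrC.
  by apply: (@integ_mul_bounded R setT W _ M) => //; exact: integ_window.
have [icp cb] := commutator_bound iK Kodd mp ip pM cphi phi0 phi2 th0 slow.
have WW x : W x * W x = W x.
  by rewrite /W /window indicE; case: (_ \in _); rewrite ?mulr1 ?mulr0.
have EE : energy phi rho t = Rintegral leb setT (fun x => p x ^+ 2 * phi x).
  rewrite /energy Rintegral_window; apply: eq_Rintegral => x _.
  by rewrite /p -/W exprMn (expr2 (W x)) WW; ring.
have Ew x : w x = convol K p x + convol K q x.
  rewrite /convol -RintegralD//.
  - by apply: eq_Rintegral => y _; rewrite /p /q; ring.
  - exact: (integ_convol x iK mp pM).
  - exact: (integ_convol x iK mq qM).
pose f x := p x * phi x * convol K p x.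
pose g x := p x * phi x * convol K q x.
have ifg : integ setT (fun x => p x * phi x * w x).
  have wM x : `|p x * w x| <= M * (M * Rintegral leb setT (fun z => `|K z|)).
    by rewrite normrM; apply: ler_pM => //; exact: (convol_bounded x iK mu uMt).
  rewrite (_ : (fun x => _) = fun x => phi x * (p x * w x)); last first.
    by apply/funext => x; ring.
  refine (@integ_mul_bounded R setT phi _ _ measurableT _ (fun x _ => wM x) iphi).
  exact: measurable_funM.
have ig : integ setT g.
  rewrite (_ : g = fun x => p x * phi x * w x - f x).
    by apply: integB.
  by apply/funext => x; rewrite /g /f Ew; ring.
have E1 : Rintegral leb `[- rho, rho] (fun x => u (t, x) * phi x * w x) =
    Rintegral leb setT f + Rintegral leb setT g.
  rewrite Rintegral_window -(RintegralD measurableT icp ig); apply: eq_Rintegral => x _.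
  by rewrite /f /g Ew /p -/W; ring.
have gle : `|Rintegral leb setT g| <= M ^+ 2 * Rintegral leb setT
         (fun y => convol (even_kernel K) phi y * (1 - window rho y)).
  apply: (nonlocal_tail iK _ _ mp pM mq qW W1 m1W cphi phi0 phi2 iphi).
    by move=> z; rewrite /even_kernel opprK lerDr.
  exact: integ_even_kernel.
have isq := integ_sqr_weight mp ip pM cphi phi0 phi2.
have cle : Rintegral leb setT (fun x => p x ^+ 2 * convol (far_kernel K r0) phi x) <=
    eps * energy phi rho t + M ^+ 2 * Rintegral leb setT chi.
  rewrite EE -RintegralZl// -RintegralZl// -RintegralD//; first last.
  - exact: integZl.
  - exact: integZl.
  apply: le_Rintegral => //.
  - exact: (integ_sqr_conv r0 iK mp ip pM cphi phi0 phi2).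
  - by apply: integD => //; exact: integZl.
  move=> x _; apply: (@le_trans _ _ (p x ^+ 2 * (eps * phi x + chi x))).
    by rewrite ler_wpM2l// sqr_ge0.
  rewrite mulrDr mulrCA lerD2l ler_wpM2r//.
  by rewrite -real_normK ?num_real// lerXn2r// nnegrE.
have cb' := le_trans (ler_norm _) cb; rewrite -EE in cb'.
have gle' := le_trans (ler_norm _) gle.
have -> : Rintegral leb `[- rho, rho]
    (fun x => u (t, x) * phi x * convol K (fun y => u (t, y)) x) =
  Rintegral leb setT f + Rintegral leb setT g by exact: E1.
exact: (nonlocal_arith cb' gle' cle).
Qed.

End Energy.

(** * Decay of weights *)

Section WeightDecay.
Context {R : realType}.
Notation MR := (measurableTypeR R).
Variables (L : R) (phi phi' : R -> R).
Hypotheses (L0 : 0 < L) (W : weight L phi phi').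

(** [phi x * exp (s * x / L)] is monotone for [s = 1] and [s = -1]. *)
Lemma weight_harnack_ord x y : x <= y ->
  phi y <= expR ((y - x) / L) * phi x /\ phi x <= expR ((y - x) / L) * phi y.
Proof.
move=> xy; have [dphi _ phi0 phiL _] := W.
have dexp (s z : R) : is_derive z 1 (fun z => expR (0 + z * s)) (s * expR (z * s)).
  have := @is_derive1_comp _ (@expR R) (fun z : R => 0 + z * s) z _ _
    (is_derive_expR (0 + z * s)) (is_derive_affine z 0 s).
  by rewrite [in expR (0 + _)]add0r mulrC.
have dm (s z : R) : is_derive z 1 (fun z => phi z * expR (0 + z * s))
    (expR (z * s) * (phi' z + s * phi z)).
  have d2 := is_deriveM (dphi z) (dexp s z).
  move: d2 => /is_derive_eq; apply.
  rewrite -[LHS]/(phi z * (s * expR (z * s)) + expR (0 + z * s) * phi' z) add0r.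
  by ring.
have iL : 0 < L^-1 by rewrite invr_gt0.
split.
- have [z _] := MVT_is_derive xy (dm (- L^-1)).
  set r := _ * (y - x) => E.
  have r0 : r <= 0.
    rewrite /r mulr_le0_ge0 ?subr_ge0// mulr_ge0_le0 ?expR_ge0//.
    have := phiL z; rewrite ler_norml => /andP[_]; lra.
  have {E r0}: phi y * expR (0 + y * - L^-1) <= phi x * expR (0 + x * - L^-1) by lra.
  rewrite -(ler_pM2r (expR_gt0 (y / L))) -!mulrA -!expRD.
  have -> : 0 + y * - L^-1 + y / L = 0 by ring.
  have -> : 0 + x * - L^-1 + y / L = (y - x) / L by ring.
  by rewrite expR0 mulr1 mulrC.
- have [z _] := MVT_is_derive xy (dm (L^-1)).
  set r := _ * (y - x) => E.
  have r0 : 0 <= r.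
    rewrite /r mulr_ge0 ?subr_ge0// mulr_ge0 ?expR_ge0//.
    have := phiL z; rewrite ler_norml => /andP[+ _]; lra.
  have {E r0}: phi x * expR (0 + x * L^-1) <= phi y * expR (0 + y * L^-1) by lra.
  rewrite -(ler_pM2r (expR_gt0 (- x / L))) -!mulrA -!expRD.
  have -> : 0 + x * L^-1 + - x / L = 0 by ring.
  have -> : 0 + y * L^-1 + - x / L = (y - x) / L by ring.
  by rewrite expR0 mulr1 [leRHS]mulrC.
Qed.

Lemma weight_slow r0 x y : `|x - y| <= r0 ->
  `|phi x - phi y| <= (expR (r0 / L) - 1) * phi x.
Proof.
move=> xyr; have [_ _ phi0 _ _] := W.
have mon d : d <= r0 -> expR (d / L) <= expR (r0 / L).
  by move=> dr; rewrite ler_expR ler_pM2r ?invr_gt0.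
have [h1 h2] : phi y <= expR (r0 / L) * phi x /\ phi x <= expR (r0 / L) * phi y.
  have [xy|/ltW xy] := leP x y.
    have [h1 h2] := weight_harnack_ord xy.
    move: xyr; rewrite distrC ger0_norm ?subr_ge0// => /mon m.
    by split; [apply: (le_trans h1)|apply: (le_trans h2)]; rewrite ler_wpM2r.
  have [h1 h2] := weight_harnack_ord xy.
  move: xyr; rewrite ger0_norm ?subr_ge0// => /mon m.
  by split; [apply: (le_trans h2)|apply: (le_trans h1)]; rewrite ler_wpM2r.
have c1 : 1 <= expR (r0 / L).
  rewrite -expR0 ler_expR divr_ge0 ?(ltW L0)//.
  by apply: le_trans xyr.
move: h1 h2 c1; set c := expR _ => h1 h2 c1.
rewrite ler_norml; apply/andP; split; first by move: h1; rewrite mulrBl; lra.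
have [xy|xy] := leP (phi x) (phi y).
  by apply: (@le_trans _ _ 0); [lra|rewrite mulr_ge0//; lra].
have : (c - 1) * phi y <= (c - 1) * phi x by rewrite ler_wpM2l ?(ltW xy)//; lra.
by rewrite !mulrBl; lra.
Qed.

(** An integrable slowly varying weight is small far away: its values at [n] and [- n] are
    at most a constant times its integral outside the segment from [- n] to [n]. *)
Lemma weight_le_tail n :
  phi n%:R <= expR L^-1 * Rintegral leb setT (fun x => phi x * (1 - window n%:R x)) /\
  phi (- n%:R) <= expR L^-1 * Rintegral leb setT (fun x => phi x * (1 - window n%:R x)).
Proof.
have [_ _ phi0 _ iphi] := W.
have w01 (x : R) : 0 <= 1 - window n%:R x <= 1.
  by have := window01 n%:R x; lra.
have mW : measurable_fun [set: MR] (fun x => 1 - window n%:R x).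
  by apply: measurable_funB => //; exact: measurable_window.
have ipw : integ setT (fun x => phi x * (1 - window n%:R x)).
  apply: (@integ_mul_bounded R setT phi _ 1) => // x _.
  by have /andP[a b] := w01 x; rewrite ger0_norm.
have main (b1 b2 : bool) (a z : R) : 
    (forall x, [set` Interval (BSide b1 a) (BSide b2 (a + 1))] x -> `|x - z| <= 1 /\ window n%:R x = 0) ->
    phi z <= expR L^-1 * Rintegral leb setT (fun x => phi x * (1 - window n%:R x)).
  move=> H; set I := [set` _] in H.
  have mI : measurable (I : set MR) by exact: measurable_itv.
  have aa : a < a + 1 by rewrite ltrDl.
  have <- : Rintegral leb (I : set MR) (fun=> phi z) = phi z.
    by rewrite Rintegral_cst_bnd// addrAC subrr add0r mulr1.
  rewrite -(RintegralZl _ measurableT ipw).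
  rewrite [leLHS]Rintegral_mkcond; apply: le_Rintegral => //.
  - apply: (integ_extend mI); first by move=> x Ix; rewrite patchE ifF//; apply/negbTE; rewrite notin_setE.
    apply: (@eq_integrable _ _ _ leb _ mI (EFin \o (fun=> phi z))).
      by move=> x xI; rewrite /= patchE xI.
    apply: (@integ_bounded _ _ _ `|phi z|) => //; exact: leb_bnd_lty.
  - exact: integZl.
  move=> x _; rewrite patchE; case: ifPn => [/set_mem/H[xz ->]|_]; last first.
    by have /andP[? ?] := w01 x; rewrite !mulr_ge0 ?expR_ge0.
  rewrite subr0 mulr1; have := weight_slow xz; rewrite mul1r mulrBl mul1r.
  by rewrite ler_norml => /andP[+ _]; lra.
have wi x : ~~ (`|x| <= n%:R) -> window n%:R x = 0.
  move=> xn; rewrite /window indicE memNset//= in_itv/= -ler_norml; exact/negP.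
split.
- apply: (main false true n%:R) => x /=; rewrite in_itv/= => /andP[nx xn]; split.
    by rewrite ger0_norm; lra.
  by rewrite wi// -ltNge ltr_normr nx.
- apply: (main true true (- n%:R - 1)) => x /=; rewrite subrK in_itv/= => /andP[nx xn]; split.
    by rewrite ler_norml; apply/andP; split; lra.
  by rewrite wi// -ltNge ltr_normr; apply/orP; right; lra.
Qed.

End WeightDecay.

(** * The bound in L^2 *)

(** Gronwall's inequality on a time interval so short that no exponential is needed. *)
Lemma gronwall {R : realType} (E E' : R -> R) (eta err s t : R) :
  0 < s -> s <= t -> (forall z, s <= z <= t -> is_derive z 1 E (E' z)) ->
  (forall z, s <= z <= t -> E' z <= eta * E z + err) ->
  (forall z, s <= z <= t -> 0 <= E z) -> 0 <= eta -> 0 <= err -> eta * t <= 1 / 2 ->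
  E t <= 2 * (E s + err * t).
Proof.
move=> s0 st dE E'le E0 eta0 err0 etat.
(* [H] is nonincreasing. *)
pose H z := E z * (1 - eta * z) - err * z.
have dH z : s <= z <= t -> is_derive z 1 H (E' z * (1 - eta * z) - eta * E z - err).
  move=> zI.
  have d1 : is_derive z 1 (fun z : R => 1 + z * (- eta)) (- eta) by exact: is_derive_affine.
  have d2 : is_derive z 1 (fun z : R => 0 + z * (- err)) (- err) by exact: is_derive_affine.
  have d3 := is_deriveD (is_deriveM (dE z zI) d1) d2.
  rewrite [X in is_derive _ _ X _](_ : _ =
    (E * (fun z : R => 1 + z * (- eta)) + (fun z : R => 0 + z * (- err)))%R); last first.
    by apply/funext => y; rewrite !fctE /H; ring.
  move: d3 => /is_derive_eq; apply.
  by rewrite -[LHS]/(E z * (- eta) + (1 + z * - eta) * E' z - err); ring.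
have le : H t <= H s.
  apply: (@ler0_derive1_nincr _ H s t) => //.
  - move=> z; rewrite in_itv/= => /andP[a b].
    have zI : s <= z <= t by rewrite !ltW.
    by case: (dH z zI).
  - move=> z; rewrite in_itv/= => /andP[a b].
    have zI : s <= z <= t by rewrite !ltW.
    rewrite derive1E; case: (dH z zI) => _ ->.
    have ez : 0 <= eta * z <= 1 / 2.
      apply/andP; split; first by rewrite mulr_ge0// (le_trans (ltW s0))// ltW.
      by apply: le_trans etat; rewrite ler_wpM2l// ltW.
    have h : E' z * (1 - eta * z) <= (eta * E z + err) * (1 - eta * z).
      by rewrite ler_wpM2r ?E'le//; move: ez; lra.
    have h2 : 0 <= (eta * E z + err) * (eta * z).
      have [ez0 _] := andP ez.
      by apply: mulr_ge0 => //; apply: addr_ge0 => //; apply: mulr_ge0 => //; exact: E0.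
    by move: h; rewrite mulrBr mulr1; lra.
  - apply: derivable_within_continuous => z; rewrite in_itv/= => zI.
    by case: (dH z zI).
have Et0 : 0 <= E t by rewrite E0// st lexx.
have Es0 : 0 <= E s by rewrite E0// st lexx.
have h1 : E t * (eta * t) <= E t * (1 / 2) by rewrite ler_wpM2l.
have h2 : 0 <= E s * (eta * s) by rewrite mulr_ge0// mulr_ge0// ltW.
have h3 : 0 <= err * s by rewrite mulr_ge0// ltW.
by move: le; rewrite /H !mulrBr !mulr1; lra.
Qed.

Lemma exp_slope {R : realType} (A sig : R) : 0 <= A -> 0 < sig ->
  exists2 z0 : R, 0 < z0 & forall z, 0 <= z -> z <= z0 -> (expR z - 1) * A <= sig.
Proof.
move=> A0 sig0.
have c : (expR z - 1) * A @[z --> (0 : R)] --> ((expR 0 - 1) * A : R).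
  apply: cvgM; last exact: cvg_cst.
  by apply: cvgB; [exact: continuous_expR|exact: cvg_cst].
rewrite expR0 subrr mul0r in c.
have : \forall z \near (0 : R), (expR z - 1) * A <= sig by exact: (cvgr_le 0 c).
move=> [e /= e0 He]; exists (e / 2); first by rewrite divr_gt0.
move=> z z0 ze; apply: He; rewrite /= sub0r normrN ger0_norm//.
by apply: le_lt_trans ze _; lra.
Qed.

Lemma growth_arith {R : realFieldType} (q c fl M2c M2d tl tA B eps ML en : R) :
  M2c <= M2d -> 2 * q <= (tA + B + eps) * en + M2c + 2 * tl ->
  2 * q + 2 / 3 * ML * en + fl <= (tA + B + eps + 2 / 3 * ML) * en + (M2d + 2 * tl + fl).
Proof. by move=> h1 h2; rewrite [leRHS]addrA mulrDl; lra. Qed.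

Lemma initial_arith {R : realFieldType} (a b f M : R) : `|a| <= M -> 0 <= f -> f <= 2 ->
  a ^+ 2 * f <= 2 * b ^+ 2 + 4 * M * `|a - b|.
Proof.
move=> aM f0 f2; have M0 : 0 <= M by apply: le_trans aM.
have h : a ^+ 2 <= b ^+ 2 + 2 * M * `|a - b|.
  have q := normr_ge0 (a - b).
  have [ab|/ltW ab] := leP `|a| `|b|.
    have : a ^+ 2 <= b ^+ 2.
      by rewrite -(real_normK (num_real a)) -(real_normK (num_real b)) lerXn2r// nnegrE.
    have : 0 <= 2 * M * `|a - b| by rewrite mulr_ge0// mulr_ge0.
    lra.
  have -> : a ^+ 2 = b ^+ 2 + (`|a| + `|b|) * (`|a| - `|b|).
    by rewrite -(real_normK (num_real a)) -(real_normK (num_real b)); ring.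
  rewrite lerD2l; apply: ler_pM; rewrite ?subr_ge0 ?addr_ge0//; first lra.
  exact: lerB_dist.
apply: (le_trans (ler_wpM2l (sqr_ge0 a) f2)); lra.
Qed.

Section InitialEnergy.
Context {R : realType}.
Notation MR := (measurableTypeR R).
Variables (u : R * R -> R) (T : \bar R) (u0 : R -> R) (M N : R).
Hypothesis uC1 : C1_on (slab T) u.
Hypothesis uM : forall p, slab T p -> `|u p| <= M.
Hypothesis mu0 : measurable_fun [set: MR] u0.
Hypothesis u0N : (\int[leb]_x (u0 x ^+ 2)%:E <= (N ^+ 2)%:E)%E.
Hypothesis N0 : 0 < N.
Hypothesis uu0 : initial_data u u0.

(** Near the initial time, the energy is at most three times the square of the norm of the data:
    a factor two is the bound on the weight, and the rest is the contribution of [u - u0]. *)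
Lemma initial_energy (phi : R -> R) (rho : R) : (0 < T)%E -> 0 < rho -> continuous phi ->
  (forall x, 0 <= phi x) -> (forall x, phi x <= 2) ->
  \forall t \near 0^'+, energy u phi rho t <= 3 * N ^+ 2.
Proof.
move=> T0 rho0 cphi phi0 phi2.
have M0 : 0 <= M.
  have [e e0 eT] : exists2 e : R, 0 < e & (e%:E < T)%E.
    move: T0; case: (T) => [T'| |//]; last by exists 1; rewrite ?ltry.
    by rewrite lte_fin => T0; exists (T' / 2); rewrite ?lte_fin; lra.
  by apply: le_trans (uM (conj e0 eT : slab T (e, 0))).
have tT : \forall t \near 0^'+, (t%:E < T)%E.
  move: T0; case: (T) => [T'| |//]; last by move=> _; apply: nearW => t; rewrite ltry.
  by rewrite lte_fin => T0; near=> t; rewrite lte_fin; near: t; exact: nbhs_right_lt.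
pose d := N ^+ 2 / (4 * M + 1).
have d0 : 0 < d by rewrite divr_gt0 ?exprn_gt0//; lra.
have I0 : \forall t \near 0^'+, (\int[leb]_(x in `[(- rho)%R, rho]) (`|u (t, x) - u0 x|)%:E <= d%:E)%E.
  have : nbhs (0%E : \bar R) [set y | (y <= d%:E)%E].
    apply: (@filterS _ (nbhs (0%E : \bar R)) _ [set y | (y < d%:E)%E]) => [y /ltW//|].
    by apply: open_ereal_lt'; rewrite lte_fin.
  by move/(uu0 rho0).
near=> t.
have t0 : 0 < t by near: t; exact: nbhs_right_gt.
have tT' : (t%:E < T)%E by near: t.
have It : (\int[leb]_(x in `[(- rho)%R, rho]) (`|u (t, x) - u0 x|)%:E <= d%:E)%E by near: t.
have cu : continuous (fun x => u (t, x)) by exact: (continuous_slice uC1).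
have muI (D : set MR) f : measurable_fun [set: MR] f -> measurable_fun D f.
  by move=> mf; apply: (measurable_funS _ _ mf).
have mu : measurable_fun [set: MR] (fun x => u (t, x)) by exact: continuous_measurable_fun.
set I := (`[(- rho)%R, rho]%classic : set MR) in It.
have mI : measurable I by exact: measurable_itv.
have iE : integ I (fun x => u (t, x) ^+ 2 * phi x).
  apply: integ_segment; apply: continuous_subspaceT => x.
  by apply: cvgM; [apply: cvgM; exact: cu|exact: cphi].
have EE : (energy u phi rho t)%:E = (\int[leb]_(x in I) (u (t, x) ^+ 2 * phi x)%:E)%E.
  by rewrite /energy /Rintegral fineK//; exact: integrable_fin_num.
have m2 : measurable_fun I (fun x => (u0 x ^+ 2)%:E).
  apply/measurable_EFinP; apply: muI.
  exact: measurable_funX.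
have m1 : measurable_fun I (fun x => (`|u (t, x) - u0 x|)%:E).
  apply/measurable_EFinP; apply: muI.
  by apply: measurableT_comp => //; exact: measurable_funB.
have le : (\int[leb]_(x in I) (u (t, x) ^+ 2 * phi x)%:E <=
   \int[leb]_(x in I) (2%:E * (u0 x ^+ 2)%:E + (4 * M)%:E * (`|u (t, x) - u0 x|)%:E))%E.
  apply: ge0_le_integral => //.
  - by move=> x _; rewrite lee_fin mulr_ge0// sqr_ge0.
  - by apply/measurable_EFinP; exact: (integ_measurable mI iE).
  - by apply: emeasurable_funD; exact: measurable_funeM.
  move=> x _; rewrite -!EFinM -EFinD lee_fin.
  have uMx : `|u (t, x)| <= M by exact: uM.
  exact: initial_arith.
have m2' := measurable_funeM 2%:E m2.
have m1' := measurable_funeM (4 * M)%:E m1.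
have u02 : (\int[leb]_(x in I) (u0 x ^+ 2)%:E <= (N ^+ 2)%:E)%E.
  apply: le_trans u0N; apply: ge0_subset_integral => //.
  - by apply/measurable_EFinP; exact: measurable_funX.
  - by move=> x _; rewrite lee_fin sqr_ge0.
have M4 : 0 <= 4 * M by rewrite mulr_ge0.
rewrite -lee_fin EE; apply: (le_trans le); rewrite ge0_integralD//; first last.
- by move=> x _; rewrite mule_ge0// lee_fin.
- by move=> x _; rewrite mule_ge0// lee_fin// sqr_ge0.
rewrite !ge0_integralZl//; first last.
- by move=> x _; rewrite lee_fin sqr_ge0.
apply: (@le_trans _ _ (2%:E * (N ^+ 2)%:E + (4 * M)%:E * d%:E)%E).
  by apply: leeD; apply: lee_pmul => //; rewrite ?lee_fin//; apply: integral_ge0 => x _;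
    rewrite lee_fin ?sqr_ge0.
rewrite -!EFinM -EFinD lee_fin.
have : 4 * M * d <= N ^+ 2.
  rewrite /d mulrCA ler_piMr ?sqr_ge0// ler_pdivrMr; lra.
lra.
Unshelve. all: by end_near.
Qed.

End InitialEnergy.

(** The parameters are chosen in the order [eps], [r0], [L], [delta], [rho], so that the growth
    rate [eta] of the energy satisfies [eta * t <= 1 / 2] and the source [err] satisfies
    [err * t <= N ^ 2]. *)
Lemma L2_bound {R : realType} (u : R * R -> R) (T : \bar R) (G K u0 : R -> R) (M N t a b : R) :
  C1_on (slab T) u -> integ setT G -> integ setT K -> weak_derivative G K ->
  solves_eq G T u -> (forall p, slab T p -> `|u p| <= M) ->
  {ae leb, forall x : R, K (- x) = - K x} ->
  measurable_fun [set: measurableTypeR R] u0 ->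
  (\int[leb]_x (u0 x ^+ 2)%:E <= (N ^+ 2)%:E)%E -> 0 < N -> initial_data u u0 ->
  0 < t -> (t%:E < T)%E -> a < b ->
  Rintegral leb `[a, b] (fun z => u (t, z) ^+ 2) <= 16 * N ^+ 2.
Proof.
move=> uC1 iG iK GK ueq uM Kodd mu0 u0N N0 uu0 t0 tT ab.
have T0 : (0 < T)%E by apply: lt_trans tT; rewrite lte_fin.
have M0 : 0 <= M by exact: le_trans (normr_ge0 _) (uM (t, 0) (conj t0 tT)).
pose A := Rintegral leb setT (even_kernel K).
have A0 : 0 <= A by apply: Rintegral_ge0 => x _; exact: even_kernel_ge0.
pose eps := (8 * t)^-1.
have e0 : 0 < eps by rewrite invr_gt0 mulr_gt0.
have et : eps * t = 1 / 8 by rewrite /eps; field; rewrite gt_eqF.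
have [n0 far] : exists n0 : nat, Rintegral leb setT (far_kernel K n0%:R) <= eps / 2.
  have e20 : 0 < eps / 2 by rewrite divr_gt0.
  have /(cvgr_le 0)/(_ _ e20) [n0 _ /(_ n0 (leqnn _)) H] := tail_cvg (integ_even_kernel iK).
  exists n0; apply: le_trans H; rewrite le_eqVlt; apply/orP; left; apply/eqP.
  apply: eq_Rintegral => x _; rewrite /far_kernel /window indicE.
  case: ifPn => xn.
    by rewrite mem_set ?subrr ?mulr0//= in_itv/= -ler_norml.
  by rewrite memNset ?subr0 ?mulr1//= in_itv/= -ler_norml; exact/negP.
pose r0 : R := n0%:R.
have [z0 z00 slope] := exp_slope A0 e0.
pose L := 1 + r0 / z0 + `|a| + `|b| + 8 * t * M.
have q1 : 0 <= r0 / z0 by rewrite divr_ge0// ltW.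
have q2 : 0 <= 8 * t * M by rewrite !mulr_ge0// ltW.
have qa := normr_ge0 a; have qb := normr_ge0 b.
have L1 : 1 <= L by rewrite /L; lra.
have L0 : 0 < L by exact: lt_le_trans L1.
pose theta := expR (r0 / L) - 1.
have th0 : 0 <= theta by rewrite /theta subr_ge0 -expR0 ler_expR divr_ge0// ltW.
have thA : theta * A <= eps.
  apply: slope; first by rewrite divr_ge0// ltW.
  rewrite ler_pdivrMr// mulrC -ler_pdivrMr//; rewrite /L; lra.
have ML : M / L <= eps.
  rewrite ler_pdivrMr// /eps mulrC ler_pdivlMr ?mulr_gt0// mulrC /L; lra.
have N2 : 0 < N ^+ 2 by rewrite exprn_gt0.
pose delta := N ^+ 2 / (3 * t * (M ^+ 2 + 1)).
have M2 : 0 < M ^+ 2 + 1 by rewrite ltr_wpDl ?sqr_ge0.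
have d0 : 0 < delta by rewrite divr_gt0 ?mulr_gt0.
have Md : t * (M ^+ 2 * delta) <= N ^+ 2 / 3.
  have -> : t * (M ^+ 2 * delta) = (N ^+ 2 / 3) * (M ^+ 2 / (M ^+ 2 + 1)).
    by rewrite /delta; field; rewrite !gt_eqF.
  by rewrite ler_piMr ?ler_pdivrMr//; lra.
have [phi [phi' [chi [W [lo phi2 cchi chi0 [cc [ichi chid]]]]]]] :=
  exists_weight (far_kernel_ge0 K r0) (integ_far_kernel r0 iK) e0 far L1 d0.
have [dphi cphi' phi0 phiL iphi] := W.
have cphi := weight_continuous W.
have slow x y : `|x - y| <= r0 -> `|phi x - phi y| <= theta * phi x by exact: weight_slow.
pose T1 (n : nat) := Rintegral leb setT (fun x => phi x * (1 - window n%:R x)).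
pose T2 (n : nat) := Rintegral leb setT (fun x => convol (even_kernel K) phi x * (1 - window n%:R x)).
have [ikp _] := convol_L1 (even_kernel_ge0 K) (integ_even_kernel iK) cphi phi0 phi2 iphi.
pose c1 := t * (2 / 3 * M ^+ 3) * (2 * expR L^-1).
have hcvg : c1 * T1 n + 2 * M ^+ 2 * t * T2 n @[n --> \oo] --> (c1 * 0 + 2 * M ^+ 2 * t * 0 : R).
  by apply: cvgD; apply: cvgM; [exact: cvg_cst|exact: tail_cvg|exact: cvg_cst|exact: tail_cvg].
rewrite !mulr0 addr0 in hcvg.
have N3 : 0 < N ^+ 2 * 2 / 3 by lra.
have [n [Ln hn]] : exists n : nat, L <= n%:R /\ c1 * T1 n + 2 * M ^+ 2 * t * T2 n <= N ^+ 2 * 2 / 3.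
  have [m _ Hm] := cvgr_le 0 hcvg _ N3.
  exists (maxn m (Num.truncn L).+1); split; last by apply: Hm; rewrite /= leq_maxl.
  by apply: (le_trans (ltW (truncnS_gt _))); rewrite ler_nat leq_maxr.
pose rho : R := n%:R.
have rho0 : 0 < rho by exact: lt_le_trans Ln.
have [b1 b2] := weight_le_tail L0 W n.
have [s [s0 st Es]] : exists s, [/\ 0 < s, s <= t & energy u phi rho s <= 3 * N ^+ 2].
  near (at_right (0 : R)) => s.
  exists s; split.
  - by near: s; exact: nbhs_right_gt.
  - by near: s; exact: nbhs_right_le.
  - by near: s; exact: (initial_energy uC1 uM mu0 u0N N0 uu0 T0).
pose eta := theta * A + Rintegral leb setT (far_kernel K r0) + eps + 2 / 3 * (M / L).
pose err := M ^+ 2 * delta + 2 * (M ^+ 2 * T2 n) + 2 / 3 * M ^+ 3 * (phi rho + phi (- rho)).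
have M3 : 0 <= M ^+ 3 by rewrite exprn_ge0.
have T20 : 0 <= T2 n.
  apply: Rintegral_ge0 => x _; apply: mulr_ge0.
    by apply: Rintegral_ge0 => y _; rewrite mulr_ge0 ?even_kernel_ge0.
  by have := window01 n%:R x; clear; lra.
have err0 : 0 <= err.
  have h1 : 0 <= M ^+ 2 * delta by rewrite mulr_ge0 ?sqr_ge0// ltW.
  have h2 : 0 <= M ^+ 2 * T2 n by rewrite mulr_ge0 ?sqr_ge0.
  have h3 : 0 <= M ^+ 3 * (phi rho + phi (- rho)) by rewrite mulr_ge0// addr_ge0.
  by rewrite /err; move: h1 h2 h3; clear; lra.
have errt : err * t <= N ^+ 2.
  have h1 : t * (2 / 3 * M ^+ 3) * (phi rho + phi (- rho)) <= c1 * T1 n.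
    have -> : c1 * T1 n = t * (2 / 3 * M ^+ 3) * (2 * expR L^-1 * T1 n) by rewrite /c1; ring.
    have tM : 0 <= t * M ^+ 3 by rewrite mulr_ge0// ltW.
    apply: ler_wpM2l; first by move: tM; clear; lra.
    by move: b1 b2; rewrite -/rho -/(T1 n); clear; lra.
  by move: hn Md h1; rewrite /err; clear; lra.
have eta0 : 0 <= eta.
  have h1 : 0 <= theta * A by exact: mulr_ge0.
  have h2 : 0 <= M / L by rewrite divr_ge0// ltW.
  have h3 : 0 <= Rintegral leb setT (far_kernel K r0).
    by apply: Rintegral_ge0 => x _; exact: far_kernel_ge0.
  by move: h1 h2 h3 e0; rewrite /eta; clear; lra.
have etat : eta * t <= 1 / 2.
  have : eta <= eps * 4 by move: thA far ML e0; rewrite /eta -/r0; clear; lra.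
  by move=> /(ler_wpM2r (ltW t0)); rewrite mulrAC et; clear; lra.
have slabI z : s <= z <= t -> 0 < z /\ (z%:E < T)%E.
  move=> /andP[sz zt]; split; first exact: lt_le_trans sz.
  by apply: le_lt_trans tT; rewrite lee_fin.
have Et : energy u phi rho t <= 2 * (energy u phi rho s + err * t).
  apply: (@gronwall R (energy u phi rho) (fun z => Rintegral leb `[- rho, rho]
    (fun x => 2 * u (z, x) * 'D_((1, 0) : R * R) u (z, x) * phi x)) eta err s t) => //.
  - by move=> z /slabI[z0' zT]; exact: (is_derive_energy uC1 cphi rho0 z0' zT).
  - move=> z /slabI[z0' zT].
    apply: (le_trans (energy_flux uC1 iG iK GK ueq uM L0 rho0 W z0' zT)).
    have := energy_nonlocal uC1 iK uM rho Kodd z0' zT cphi phi0 phi2 iphi th0 slow cchi chi0 ichi.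
    have := ler_wpM2l (sqr_ge0 M) chid.
    rewrite -/A -/(T2 n) /eta /err; exact: growth_arith.
  - move=> z /slabI[z0' zT]; apply: Rintegral_ge0 => x _.
    by apply: mulr_ge0 => //; exact: sqr_ge0.
have E8 : energy u phi rho t <= 8 * N ^+ 2 by move: Et Es errt; clear; lra.
have cu : continuous (fun x => u (t, x)) by exact: (continuous_slice uC1).
apply: (@le_trans _ _ (2 * energy u phi rho t)); last by move: E8; clear; lra.
have iE : integ (`[- rho, rho]%classic : set (measurableTypeR R)) (fun x => u (t, x) ^+ 2 * phi x).
  apply: integ_segment; apply: continuous_subspaceT => x.
  by apply: cvgM; [apply: cvgM; exact: cu|exact: cphi].
have iU : integ (`[a, b]%classic : set (measurableTypeR R)) (fun x => u (t, x) ^+ 2).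
  by apply: integ_segment; apply: continuous_subspaceT => x; apply: cvgM; exact: cu.
have mab : measurable (`[a, b]%classic : set (measurableTypeR R)) by exact: measurable_itv.
have mrr : measurable (`[- rho, rho]%classic : set (measurableTypeR R)) by exact: measurable_itv.
rewrite /energy -RintegralZl// Rintegral_mkcond [leRHS]Rintegral_mkcond.
have iext (D : set (measurableTypeR R)) f : measurable D -> integ D f -> integ setT (f \_ D).
  by move=> mD /(integrable_mkcond _ mD); rewrite restrict_EFin.
apply: le_Rintegral => //; [exact: iext| |].
  by apply: iext => //; exact: integZl.
move=> x _; rewrite !patchE; case: ifPn => [/set_mem/=|_].
  rewrite in_itv/= => /andP[ax xb].
  have xL : `|x| <= L.
    have : x <= `|b| by apply: (le_trans xb); exact: ler_norm.
    have : - `|a| <= x by apply: le_trans ax; rewrite lerNl -normrN ler_norm.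
    by move: qa qb q1 q2; rewrite ler_norml /L; clear; move=> *; apply/andP; split; lra.
  rewrite mem_set/=; last by rewrite in_itv/= -ler_norml (le_trans xL).
  have := ler_wpM2l (sqr_ge0 (u (t, x))) (le_trans (lorentz_ge L0 xL) (lo x)).
  by clear; lra.
by case: ifPn => // _; rewrite mulr_ge0// mulr_ge0// sqr_ge0.
Unshelve. all: by end_near.
Qed.

(** * Null sets of the plane *)

Section ProductNull.
Context {R : realType}.
Notation MR := (measurableTypeR R).

Lemma leb2_ysection (A : set (MR * MR)) : measurable A ->
  leb2 A = (\int[@leb R]_h leb (ysection A h))%E.
Proof.
move=> mA.
have := @product_measure_unique _ _ MR MR R leb leb
  (@product_measure2 _ _ MR MR R leb leb) _ A mA; apply.
by move=> A1 A2 mA1 mA2; exact: (@product_measure2E _ _ MR MR R leb leb).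
Qed.

Lemma leb2_setX (A B : set MR) : measurable A -> measurable B ->
  leb2 (A `*` B) = (leb A * leb B)%E.
Proof. by move=> mA mB; exact: (@product_measure1E _ _ MR MR R leb leb). Qed.

Lemma leb_itv_gt0 (a b : R) : a < b -> (0 < leb (`]a, b[%classic : set MR))%E.
Proof.
move=> ab; have H := @lebesgue_measure_itv R `]a, b[.
by rewrite [X in (_ < X)%E](H : leb (_ : set MR) = _) /= lte_fin ab -EFinD lte_fin subr_gt0.
Qed.

(** Almost every horizontal line meets a null set in a null set. *)
Lemma ae_leb2_sections (P : R * R -> Prop) : {ae @leb2 R, forall p, P p} ->
  {ae @leb R, forall h, {ae @leb R, forall x, P (x, h)}}.
Proof.
move=> [N [mN N0 PN]].
have := @leb2_ysection N mN; rewrite N0 => /esym I0.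
have mf : measurable_fun [set: MR] (fun h => leb (ysection N h)).
  exact: measurable_fun_ysection.
have : {ae @leb R, forall h, leb (ysection N h) = 0%E}.
  have /(ae_eq_integral_abs leb measurableT mf)  : (\int[@leb R]_(h in [set: MR]) `|leb (ysection N h)| = 0)%E.
    by rewrite -[RHS]I0; apply: eq_integral => h _; rewrite gee0_abs.
  have FF := ae_filter_ringOfSetsType (@leb R).
  by apply: filterS => h /(_ I).
have FF := ae_filter_ringOfSetsType (@leb R).
apply: filterS => h Nh0; exists (ysection N h); split => //.
  exact: measurable_ysection.
by move=> x /= Px; rewrite /ysection /= inE; exact: PN.
Qed.

(** A measurable set whose horizontal sections are null is null. *)
Lemma leb2_ae_of_sections (A : set (MR * MR)) : measurable A ->
  (forall h, {ae @leb R, forall x, ~ A (x, h)}) -> {ae @leb2 R, forall p, ~ A p}.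
Proof.
move=> mA H; exists A; split => //; last by move=> p /= /contrapT.
rewrite leb2_ysection// integral0_eq// => h _.
have mAh : measurable (ysection A h) by exact: measurable_ysection.
have [N [mN N0 PN]] := H h.
apply/eqP; rewrite -measure_le0 -N0; apply: le_measure; rewrite ?inE//.
by move=> x; rewrite /ysection /= inE => Ax; apply: PN => /=; exact.
Qed.

Lemma leb2_setT_gt0 : (0 < @leb2 R [set: MR * MR])%E.
Proof.
rewrite -setXTT leb2_setX//; apply: mule_gt0; exact: leb_setT_gt0.
Qed.

(** By continuity, an essential bound on the slab is a pointwise bound. *)
Lemma slab_bound (T : \bar R) (u : R * R -> R) :
  Linfty_on (slab T) u -> C1_on (slab T) u ->
  exists M : R, forall p, slab T p -> `|u p| <= M.
Proof.
rewrite /Linfty_on unlock leb2_setT_gt0; set e := ess_sup _ _ => eoo uC1.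
have e0 : (0 <= e)%E.
  apply: ess_sup_gee; [exact: leb2_setT_gt0|].
  by exists set0; split => // p; apply: contra_notP => _ /=.
have eM : e = (fine e)%:E by rewrite fineK// ge0_fin_numE.
exists (fine e) => -[t x] [/= t0 tT]; rewrite leNgt; apply/negP => Mu.
have [ta [tb [ta0 tat ttb tbT]]] := slab_between t0 tT.
have [du _ _] := uC1 (t, x) (conj t0 tT).
have : \forall q \near ((t, x) : R * R), fine e < `|u q|.
  have cu : `|u q| @[q --> (t, x)] --> `|u (t, x)|.
    by apply: cvg_norm; exact: differentiable_continuous.
  exact: (cvgr_gt _ cu).
move=> [[B1 B2] [/= nB1 nB2] BB].
have [e1 /= e10 H1] := nB1; have [e2 /= e20 H2] := nB2.
have [a [b [ab aB]]] : exists a b : R, a < b /\ forall z, a < z < b ->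
    B1 z /\ 0 < z /\ (z%:E < T)%E.
  exists (Num.max ta (t - e1)), (Num.min tb (t + e1)); split.
    by rewrite gt_max !lt_min; apply/andP; split; apply/andP; split; lra.
  move=> z; rewrite gt_max lt_min => /andP[/andP[z1 z2] /andP[z3 z4]]; split.
    by apply: H1; rewrite /= ltr_norml; apply/andP; split; lra.
  split; first exact: lt_trans z1.
  by apply: lt_trans tbT; rewrite lte_fin.
have cB z : x - e2 < z < x + e2 -> B2 z.
  by move=> /andP[z1 z2]; apply: H2; rewrite /= ltr_norml; apply/andP; split; lra.
have xx : x - e2 < x + e2 by lra.
have [N [mN N0 PN]] := @ess_sup_ge _ _ _ (@leb2 R) (abse \o (EFin \o (u \_ (slab T)))).
pose A1 := (`]a, b[%classic : set MR); pose A2 := (`]x - e2, x + e2[%classic : set MR).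
have mA1 : measurable A1 by exact: measurable_itv.
have mA2 : measurable A2 by exact: measurable_itv.
have : (0 < leb2 (A1 `*` A2))%E.
  by rewrite leb2_setX//; apply: mule_gt0; exact: leb_itv_gt0.
apply/negP; rewrite -leNgt -N0; apply: le_measure; rewrite ?inE//; first exact: measurableX.
move=> [t' x'] []; rewrite /A1 /A2 /= !in_itv/= => /aB[Bt' [t'0 t'T]] /cB Bx'.
apply: PN => /=; apply/negP; rewrite -ltNge -/e eM lte_fin patchE mem_set//.
by apply: (BB (t', x')); split.
Qed.

End ProductNull.

(** * Passing to the initial time *)

Section InitialData.
Context {R : realType}.
Notation MR := (measurableTypeR R).
Variables (u : R * R -> R) (u0 : R -> R) (T : \bar R) (e : R).
Hypothesis uC1 : C1_on (slab T) u.
Hypothesis mu0 : measurable_fun [set: MR] u0.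
Hypothesis uu0 : initial_data u u0.
Hypotheses (e0 : 0 < e) (eT : (e%:E <= T)%E).

(** How much the decrease of [u0] over the distance [h] exceeds [r * h `^ al]. *)
Let excess (r al h x : R) := Num.max 0 (u0 (x - h) - u0 x - r * h `^ al).

Let measurable_excess r al h : measurable_fun [set: MR] (excess r al h).
Proof.
apply: measurable_maxr => //.
apply: measurable_funB => //.
apply: measurable_funB => //.
exact: (measurableT_comp mu0 (measurable_addr (- h))).
Qed.

Lemma initial_difference_segment (r al h m : R) : 0 < h -> 0 < m ->
  (forall t x y, 0 < t -> t < e -> x < y -> u (t, x) - u (t, y) <= r * (y - x) `^ al) ->
  (\int[leb]_(x in `[(- m)%R, m]) (excess r al h x)%:E = 0)%E.
Proof.
move=> h0 m0 H.
set I := (`[(- m)%R, m]%classic : set MR).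
pose J := (`[(- (m + h))%R, (m + h)%R]%classic : set MR).
have mI : measurable I by exact: measurable_itv.
have mJ : measurable J by exact: measurable_itv.
have mh0 : 0 < m + h by exact: addr_gt0.
have mE := measurable_excess r al h.
apply/eqP; rewrite eq_le integral_ge0 ?andbT; last by move=> x _; rewrite lee_fin le_max lexx.
apply/lee_addgt0Pr => d d0; rewrite add0e.
have d20 : 0 < d / 2 by rewrite divr_gt0.
have nd : \forall t \near 0^'+, (\int[leb]_(x in J) (`|u (t, x) - u0 x|)%:E <= (d / 2)%:E)%E.
  have : nbhs (0%E : \bar R) [set y | (y <= (d / 2)%:E)%E].
    apply: (@filterS _ (nbhs (0%E : \bar R)) _ [set y | (y < (d / 2)%:E)%E]) => [y /ltW//|].
    by apply: open_ereal_lt'; rewrite lte_fin.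
  by move/(uu0 mh0).
have [t [t0 te Jt]] : exists t, [/\ 0 < t, t < e &
    (\int[leb]_(x in J) (`|u (t, x) - u0 x|)%:E <= (d / 2)%:E)%E].
  near (at_right (0 : R)) => t; exists t; split.
  - by near: t; exact: nbhs_right_gt.
  - by near: t; exact: nbhs_right_lt.
  - by near: t.
have tT : (t%:E < T)%E by apply: lt_le_trans eT; rewrite lte_fin.
have cu : continuous (fun x => u (t, x)) by exact: (continuous_slice uC1).
have mu : measurable_fun [set: MR] (fun x => u (t, x)) by exact: continuous_measurable_fun.
pose g (x : R) := (`|u (t, x) - u0 x|)%:E.
have g0 x : (0 <= g x)%E by rewrite lee_fin.
have mg : measurable_fun [set: MR] g.
  apply/measurable_EFinP; apply: measurableT_comp => //.
  exact: measurable_funB.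
have mgh : measurable_fun [set: MR] (fun x => g (x - h)).
  exact: (measurableT_comp mg (measurable_addr (- h))).
have sub (f : MR -> \bar R) (D : set MR) : measurable_fun [set: MR] f -> measurable_fun D f.
  by move=> mf; apply: (measurable_funS _ _ mf).
apply: (@le_trans _ _ (\int[leb]_(x in I) (g (x - h)%R + g x)%E)%E).
  apply: ge0_le_integral => //.
  - by move=> x _; rewrite lee_fin le_max lexx.
  - by apply: sub; apply/measurable_EFinP.
  - by apply: sub; exact: emeasurable_funD.
  move=> x _; rewrite -EFinD lee_fin ge_max addr_ge0//=.
  have xh : x - h < x by rewrite ltrBlDr ltrDl.
  have := H t (x - h) x t0 te xh; rewrite (_ : x - (x - h) = h); last by ring.
  move=> Hx.
  have q1 := ler_norm (u0 (x - h) - u (t, x - h)); rewrite distrC in q1.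
  have q2 := ler_norm (u (t, x) - u0 x).
  by move: Hx q1 q2; set a := _ `^ _; lra.
rewrite ge0_integralD//; [|exact: sub|exact: sub].
have -> : d = d / 2 + d / 2 by lra.
rewrite EFinD; apply: leeD.
  apply: le_trans Jt; rewrite integral_mkcond [leRHS]integral_mkcond.
  have mgJ : measurable_fun [set: MR] (g \_ J).
    by apply/(measurable_restrictT _ mJ); exact: sub.
  have gJ0 x : (0 <= (g \_ J) x)%E by rewrite patchE; case: ifP.
  rewrite -(ge0_integral_shift (- h) mgJ gJ0).
  apply: ge0_le_integral => //.
  - by move=> x _; rewrite patchE; case: ifP.
  - by apply/(measurable_restrictT _ mI); exact: sub.
  - exact: (measurableT_comp mgJ (measurable_addr (- h))).
  move=> x _; rewrite patchE; case: ifPn => [/set_mem|_]; last exact: gJ0.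
  rewrite /I /= in_itv/= => /andP[x1 x2].
  by rewrite patchE mem_set// /J /= in_itv/=; apply/andP; split; lra.
apply: le_trans Jt; apply: ge0_subset_integral => //; first exact: sub.
by move=> x; rewrite /I /J /= !in_itv/= => /andP[x1 x2]; apply/andP; split; lra.
Unshelve. all: by end_near.
Qed.

(** A bound on all ratios at small times passes to the initial data, for each fixed distance
    [h]. *)
Lemma initial_difference (r al h : R) : 0 < h ->
  (forall t x y, 0 < t -> t < e -> x < y -> u (t, x) - u (t, y) <= r * (y - x) `^ al) ->
  {ae @leb R, forall x, u0 (x - h) - u0 x <= r * h `^ al}.
Proof.
move=> h0 H.
have FF := ae_filter_ringOfSetsType (@leb R).
have : forall n : nat, {ae @leb R, forall x, (`|x| <= n.+1%:R) -> u0 (x - h) - u0 x <= r * h `^ al}.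
  move=> n; have n0 : (0 : R) < n.+1%:R by [].
  have I0 := initial_difference_segment h0 n0 H.
  have mI : measurable (`[(- n.+1%:R)%R, n.+1%:R]%classic : set MR) by exact: measurable_itv.
  have mE : measurable_fun (`[(- n.+1%:R)%R, n.+1%:R]%classic : set MR) (EFin \o excess r al h).
    apply/measurable_EFinP; apply: (measurable_funS _ _ (measurable_excess r al h)) => //.
  have : (\int[@leb R]_(x in `[(- n.+1%:R)%R, n.+1%:R]) `|(EFin \o excess r al h) x| = 0)%E.
    rewrite -[RHS]I0; apply: eq_integral => x _; rewrite gee0_abs//.
    by rewrite lee_fin le_max lexx.
  move/(ae_eq_integral_abs leb mI mE); apply: filterS => x Hx xn.
  have : (`[(- n.+1%:R)%R, n.+1%:R]%classic : set MR) x by rewrite /= in_itv/= -ler_norml.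
  move/Hx => /= [E0]; rewrite -subr_le0 -[X in _ <= X]E0 /excess le_max lexx orbT//.
move/ae_foralln; apply: filterS => x Hx.
apply: (Hx (Num.truncn `|x|)); exact/ltW/truncnS_gt.
Qed.

End InitialData.

(** * The one-sided seminorm and the norms of the data *)

Section OneSided.
Context {R : realType}.
Notation MR := (measurableTypeR R).
Variables (u0 : R -> R) (s : R).
Hypothesis mu0 : measurable_fun [set: MR] u0.
Hypothesis s0 : 0 <= s.

Lemma one_sided_le (r : R) :
  (forall h, 0 < h -> {ae @leb R, forall x, u0 (x - h) - u0 x <= r * h `^ ((1 + s) / 2)}) ->
  (one_sided_seminorm s u0 <= r%:E)%E.
Proof.
move=> H.
pose g (p : R * R) := u0 (p.1 - p.2) - u0 p.1 - r * p.2 `^ ((1 + s) / 2).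
have mg : measurable_fun [set: MR * MR] g.
  apply: measurable_funB.
    apply: measurable_funB.
      apply: (measurableT_comp mu0).
      by apply: measurable_funB; [exact: measurable_fst|exact: measurable_snd].
    exact: (measurableT_comp mu0 measurable_fst).
  apply: measurable_funM => //.
  exact: (measurableT_comp (measurable_powR _) measurable_snd).
pose A : set (MR * MR) := (snd @^-1` `]0, +oo[%classic) `&` (g @^-1` `]0, +oo[%classic).
have mA : measurable A.
  apply: measurableI.
    by rewrite -[X in measurable X]setTI; apply: measurable_snd => //; exact: measurable_itv.
  by rewrite -[X in measurable X]setTI; apply: mg => //; exact: measurable_itv.
have FF := ae_filter_ringOfSetsType (@leb2 R).
apply/ess_supP; have : {ae @leb2 R, forall p, ~ A p}.
  apply: leb2_ae_of_sections => // h.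
  have [h0|h0] := leP h 0.
    by apply: nearW => x [/= ]; rewrite in_itv/= andbT ltNge h0.
  have FF1 := ae_filter_ringOfSetsType (@leb R).
  apply: filterS (H h h0) => x Hx [/= _]; rewrite in_itv/= andbT /g /=.
  by rewrite ltNge subr_le0 Hx.
apply: filterS => p nA; case: ifPn => [p0|]; last by rewrite leNye.
rewrite lee_fin ler_pdivrMr ?powR_gt0// leNgt; apply/negP => lt; apply: nA.
by split; rewrite /= in_itv/= andbT// /g subr_gt0.
Qed.

Lemma ae_exists (P : R -> Prop) (D : set MR) : measurable D -> (0 < leb D)%E ->
  {ae @leb R, forall x, P x} -> exists2 x, D x & P x.
Proof.
move=> mD D0 [N [mN N0 PN]]; apply/not_exists2P => nP.
move: D0; rewrite -N0; apply/negP; rewrite -leNgt; apply: le_measure; rewrite ?inE//.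
by move=> x Dx; apply: PN => /=; case: (nP x).
Qed.

(** The seminorm of a bounded function is nonnegative: otherwise the function would grow at least
    like a positive power of the distance. *)
Lemma one_sided_ge0 (m : R) : {ae @leb R, forall x, `|u0 x| <= m} ->
  (0 <= one_sided_seminorm s u0)%E.
Proof.
move=> um; rewrite leNgt; apply/negP => Sneg.
have [q q0 Sq] : exists2 q : R, 0 < q & (one_sided_seminorm s u0 <= (- q)%:E)%E.
  move: Sneg; case: (one_sided_seminorm s u0) => [x| |] //.
    by rewrite lte_fin => x0; exists (- x); rewrite ?oppr_gt0// opprK.
  by move=> _; exists 1; rewrite ?leNye.
have m0 : 0 <= m.
  have [x _] := ae_exists measurableT leb_setT_gt0 um.
  exact: le_trans.
have al : 0 < (1 + s) / 2 by move: (s0) => ?; lra.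
pose X := 2 * m / q + 1.
have X0 : 0 < X by rewrite ltr_wpDl// divr_ge0 ?(ltW q0)// mulr_ge0.
pose H := X `^ ((1 + s) / 2)^-1.
have H0 : 0 < H by exact: powR_gt0.
have HX h : H < h -> X <= h `^ ((1 + s) / 2).
  move=> Hh; have -> : X = H `^ ((1 + s) / 2).
    by rewrite /H -powRrM mulVf ?gt_eqF// powRr1// ltW.
  by apply: ge0_ler_powR; rewrite ?nnegrE; apply/ltW => //; exact: lt_trans Hh.
move/ess_supP : Sq => /(@ae_leb2_sections R) Sh.
have HH : H < H + 1 by rewrite ltrDl.
have [h] := ae_exists (measurable_itv `]H, (H + 1)[) (leb_itv_gt0 HH) Sh.
rewrite /= in_itv/= => /andP[Hh _] Px.
have umh : {ae @leb R, forall x, `|u0 (x - h)| <= m} by exact: (ae_shift (- h) um).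
have FF := ae_filter_ringOfSetsType (@leb R).
have [x _ [[x1 x2] x3]] := ae_exists measurableT leb_setT_gt0 (filterI (filterI um umh) Px).
move: x3; rewrite /= (lt_trans H0 Hh) lee_fin ler_pdivrMr ?powR_gt0 ?(lt_trans H0 Hh)//.
have := HX h Hh; set Y := h `^ _ => XY x3.
have : q * X <= q * Y by rewrite ler_pM2l.
rewrite /X mulrDr mulrCA mulfV ?gt_eqF// !mulr1.
by move: x1 x2; rewrite !ler_norml => /andP[? ?] /andP[? ?]; lra.
Qed.

Lemma one_sided_zero : {ae @leb R, forall x, u0 x = 0} -> (one_sided_seminorm s u0 <= 0)%E.
Proof.
move=> z; apply: one_sided_le => h h0; have zh := ae_shift (- h) z.
have FF := ae_filter_ringOfSetsType (@leb R).
apply: filterS (filterI z zh) => x [-> ->]; by rewrite mul0r subrr.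
Qed.

Lemma Lfun2_norm : u0 \in Lfun leb 2%:E -> exists2 N : R, 0 <= N &
  ('N[leb]_2%:E[EFin \o u0] = N%:E)%E /\ (\int[@leb R]_x (u0 x ^+ 2)%:E = (N ^+ 2)%:E)%E.
Proof.
move=> /sub_Lfun_finLfun/set_mem/=; rewrite /finite_norm => Noo.
set I := (\int[_]_x _)%E.
have N0 := Lnorm_ge0 leb 2%:E (EFin \o u0).
have NI : ('N[leb]_2%:E[EFin \o u0] = I `^ 2^-1)%E.
  rewrite unlock; congr (_ `^ _)%E; apply: eq_integral => x _.
  have -> : (`|(EFin \o u0) x| `^ 2)%E = (`|u0 x| `^ 2%:R)%:E by [].
  by rewrite powR_mulrn// real_normK// num_real.
have I0 : (0 <= I)%E by apply: integral_ge0 => x _; rewrite lee_fin sqr_ge0.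
have : (I < +oo)%E.
  rewrite ltey; apply/eqP => Ioo; move: Noo; rewrite NI Ioo poweRyr//.
case: I I0 NI => [i| |]// i0 NI _; exists (i `^ 2^-1); first exact: powR_ge0.
rewrite NI; split => //; congr EFin.
by rewrite -powR_mulrn ?powR_ge0// -powRrM mulVf// powRr1.
Qed.

Lemma Lfunoo_bound : u0 \in Lfun leb +oo%E -> exists m : R, {ae @leb R, forall x, `|u0 x| <= m}.
Proof.
move=> /sub_Lfun_finLfun/set_mem/=; rewrite /finite_norm unlock leb_setT_gt0 => Hoo.
set e := ess_sup _ _ in Hoo.
have e0 : (0 <= e)%E.
  by apply: ess_sup_gee; [exact: leb_setT_gt0|apply: nearW => x /=].
exists (fine e).
have FF := ae_filter_ringOfSetsType (@leb R).
apply: filterS (ess_sup_ge leb (abse \o (EFin \o u0))) => x.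
by rewrite -/e -[e]fineK ?ge0_fin_numE.
Qed.

End OneSided.

(** * Constants *)

Section Constants.
Context {R : realType}.
Variables (s k N r : R).
Hypotheses (s0 : 0 <= s) (s1 : s <= 1) (k0 : 0 <= k) (N0 : 0 < N) (r0 : 0 < r).
Let B := 128 * N `^ (1 + s).

(** The smallness condition of the blow-up argument in terms of the seminorm and the norm. *)
Lemma amplitude_le : 2 ^+ 17 * (k `^ (2 + s) * N `^ (1 + s)) <= r `^ (3 + 2 * s) ->
  k * amplitude s B r <= r ^+ 2 / 8.
Proof.
move=> kr; have [sp s1'] : 0 < 2 + s /\ s <= 1 by move: (s0) (s1) => ? ?; split; lra.
have B0 : 0 < B by rewrite mulr_gt0 ?powR_gt0.
have A0 : 0 <= B * (2 * r) by rewrite mulr_ge0 ?(ltW B0)// mulr_ge0// ltW.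
have am0 : 0 <= amplitude s B r by exact: powR_ge0.
have r8 : 0 <= r ^+ 2 / 8 by rewrite divr_ge0 ?exprn_ge0 ?(ltW r0).
have inv (x : R) : 0 <= x -> (x `^ (2 + s)) `^ (2 + s)^-1 = x.
  by move=> x0; rewrite -powRrM mulfV ?gt_eqF// powRr1.
rewrite -(inv (k * amplitude s B r) (mulr_ge0 k0 am0)) -(inv _ r8).
apply: ge0_ler_powR; rewrite ?nnegrE ?powR_ge0 ?invr_ge0 ?(ltW sp)//.
rewrite powRM// {1}/amplitude -powRrM mulVf ?gt_eqF// powRr1//.
rewrite powRM ?exprn_ge0 ?invr_ge0 ?(ltW r0)// -powR_mulrn ?(ltW r0)// -powRrM.
have -> : 2%:R * (2 + s) = (3 + 2 * s) + 1 :> R by ring.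
rewrite [r `^ (_ + 1)]gt0_powRD// powRr1 ?(ltW r0)//.
have h8 : (2 ^+ 9)^-1 <= 8^-1 `^ (2 + s) :> R.
  have -> : (2 ^+ 9)^-1 = 8^-1 `^ 3 :> R by rewrite powR_mulrn// exprVn -natrX -natrX.
  by apply: ger_powR; [apply/andP; split; lra|lra].
apply: (@le_trans _ _ (r `^ (3 + 2 * s) * r * (2 ^+ 9)^-1)); last first.
  by apply: ler_wpM2l => //; rewrite mulr_ge0 ?powR_ge0// ltW.
have -> : k `^ (2 + s) * (B * (2 * r)) =
    (2 ^+ 17 * (k `^ (2 + s) * N `^ (1 + s))) * r * (2 ^+ 9)^-1.
  by rewrite /B; field.
apply: ler_wpM2r; first by rewrite invr_ge0 exprn_ge0.
by apply: ler_wpM2r => //; exact: ltW.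
Qed.

Lemma powR_expR (a x : R) : (expR a) `^ x = expR (x * a).
Proof. by rewrite /powR gt_eqF ?expR_gt0// expRK. Qed.

(** Up to a constant, the delay is the bound on the lifespan at ratio [r]. *)
Lemma delay_le : delay s B r <= 128 * (N `^ (1 - s) / r `^ 3) `^ (2 + s)^-1.
Proof.
pose a := ln N; pose b := ln r.
have Ea : N = expR a by rewrite lnK.
have Eb : r = expR b by rewrite lnK.
have [sp [sq s1']] : 0 < 2 + s /\ 0 < 1 + s /\ 0 <= 1 - s.
  by move: (s0) (s1) => ? ?; do ! split; lra.
pose p := (2 + s)^-1; pose e := (1 - s) / (1 + s).
have pe : (1 - (1 + s) / 2) / ((1 + s) / 2) = e.
  by rewrite /e; field; rewrite gt_eqF.
have p0 : 0 < p by rewrite invr_gt0.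
have am : amplitude s B r = 256 `^ p * expR (p * ((1 + s) * a + b)).
  rewrite /amplitude -/p -powR_expR -powRM ?expR_ge0 ?ler0n//; congr (_ `^ _).
  by rewrite /B Ea Eb powR_expR expRD; ring.
have p256 : 0 < 256 `^ p :> R by exact: (powR_gt0 _ (ltr0Sn R 255)).
have c0 : 0 < 2 * 256 `^ p :> R by exact: mulr_gt0.
have sprd : spread s B r = (2 * 256 `^ p) `^ e * expR (p * (1 - s) * (a - b)).
  have -> : p * (1 - s) * (a - b) = e * (p * ((1 + s) * a + b) - b).
    by rewrite /e /p; field; rewrite !gt_eqF.
  rewrite /spread pe -powR_expR -powRM ?expR_ge0 ?(ltW c0)//; congr (_ `^ _).
  by rewrite am [in LHS]Eb expRD expRN; ring.
have cb : (2 * 256 `^ p) `^ e <= 32 :> R.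
  have h16 : 256 `^ p <= 16 :> R.
    have -> : 16 = 256 `^ 2^-1 :> R.
      by rewrite (_ : 256 = 16 `^ 2%:R) -?powRrM ?mulfV ?powRr1 ?powR_mulrn// -natrX.
    by apply: ler_powR; [lra|rewrite /p lef_pV2 ?posrE// lerDl].
  have c1 : 1 <= 2 * 256 `^ p :> R.
    have : 1 <= 256 `^ p :> R by rewrite -{1}(powRr0 256); apply: ler_powR; [lra|exact: ltW].
    by lra.
  apply: (@le_trans _ _ (2 * 256 `^ p)); last by lra.
  rewrite -[leRHS]powRr1 ?(ltW c0)//; apply: ler_powR => //.
  by rewrite /e ler_pdivrMr// mul1r; move: (s0) => ?; lra.
have RE : (N `^ (1 - s) / r `^ 3) `^ p = expR (p * (1 - s) * (a - b)) / r.
  have -> : N `^ (1 - s) / r `^ 3 = expR ((1 - s) * a - 3 * b).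
    by rewrite {1}Ea {1}Eb !powR_expR expRD expRN.
  rewrite powR_expR {1}Eb -expRN -expRD; congr expR; rewrite /p; field.
  by rewrite gt_eqF.
rewrite RE /delay sprd.
move: cb; set c := _ `^ e; set w := expR _ => cb.
have -> : 4 * (c * w) / r = 4 * c * (w / r) by ring.
apply: ler_wpM2r; last lra.
by rewrite divr_ge0 ?expR_ge0// ltW.
Qed.

End Constants.

(** * The lifespan *)

Section FinalConstants.
Context {R : realType}.
Variables (s A Z : R).
Hypotheses (s0 : 0 <= s) (s1 : s <= 1) (A0 : 0 <= A) (Z0 : 0 < Z).

Let p := (2 + s)^-1.
Let p0 : 0 < p. Proof. by rewrite invr_gt0; move: (s0) => ?; lra. Qed.

(** Half of a finite seminorm [sg] is a ratio that still satisfies the smallness condition. *)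
Lemma half_threshold (sg : R) : 0 < sg -> 2 ^+ 22 * A <= sg `^ (3 + 2 * s) ->
  2 ^+ 17 * A <= (sg / 2) `^ (3 + 2 * s).
Proof.
move=> sg0 h.
have E : sg `^ (3 + 2 * s) = 2 `^ (3 + 2 * s) * (sg / 2) `^ (3 + 2 * s).
  by rewrite -powRM ?(divr_ge0 (ltW sg0))// [2 * (sg / 2)]mulrC divfK.
have h2 : 2 `^ (3 + 2 * s) <= 2 ^+ 5 :> R.
  rewrite -[leRHS]powR_mulrn//; apply: ler_powR; first lra.
  by move: (s1) => ?; lra.
have := ler_wpM2r (powR_ge0 (sg / 2) (3 + 2 * s)) h2; rewrite -E => h3.
by move: h h3; lra.
Qed.

Lemma half_lifespan (sg : R) : 0 < sg ->
  256 * (Z / (sg / 2) `^ 3) `^ p < 2 ^+ 12 * (Z / sg `^ 3) `^ p.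
Proof.
move=> sg0.
have s3 : 0 < sg `^ 3 by exact: powR_gt0.
have -> : Z / (sg / 2) `^ 3 = 8 * (Z / sg `^ 3).
  rewrite powRM ?(ltW sg0)// [2^-1 `^ 3]powR_mulrn//; field.
  by rewrite gt_eqF.
have W0 : 0 < Z / sg `^ 3 by rewrite divr_gt0.
rewrite powRM ?(ltW W0)//.
have W1 : 0 < (Z / sg `^ 3) `^ p by exact: powR_gt0.
have h8 : 8 `^ p <= 8 :> R.
  rewrite -[leRHS]powRr1//; apply: ler_powR; first lra.
  by rewrite /p invf_le1; move: (s0) => ?; lra.
have := ler_wpM2r (ltW W1) h8; lra.
Qed.

(** For an infinite seminorm, every positive lifespan is excluded by some ratio. *)
Lemma large_ratio (tau : R) : 0 < tau -> exists r : R, [/\ 0 < r,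
  2 ^+ 17 * A <= r `^ (3 + 2 * s) & 256 * (Z / r `^ 3) `^ p < tau].
Proof.
move=> tau0; pose q := tau / 512.
have q0 : 0 < q by move: tau0; rewrite /q; lra.
have qs : 0 < q `^ (2 + s) by exact: powR_gt0.
have Zq : 0 < Z / q `^ (2 + s) by rewrite divr_gt0.
pose r := 1 + 2 ^+ 17 * A + Z / q `^ (2 + s).
have AA : 0 <= 2 ^+ 17 * A by rewrite mulr_ge0 ?exprn_ge0.
have r1 : 1 <= r by rewrite /r; lra.
have r0 : 0 < r by exact: lt_le_trans r1.
have rp x : 1 <= x -> r <= r `^ x.
  by move=> x1; rewrite -{1}(powRr1 (ltW r0)); exact: ler_powR.
exists r; split => //.
  apply: (@le_trans _ _ r); first by rewrite /r; lra.
  by apply: rp; move: (s0) => ?; lra.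
have h : Z / r `^ 3 <= q `^ (2 + s).
  rewrite ler_pdivrMr ?powR_gt0// mulrC -ler_pdivrMr//.
  by apply: le_trans (rp 3 _); [rewrite /r|]; lra.
have : (Z / r `^ 3) `^ p <= (q `^ (2 + s)) `^ p.
  apply: ge0_ler_powR => //; rewrite ?nnegrE ?(ltW p0) ?(ltW qs)//.
  by rewrite divr_ge0 ?powR_ge0// ltW.
rewrite -powRrM mulfV ?powRr1 ?(ltW q0)//; first by rewrite /q; lra.
by rewrite gt_eqF//; move: (s0) => ?; lra.
Qed.

End FinalConstants.

Section Lifespan.
Context {R : realType}.
Notation MR := (measurableTypeR R).
Variables (G K u0 : R -> R) (s : R) (T : \bar R) (u : R * R -> R) (k N : R).
Hypotheses (iG : integ setT G) (iK : integ setT K).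
Hypothesis Geven : {ae leb, forall x : R, G (- x) = G x}.
Hypothesis GK : weak_derivative G K.
Hypothesis mu0 : measurable_fun [set: MR] u0.
Hypothesis u0N : (\int[leb]_x (u0 x ^+ 2)%:E <= (N ^+ 2)%:E)%E.
Hypotheses (s0 : 0 <= s) (s1 : s <= 1) (k0 : 0 <= k) (N0 : 0 < N).
Hypothesis TVk : (TV_seminorm s K <= k%:E)%E.
Hypothesis sol : classical_solution G u0 T u.

(** Every ratio [r] below the seminorm of the data that satisfies the smallness condition bounds
    the lifespan. *)
Lemma lifespan_le (r : R) : 0 < r -> (r%:E < one_sided_seminorm s u0)%E ->
  2 ^+ 17 * (k `^ (2 + s) * N `^ (1 + s)) <= r `^ (3 + 2 * s) ->
  (T <= (256 * (N `^ (1 - s) / r `^ 3) `^ (2 + s)^-1)%:E)%E.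
Proof.
move=> r0 rS kr; have [uoo uC1 ueq uu0] := sol.
have [M uM] := slab_bound uoo uC1.
have Kodd := weak_derivative_odd iG iK GK Geven.
have kamp := amplitude_le s0 s1 k0 N0 r0 kr.
have del := delay_le s0 s1 N0 r0.
set X := _ `^ (2 + s)^-1 in del *.
apply: (@le_trans _ _ (2 * delay s (128 * N `^ (1 + s)) r)%:E); last first.
  by rewrite lee_fin; lra.
rewrite leNgt; apply/negP => dT.
have d0 : 0 <= delay s (128 * N `^ (1 + s)) r.
  by rewrite divr_ge0 ?(ltW r0)// mulr_ge0// powR_ge0.
have [e e0 eT] : exists2 e : R, 0 < e & ((e + 2 * delay s (128 * N `^ (1 + s)) r)%:E < T)%E.
  move: dT; set D := _ * delay _ _ _; case: (T) => [T'| |//]; last by exists 1; rewrite ?ltry.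
  rewrite lte_fin => dT; exists ((T' - D) / 2); first by rewrite divr_gt0// subr_gt0.
  by rewrite lte_fin; lra.
have eT' : (e%:E <= T)%E.
  by apply: le_trans (ltW eT); rewrite lee_fin lerDl mulr_ge0.
have [t [x [y [t0 te xy pair]]]] : exists t x y, [/\ 0 < t, t < e, x < y &
    r * (y - x) `^ ((1 + s) / 2) <= u (t, x) - u (t, y)].
  apply: contrapT => nex; move: rS; apply/negP; rewrite -leNgt.
  apply: one_sided_le => // h h0.
  apply: (initial_difference uC1 mu0 uu0 e0 eT' h0) => t x y t0 te xy.
  by rewrite leNgt; apply/negP => /ltW p; apply: nex; exists t, x, y.
have : (T <= (t + 2 * delay s (128 * N `^ (1 + s)) r)%:E)%E.
  apply: (@blow_up R u T M uC1 uM s k s0 s1 k0 _ _ _ _ r t x y r0 kamp t0 xy pair).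
  - by move=> t' m x' y' t'0 t'T; exact: (force_holder iG iK GK uC1 ueq TVk).
  - by rewrite mulr_gt0 ?powR_gt0.
  - move=> t' a t'0 t'T a0 va z.
    apply: (@sup_bound R (fun y => u (t', y)) s a N z s0 s1 a0 N0 _ va).
      exact: (continuous_slice uC1).
    move=> a' b' ab; exact: (L2_bound uC1 iG iK GK ueq uM Kodd mu0 u0N N0 uu0).
apply/negP; rewrite -ltNge; apply: le_lt_trans eT.
by rewrite lee_fin lerD2r ltW.
Qed.

End Lifespan.

Lemma TV_seminorm_ge0 {R : realType} (s : R) (K : R -> R) : (0 <= TV_seminorm s K)%E.
Proof.
apply: (@le_trans _ _ ('N[leb]_1[EFin \o (fun x => (K (x + 1) - K x)%R)] / (1 `^ s)%:E)%E).
  by rewrite powR1 inve1 mule1 Lnorm_ge0.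
by apply: ereal_sup_ubound; exists 1 => //=.
Qed.

Theorem corollary2p6 (R : realType) :
  exists C c : R, 0 < C /\ 0 < c /\
  forall G K : R -> R,
    G \in Lfun leb 1%E ->
    K \in Lfun leb 1%E ->
    {ae leb, forall x : R, G (- x) = G x} ->
    weak_derivative G K ->
  forall u0 : R -> R,
    u0 \in Lfun leb 2%:E ->
    u0 \in Lfun leb +oo%E ->
  forall s : R, 0 <= s -> s <= 1 ->
    (TV_seminorm s K < +oo)%E ->
    (c%:E * TV_seminorm s K `^ (2 + s) * 'N[leb]_2%:E[EFin \o u0] `^ (1 + s)
       < one_sided_seminorm s u0 `^ (3 + 2 * s))%E ->
  forall (T : \bar R) (u : R * R -> R),
    (0 < T)%E ->
    classical_solution G u0 T u ->
    (T < C%:E * ('N[leb]_2%:E[EFin \o u0] `^ (1 - s) / one_sided_seminorm s u0 `^ 3)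
                  `^ (2 + s)^-1)%E.
Proof.
(* The ratio [r = sg / 2] costs a factor [2 ^ 5] in the smallness condition and a factor [8] in the
   bound [256 * _] on the lifespan; one more factor [2] makes the conclusion strict. *)
exists (2 ^+ 12), (2 ^+ 22); split; first exact: exprn_gt0.
split; first exact: exprn_gt0.
move=> G K GL KL Geven GK u0 u0L2 u0Loo s s0 s1 TVoo big T u T0 sol.
have iG : integ setT G by exact/Lfun1_integrable.
have iK : integ setT K by exact/Lfun1_integrable.
have mu0 : measurable_fun [set: measurableTypeR R] u0.
  by have := sub_Lfun_mfun u0L2; rewrite inE.
have [N N0 [NE N2]] := Lfun2_norm u0L2.
have [m u0m] := Lfunoo_bound u0Loo.
have Sge0 := one_sided_ge0 s0 u0m.
have TV0 := TV_seminorm_ge0 s K.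
have TVE : TV_seminorm s K = (fine (TV_seminorm s K))%:E by rewrite fineK// ge0_fin_numE.
set k := fine _ in TVE.
have k0 : 0 <= k by rewrite -lee_fin -TVE.
have [sp sq] : 0 < 2 + s /\ 0 < 3 + 2 * s by split; lra.
have N_gt0 : 0 < N.
  rewrite lt0r N0 andbT; apply/eqP => NN.
  have z : {ae @leb R, forall x, u0 x = 0}.
    have FF := ae_filter_ringOfSetsType (@leb R).
    have : ('N[leb]_2%:E[EFin \o u0] = 0)%E by rewrite NE NN.
    have mu0' : measurable_fun [set: measurableTypeR R] (EFin \o u0) by exact/measurable_EFinP.
    have p2 : (0 < 2%:E :> \bar R)%E by rewrite lte_fin.
    move/(Lnorm_eq0_eq0 mu0' p2).
    by apply: filterS => x /(_ I) [].
  have S0 : one_sided_seminorm s u0 = 0%E.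
    by apply/eqP; rewrite eq_le Sge0 one_sided_zero.
  by move: big; rewrite S0 poweR0r ?gt_eqF// ltNge !mule_ge0 ?poweR_ge0// lee_fin exprn_ge0.
have main r := @lifespan_le R G K u0 s T u k N iG iK Geven GK mu0
  (eq_ind_r (fun z => (z <= (N ^+ 2)%:E)%E) (lexx _) N2) s0 s1 k0 N_gt0
  (eq_ind_r (fun z => (z <= k%:E)%E) (lexx _) TVE) sol r.
pose A := k `^ (2 + s) * N `^ (1 + s).
have A0 : 0 <= A by rewrite mulr_ge0 ?powR_ge0.
have Z0 : 0 < N `^ (1 - s) by exact: powR_gt0.
move: big Sge0 main; rewrite TVE NE; case: (one_sided_seminorm s u0) => [sg| |//]; last first.
  move=> _ _ main; exfalso.
  have Tfin : T \is a fin_num.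
    have [r [r0 rA _]] := large_ratio s0 A0 Z0 ltr01.
    rewrite fin_numElt (lt_trans (ltNyr 0) T0).
    exact: le_lt_trans (main r r0 (ltry r) rA) (ltry _).
  move: T0 main; rewrite -(fineK Tfin) lte_fin => tau0 main.
  have [r [r0 rA rT]] := large_ratio s0 A0 Z0 tau0.
  by have := main r r0 (ltry r) rA; rewrite lee_fin leNgt rT.
rewrite !poweR_EFin -!EFinM lte_fin => big; rewrite lee_fin => sg0 main.
have sgp : 0 < sg.
  rewrite lt0r sg0 andbT; apply/eqP => sgz.
  move: big; rewrite sgz powR0 ?gt_eqF// ltNge -mulrA -/A mulr_ge0// exprn_ge0//.
have s3 : 0 < sg `^ 3 by exact: powR_gt0.
have big' : 2 ^+ 22 * A <= sg `^ (3 + 2 * s) by rewrite /A mulrA ltW.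
have half0 : 0 < sg / 2 by rewrite divr_gt0.
have halfS : ((sg / 2)%:E < sg%:E)%E by rewrite lte_fin; lra.
apply: le_lt_trans (main (sg / 2) half0 halfS (half_threshold s1 sgp big')) _.
rewrite inver gt_eqF// -!EFinM lte_fin.
exact: (half_lifespan s0 Z0 sgp).
Qed.
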